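(* Let $(R,\mathfrak m)$ and $(S,\mathfrak n)$ be commutative Noetherian local rings, let $\varphi: R\hookrightarrow S$ be a module-finite extension, and let $N$ be a finitely generated $S$-module, also regarded as an $R$-module via $\varphi$. The following statements hold. (a) For each integer $i$, there is an isomorphism $H^i_{\mathfrak n}(N)\cong H^i_{\mathfrak m}(N)$ of Artinian $R$-modules. Moreover, if $H^i_{\mathfrak n}(N)\neq 0$ then $\dim_S(H^i_{\mathfrak n}(N))=\dim_R(H^i_{\mathfrak m}(N))$. (b) $N$ is Cohen-Macaulay (resp. generalized Cohen-Macaulay, $1$-Cohen-Macaulay, sequentially Cohen-Macaulay, sequentially generalized Cohen-Macaulay, sequentially $1$-Cohen-Macaulay) as an $S$-module if and only if $N$ is so as an $R$-module. (c) $R$ is a quotient of a Cohen-Macaulay local ring if and only if $S$ is a quotient of a Cohen-Macaulay local ring.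
   Context: A module-finite extension $\varphi: R\hookrightarrow S$ is an injective ring homomorphism such that $S$ is finitely generated as an $R$-module via $\varphi$. $H^i_{\mathfrak m}(-)$ denotes the $i$-th local cohomology functor with support in $\mathfrak m$. For an Artinian module $A$ over a local ring $R$, $\dim_R(A):=\dim(R/\operatorname{Ann}_RA)$. The dimension of the zero module (and of the zero ring) is $-1$. Let $M$ be a finitely generated module of dimension $d$ over a Noetherian local ring $(R,\mathfrak m)$. Put $\mathfrak a_i(M)=\operatorname{Ann}_RH^i_{\mathfrak m}(M)$ and $\mathfrak a(M)=\mathfrak a_0(M)\cdots\mathfrak a_{d-1}(M)$ (the empty product is $R$). Then $M$ is Cohen-Macaulay (resp. generalized Cohen-Macaulay, $1$-Cohen-Macaulay) if $\dim(R/\mathfrak a(M))=-1$ (resp. $\dim(R/\mathfrak a(M))\le 0$, $\dim(R/\mathfrak a(M))\le 1$); equivalently, for all $i<d$, $H^i_{\mathfrak m}(M)=0$ (resp. $\dim_R H^i_{\mathfrak m}(M)\le 0$, $\dim_R H^i_{\mathfrak m}(M)\le 1$). The dimension filtration of $M$ is the unique filtration $H^0_{\mathfrak m}(M)=D_t\subset\dots\subset D_1\subset D_0=M$ in which, for all $i<t$, $D_{i+1}$ is the largest submodule of $M$ of dimension less than $\dim_R(D_i)$. $M$ is sequentially Cohen-Macaulay (resp. sequentially generalized Cohen-Macaulay, sequentially $1$-Cohen-Macaulay) if each quotient $D_i/D_{i+1}$, $0\le i<t$, is Cohen-Macaulay (resp. generalized Cohen-Macaulay, $1$-Cohen-Macaulay).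 The same definitions apply over $(S,\mathfrak n)$. *)

(* Defs.v *)
From HB Require Import structures.
From mathcomp Require Import all_boot all_order all_algebra.
From mathcomp Require Import boolp constructive_ereal.

Set Implicit Arguments.
Unset Strict Implicit.
Unset Printing Implicit Defensive.

Import Order.TTheory GRing.Theory Num.Theory.
Local Open Scope ring_scope.

(* Submodules are the [submodClosed] predicates of the library, and ideals are
   the submodules of the regular module; unlike [idealr], the latter allows the
   unit ideal, which annihilators and products of ideals may be equal to.      *)
Notation ideal R := (submodClosed R^o).

Section SubmodOf.
Variables (R : pzRingType) (V : lmodType R) (P : V -> Prop).

Definition submod_prop : Prop :=
  P 0 /\ forall a u v, P u -> P v -> P (a *: u + v).

Definition submod_pred (_ : submod_prop) : {pred V} := fun x => `[< P x >].

Variable H : submod_prop.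

Lemma submod_pred_closed : submod_closed (submod_pred H).
Proof.
case: H => P0 PD; split; first exact/asboolP.
by move=> a u v /asboolP Pu /asboolP Pv; apply/asboolP/PD.
Qed.

HB.instance Definition _ :=
  GRing.isSubmodClosed.Build R V (submod_pred H) submod_pred_closed.

Definition submod_of : submodClosed V := submod_pred H.

Lemma submod_ofP x : reflect (P x) (x \in submod_of).
Proof. exact: asboolP. Qed.

End SubmodOf.

Section SubmodType.
Variables (R : pzRingType) (V : lmodType R) (A : submodClosed V).

Record submod_type := SubmodType { submod_val : V; _ : submod_val \in A }.

HB.instance Definition _ := [isSub for submod_val].
HB.instance Definition _ := [Choice of submod_type by <:].
HB.instance Definition _ := [SubChoice_isSubLmodule of submod_type by <:].

End SubmodType.

Section QuotientModule.
Variables (R : pzRingType) (V : lmodType R) (W : submodClosed V).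
Local Open Scope quotient_scope.

Definition submod_zmod_pred : {pred V} := W.
HB.instance Definition _ := GRing.isZmodClosed.Build V submod_zmod_pred
  (GRing.submod_closedB (GRing.submodClosedP W)).
Definition submod_zmod : zmodClosed V := submod_zmod_pred.

Definition quotient_mod : Type := {ideal_quot submod_zmod}.
HB.instance Definition _ := GRing.Zmodule.on quotient_mod.

Definition quotient_pi (x : V) : quotient_mod := \pi_({ideal_quot submod_zmod}) x.
Definition quotient_repr (u : quotient_mod) : V := repr (u : {ideal_quot submod_zmod}).

Lemma quotient_reprK : cancel quotient_repr quotient_pi.
Proof. by move=> u; rewrite /quotient_pi reprK. Qed.

Lemma quotient_eqP x y : reflect (quotient_pi x = quotient_pi y) (x - y \in W).
Proof. by rewrite (Quotient.idealrBE submod_zmod); apply: eqP. Qed.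

Lemma quotient_piD : {morph quotient_pi : x y / x + y}.
Proof. by move=> x y; rewrite /quotient_pi !piE. Qed.

Lemma quotient_pi_repr x : x - quotient_repr (quotient_pi x) \in W.
Proof. by apply/quotient_eqP; rewrite quotient_reprK. Qed.

Definition quotient_scale (a : R) (u : quotient_mod) : quotient_mod :=
  quotient_pi (a *: quotient_repr u).

Lemma quotient_piZ a x : quotient_pi (a *: x) = quotient_scale a (quotient_pi x).
Proof.
by apply/quotient_eqP; rewrite -scalerBr; apply: rpredZ; apply: quotient_pi_repr.
Qed.

Lemma quotient_scaleA a b u :
  quotient_scale a (quotient_scale b u) = quotient_scale (a * b) u.
Proof. by rewrite -(quotient_reprK u) -!quotient_piZ scalerA. Qed.

Lemma quotient_scale1 : left_id 1 quotient_scale.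
Proof. by move=> u; rewrite -(quotient_reprK u) -quotient_piZ scale1r. Qed.

Lemma quotient_scaleDr : right_distributive quotient_scale +%R.
Proof.
move=> a u v; rewrite -(quotient_reprK u) -(quotient_reprK v).
by rewrite -quotient_piD -!quotient_piZ scalerDr quotient_piD.
Qed.

Lemma quotient_scaleDl u : {morph quotient_scale^~ u : a b / a + b}.
Proof.
by move=> a b; rewrite -(quotient_reprK u) -!quotient_piZ scalerDl quotient_piD.
Qed.

HB.instance Definition _ := GRing.Zmodule_isLmodule.Build R quotient_mod
  quotient_scaleA quotient_scale1 quotient_scaleDr quotient_scaleDl.

End QuotientModule.

(* The library only has quotients by proper ideals; here R / I may be zero.    *)
Section QuotientRing.
Variables (R : comPzRingType) (I : ideal R).

Definition quotient_ring : Type := quotient_mod I.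
HB.instance Definition _ := GRing.Zmodule.on quotient_ring.

Let pi (x : R) : quotient_ring := quotient_pi I (x : R^o).
Let rp (u : quotient_ring) : R := quotient_repr u.

Definition quotient_one : quotient_ring := pi 1.
Definition quotient_mul (u v : quotient_ring) : quotient_ring := pi (rp u * rp v).

Let rpK : cancel rp pi. Proof. exact: quotient_reprK. Qed.

Lemma quotient_piM x y : pi (x * y) = quotient_mul (pi x) (pi y).
Proof.
apply/quotient_eqP.
have -> : (x * y : R) - rp (pi x) * rp (pi y) =
    y * (x - rp (pi x)) + rp (pi x) * (y - rp (pi y)).
  by rewrite !mulrBr (mulrC y x) (mulrC y) addrA subrK.
by apply: (@rpredD _ I); apply: (@rpredZ _ _ I); apply: quotient_pi_repr.
Qed.

Lemma quotient_mulA : associative quotient_mul.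
Proof.
by move=> u v w; rewrite -(rpK u) -(rpK v) -(rpK w) -!quotient_piM mulrA.
Qed.

Lemma quotient_mulC : commutative quotient_mul.
Proof. by move=> u v; rewrite /quotient_mul mulrC. Qed.

Lemma quotient_mul1 : left_id quotient_one quotient_mul.
Proof. by move=> u; rewrite -(rpK u) -quotient_piM mul1r. Qed.

Lemma quotient_mulDl : left_distributive quotient_mul +%R.
Proof.
move=> u v w; rewrite -(rpK u) -(rpK v) -(rpK w).
by rewrite -[_ + _]quotient_piD -!quotient_piM -[RHS]quotient_piD mulrDl.
Qed.

HB.instance Definition _ := GRing.Zmodule_isComPzRing.Build quotient_ring
  quotient_mulA quotient_mulC quotient_mul1 quotient_mulDl.

End QuotientRing.

Section Ideals.
Variable R : comPzRingType.
Implicit Types I J : ideal R.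

Lemma ideal_unit_prop : @submod_prop R R^o (fun=> True).
Proof. by split. Qed.

Definition ideal_unit : ideal R := submod_of ideal_unit_prop.

Lemma ideal_mul_prop I J : @submod_prop R R^o (fun x =>
  exists s : seq (R^o * R^o), all (fun p => (p.1 \in I) && (p.2 \in J)) s /\
    x = \sum_(p <- s) (p.1 : R) * p.2).
Proof.
split=> [|a u v [s [sP ->]] [t [tP ->]]]; first by exists [::]; rewrite big_nil.
exists ([seq (a *: p.1, p.2) | p <- s] ++ t); split.
  rewrite all_cat tP andbT all_map; apply: sub_all sP => p /andP[p1 p2] /=.
  by rewrite p2 andbT rpredZ.
rewrite big_cat big_map /= scaler_sumr; congr (_ + _).
by apply: eq_bigr => p _; rewrite -mulrA.
Qed.

Definition ideal_mul I J : ideal R := submod_of (ideal_mul_prop I J).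

Definition ideal_exp I (n : nat) : ideal R := \big[ideal_mul/ideal_unit]_(i < n) I.

Lemma ideal_mul_subr I J : {subset ideal_mul I J <= J}.
Proof.
move=> x /submod_ofP[s [/allP sP ->]]; rewrite big_seq.
apply: (@rpred_sum _ J) => p /sP /andP[_ pJ]; exact: (@rpredZ _ _ J).
Qed.

Lemma ideal_exp_sub I n k : {subset ideal_exp I (k + n) <= ideal_exp I n}.
Proof.
elim: k => // k IH x; rewrite addSn /ideal_exp big_ord_recl => /ideal_mul_subr.
exact: IH.
Qed.

Definition prime_ideal I : Prop :=
  (1 : R^o) \notin I /\
  forall x y : R, (x * y : R^o) \in I -> (x : R^o) \in I \/ (y : R^o) \in I.

Definition maximal_ideal I : Prop :=
  (1 : R^o) \notin I /\
  forall J, {subset I <= J} -> (1 : R^o) \notin J -> {subset J <= I}.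

(* There are primes P_0 < P_1 < ... < P_n of R, all inclusions being strict.   *)
Definition prime_chain (n : nat) : Prop :=
  exists P : nat -> ideal R, (forall i, (i <= n)%N -> prime_ideal (P i)) /\
    forall i, (i < n)%N -> {subset P i <= P i.+1} /\ ~ {subset P i.+1 <= P i}.

(* Chains can be truncated, so the supremum of the n with [prime_chain n] is
   one less than the first n for which [prime_chain n] fails; in particular it
   is -1 for the zero ring.                                                    *)
Definition krull_dim : \bar int :=
  if pselect (exists n, ~~ `[< prime_chain n >]) is left h
  then ((ex_minn h)%:Z - 1)%:E else +oo%E.

End Ideals.

Section ModuleNotions.
Variables (R : comPzRingType) (M : lmodType R).

Definition fin_gen : Prop :=
  exists n (v : 'I_n -> M), forall x, exists a : 'I_n -> R,
    x = \sum_i a i *: v i.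

Definition artinian : Prop :=
  forall D : nat -> submodClosed M, (forall i, {subset D i.+1 <= D i}) ->
    exists n, forall i, (n <= i)%N -> D i =i D n.

Lemma ann_prop : @submod_prop R R^o (fun a => forall x : M, (a : R) *: x = 0).
Proof.
split=> [x|a u v uM vM x]; first by rewrite scale0r.
by rewrite scalerDl -scalerA uM vM scaler0 addr0.
Qed.

Definition ann : ideal R := submod_of ann_prop.

Definition mod_dim : \bar int := krull_dim (quotient_ring ann).

Lemma submod_full_prop : @submod_prop R M (fun=> True).
Proof. by split. Qed.

Definition submod_full : submodClosed M := submod_of submod_full_prop.

Lemma torsion_prop (m : ideal R) : @submod_prop R M (fun x =>
  exists n, forall a : R, (a : R^o) \in ideal_exp m n -> a *: x = 0).
Proof.
split=> [|a u v [n un] [k vk]]; first by exists 0 => a _; rewrite scaler0.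
exists (n + k)%N => b bm.
have bk := ideal_exp_sub bm; rewrite addnC in bm; have bn := ideal_exp_sub bm.
by rewrite scalerDr scalerA mulrC -scalerA un // vk // scaler0 addr0.
Qed.

(* H^0_m(M) as a submodule of M. *)
Definition torsion (m : ideal R) : submodClosed M := submod_of (torsion_prop m).

Lemma submod_restrict_prop (A B : submodClosed M) :
  @submod_prop R (submod_type A) (fun x => submod_val x \in B).
Proof.
split=> [|a u v uB vB]; first by rewrite rpred0.
by rewrite rpredD ?rpredZ.
Qed.

(* A / B for submodules B of A; in general A / (A :&: B). *)
Definition subquotient (A B : submodClosed M) : lmodType R :=
  quotient_mod (submod_of (submod_restrict_prop A B)).

End ModuleNotions.

Definition noetherian (R : comPzRingType) : Prop :=
  forall I : ideal R, fin_gen (submod_type I).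

Definition local_ring (R : comPzRingType) (m : ideal R) : Prop :=
  maximal_ideal m /\ forall m' : ideal R, maximal_ideal m' -> m' =i m.

Definition noetherian_local (R : comPzRingType) (m : ideal R) : Prop :=
  noetherian R /\ local_ring m.

Section LocalCohomology.
Variable R : comPzRingType.

Definition injective_module (E : lmodType R) : Prop :=
  forall (A B : lmodType R) (f : {linear A -> B}) (g : {linear A -> E}),
    injective f -> exists h : {linear B -> E}, forall x, h (f x) = g x.

(* M -> E^0 -> E^1 -> ... *)
Record augmented_sequence (M : lmodType R) := AugmentedSequence {
  seq_obj :> nat -> lmodType R;
  seq_diff : forall n, {linear seq_obj n -> seq_obj n.+1};
  seq_aug : {linear M -> seq_obj 0%N}
}.

Definition injective_resolution (M : lmodType R) (E : augmented_sequence M) :=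
  [/\ forall n, injective_module (E n),
      injective (seq_aug E),
      forall x, seq_diff E 0 x = 0 <-> exists y, x = seq_aug E y &
      forall n x, seq_diff E n.+1 x = 0 <-> exists y, x = seq_diff E n y].

Variable m : ideal R.

Section Cohomology.
Variables (M : lmodType R) (E : augmented_sequence M).

Lemma torsion_cocycle_prop n : @submod_prop R (E n) (fun x =>
  x \in torsion (E n) m /\ seq_diff E n x = 0).
Proof.
split=> [|a u v [um ud] [vm vd]]; first by rewrite rpred0 linear0.
by rewrite rpredD ?rpredZ // linearP ud vd scaler0 addr0.
Qed.

Definition torsion_coboundary n : E n -> Prop :=
  match n with
  | 0 => fun x => x = 0
  | k.+1 => fun x => exists2 y, y \in torsion (E k) m & x = seq_diff E k y
  end.

Lemma torsion_coboundary_prop n : submod_prop (@torsion_coboundary n).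
Proof.
case: n => [|n] /=; first by split=> // a u v -> ->; rewrite scaler0 addr0.
split=> [|a _ _ [u um ->] [v vm ->]]; first by exists 0; rewrite ?rpred0 ?linear0.
by exists (a *: u + v); rewrite ?rpredD ?rpredZ ?linearP.
Qed.

(* The n-th cohomology of the complex of the m-torsion submodules of the E^i.  *)
Definition torsion_cohomology (n : nat) : lmodType R :=
  subquotient (submod_of (torsion_cocycle_prop n))
              (submod_of (torsion_coboundary_prop n)).

End Cohomology.

Definition zero_module : lmodType R := 'rV[R]_0.

(* The i-th right derived functor of the m-torsion functor at M, computed on a
   chosen injective resolution. Every module has one, so that the last branch
   is never taken.                                                             *)
Definition local_cohomology (i : int) (M : lmodType R) : lmodType R :=
  match i with
  | Posz n =>
      if pselect (exists E : augmented_sequence M, injective_resolution E)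
        is left h then torsion_cohomology (projT1 (cid h)) n else zero_module
  | Negz _ => zero_module
  end.

End LocalCohomology.

Section CohenMacaulay.
Variables (R : comPzRingType) (m : ideal R).
Implicit Type M : lmodType R.

(* Finitely generated modules over Noetherian local rings have finite
   dimension; for the zero module, of dimension -1, the range is empty.        *)
Definition lc_ann_prod M : ideal R :=
  \big[@ideal_mul R/ideal_unit R]_(i < if mod_dim M is (Posz d)%:E then d else 0%N)
     ann (local_cohomology m (i : nat)%:Z M).

Definition lc_ann_dim M : \bar int := krull_dim (quotient_ring (lc_ann_prod M)).

Definition cohen_macaulay M : Prop := lc_ann_dim M = (-1)%:E.
Definition generalized_cohen_macaulay M : Prop := (lc_ann_dim M <= 0%:E)%E.
Definition one_cohen_macaulay M : Prop := (lc_ann_dim M <= 1%:E)%E.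

Definition submod_dim M (A : submodClosed M) : \bar int := mod_dim (submod_type A).

Definition dimension_filtration M (t : nat) (D : nat -> submodClosed M) : Prop :=
  [/\ D 0%N =i submod_full M,
      D t =i torsion M m &
      forall i, (i < t)%N ->
        [/\ {subset D i.+1 <= D i},
            (submod_dim (D i.+1) < submod_dim (D i))%E &
            forall A : submodClosed M, (submod_dim A < submod_dim (D i))%E ->
              {subset A <= D i.+1}]].

Definition sequentially (P : lmodType R -> Prop) M : Prop :=
  exists (t : nat) (D : nat -> submodClosed M), dimension_filtration t D /\
    forall i, (i < t)%N -> P (subquotient (D i) (D i.+1)).

End CohenMacaulay.

Definition quotient_of_cm_local (R : comPzRingType) : Prop :=
  exists (A : comPzRingType) (m : ideal A) (f : {rmorphism A -> R}),
    [/\ noetherian_local m, cohen_macaulay m (A^o : lmodType A)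
      & forall y, exists x, f x = y].

Definition restrict_scalars (R S : comPzRingType) (phi : {rmorphism R -> S})
  (N : lmodType S) : Type := N.

Section RestrictScalars.
Variables (R S : comPzRingType) (phi : {rmorphism R -> S}) (N : lmodType S).
Local Notation N' := (restrict_scalars phi N).

HB.instance Definition _ := GRing.Zmodule.on N'.

Definition restrict_scale (a : R) (x : N') : N' := phi a *: (x : N).

Lemma restrict_scaleA a b x :
  restrict_scale a (restrict_scale b x) = restrict_scale (a * b) x.
Proof. by rewrite /restrict_scale scalerA rmorphM. Qed.

Lemma restrict_scale1 : left_id 1 restrict_scale.
Proof. by move=> x; rewrite /restrict_scale rmorph1 scale1r. Qed.

Lemma restrict_scaleDr : right_distributive restrict_scale +%R.
Proof. by move=> a x y; rewrite /restrict_scale scalerDr. Qed.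

Lemma restrict_scaleDl x : {morph restrict_scale^~ x : a b / a + b}.
Proof. by move=> a b; rewrite /restrict_scale rmorphD scalerDl. Qed.

HB.instance Definition _ := GRing.Zmodule_isLmodule.Build R N'
  restrict_scaleA restrict_scale1 restrict_scaleDr restrict_scaleDl.

End RestrictScalars.

Definition module_finite_extension (R S : comPzRingType)
    (phi : {rmorphism R -> S}) : Prop :=
  injective phi /\ fin_gen (restrict_scalars phi (S^o : lmodType S)).

(* Main.v *)
Require Import Defs.
From HB Require Import structures.
From mathcomp Require Import all_boot all_order all_algebra.
From mathcomp Require Import boolp classical_sets constructive_ereal ring.

Set Implicit Arguments.
Unset Strict Implicit.
Unset Printing Implicit Defensive.

Import Order.TTheory GRing.Theory Num.Theory.
Local Open Scope ring_scope.

(* Torsion with respect to n and with respect to m coincide on S-modules, since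
   n is the radical of m S. An injective S-module need not be injective over R,
   but it keeps the divisibility property [good] of torsion elements, which is
   enough for an exact complex to stay exact after taking torsion; so an
   injective resolution over S computes the local cohomology over R as well.
   Annihilators over R are contracted from S, and lying over and
   incomparability match the chains of primes above them, which gives the
   equalities of dimensions, hence the Cohen-Macaulay conditions. The dimension
   filtrations over R and S agree because an R-submodule of N and its S-span
   have the same dimension.

   If D is Cohen-Macaulay and maps to S finitely, a generator of S over D is a
   root of a monic polynomial F over D; for F of minimal degree D[X]/(F) is
   local, it is free over D, hence Cohen-Macaulay, and it maps onto the
   subalgebra generated. Iterating over the generators makes S a quotient.

   Conversely let f map a Cohen-Macaulay B onto S. The fibre product A of R and B
   over S is a Noetherian local subring of B over which B is finite, and R is a
   quotient of A, so it suffices to treat A. One chooses parameters x_d, ..., x_1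
   of A such that x_i annihilates the quotients ((ys) : y) / (ys) in
   A / (x_(i+1)^2, ..., x_d^2) for every list y :: ys that is regular on B
   modulo the same squares; such an x_i is obtained from annihilators of Koszul
   cohomology along a prime filtration. As powers of a part of the x_i are
   B-regular, in A[[v_1, ..., v_d]] / (x_1 v_1, ..., x_d v_d) the elements
   x_i + v_i form a regular sequence of length at least the dimension. This
   ring is thus Cohen-Macaulay, and v |-> 0 maps it onto A. *)

(** For an ideal [I] of a ring [E], the colon condition serves one implication: if [x * (x * a)]
    lies in [I], so does [x * a]. It is equivalent to [x + v] being a nonzerodivisor on [E[[v]]]
    modulo [I] and [x v]. Dividing by [x + v] substitutes [- x] for [v] and leaves [E / (I, x ^ 2)],
    whence the squares of the later parameters; coefficients of positive degree live modulo
    [(I, x)], whence arbitrary subsets of the earlier parameters. The implication concerns the colon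
    by [x ^ 2], again a power of a parameter.

    A single [x_i] has to serve for all lists at once. Koszul cohomology allows this: a prime
    filtration has finitely many factors, and for each of them one element works for every list,
    since the factors of top dimension embed into [B] modulo the squares, where regular lists have
    no lower Koszul cohomology. As [x_i] avoids the primes of dimension [i], the dimension drops at
    each choice.

    The fibre product is Noetherian because the kernel of [A -> R] is also an ideal of [B]: ideals
    of [A] above it come from [R], and its products with elements of [B] stay in [A]. *)

Definition mklin (R : pzRingType) (U V : lmodType R) (f : U -> V)
    (lf : linear f) : {linear U -> V} :=
  HB.pack f (GRing.isLinear.Build R U V _ f lf).

Notation "x \ini I" := ((x : GRing.regular _) \in I) (at level 70).

(** * Submodules and ideals *)

Section Submodules.
Variables (R : comPzRingType).
Implicit Types (M U V : lmodType R).

Lemma in_sub V (P : V -> Prop) (H : submod_prop P) x : (x \in submod_of H) <-> P x.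
Proof. by split=> [/submod_ofP|?] //; apply/submod_ofP. Qed.

Lemma ideal_mull (I : ideal R) (a x : R) : x \ini I -> a * x \ini I.
Proof. by move=> xI; apply: (@rpredZ _ _ I a x). Qed.

Lemma ideal_mulr (I : ideal R) (a x : R) : x \ini I -> x * a \ini I.
Proof. by rewrite mulrC; apply: ideal_mull. Qed.

Lemma ideal_add (I : ideal R) (x y : R) : x \ini I -> y \ini I -> x + y \ini I.
Proof. exact: (@rpredD _ I). Qed.

Lemma ideal_opp (I : ideal R) (x : R) : x \ini I -> - x \ini I.
Proof. by move=> xI; rewrite -mulN1r; apply: ideal_mull. Qed.

Lemma ideal_sub (I : ideal R) (x y : R) : x \ini I -> y \ini I -> x - y \ini I.
Proof. by move=> xI yI; apply: ideal_add => //; apply: ideal_opp. Qed.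

Lemma ideal0 (I : ideal R) : (0 : R) \ini I.
Proof. exact: (@rpred0 _ I). Qed.

Lemma ideal_sum (I : ideal R) (T : Type) (r : seq T) (P : pred T) (F : T -> R) :
  (forall i, P i -> F i \ini I) -> \sum_(i <- r | P i) F i \ini I.
Proof. by move=> h; apply: (@rpred_sum _ I). Qed.

Lemma ideal_expn (I : ideal R) (x : R) n : x \ini I -> (0 < n)%N -> x ^+ n \ini I.
Proof. by move=> xI; case: n => // n _; rewrite exprS; apply: ideal_mulr. Qed.

Lemma submodN V (A : submodClosed V) x : x \in A -> - x \in A.
Proof. by move=> xA; rewrite -scaleN1r rpredZ. Qed.

Lemma submodB V (A : submodClosed V) x y : x \in A -> y \in A -> x - y \in A.
Proof. by move=> xA yA; rewrite rpredD // submodN. Qed.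

Lemma scale0_prop V : @submod_prop R V (fun x => x = 0).
Proof. by split=> // a u v -> ->; rewrite scaler0 addr0. Qed.

Definition sub0 V : submodClosed V := submod_of (scale0_prop V).

Lemma in_sub0 V (x : V) : (x \in sub0 V) <-> x = 0.
Proof. exact: in_sub. Qed.

Lemma subI_prop V (A B : submodClosed V) : @submod_prop R V (fun x => x \in A /\ x \in B).
Proof.
split; first by rewrite !rpred0.
by move=> a u v [uA uB] [vA vB]; rewrite !rpredD ?rpredZ.
Qed.

Definition subI V (A B : submodClosed V) := submod_of (subI_prop A B).

Lemma subD_prop V (A B : submodClosed V) :
  @submod_prop R V (fun x => exists2 a, a \in A & x - a \in B).
Proof.
split; first by exists 0; rewrite ?subrr rpred0.
move=> c u v [a aA ua] [b bA vb]; exists (c *: a + b); first by rewrite rpredD ?rpredZ.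
by rewrite opprD addrACA -scalerBr rpredD ?rpredZ.
Qed.

Definition subD V (A B : submodClosed V) := submod_of (subD_prop A B).

Lemma subDl V (A B : submodClosed V) x : x \in A -> x \in subD A B.
Proof. by move=> xA; apply/in_sub; exists x; rewrite ?subrr ?rpred0. Qed.

Lemma subDr V (A B : submodClosed V) x : x \in B -> x \in subD A B.
Proof. by move=> xA; apply/in_sub; exists 0; rewrite ?subr0 ?rpred0. Qed.

Lemma preim_prop U V (f : {linear U -> V}) (A : submodClosed V) :
  @submod_prop R U (fun x => f x \in A).
Proof. by split=> [|a u v uA vA]; rewrite ?linear0 ?rpred0 // linearP rpredD ?rpredZ. Qed.

Definition preim U V (f : {linear U -> V}) A := submod_of (preim_prop f A).

Lemma image_prop U V (f : {linear U -> V}) (A : submodClosed U) :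
  @submod_prop R V (fun y => exists2 x, x \in A & y = f x).
Proof.
split; first by exists 0; rewrite ?rpred0 ?linear0.
move=> a _ _ [u uA ->] [v vA ->]; exists (a *: u + v); last by rewrite linearP.
by rewrite rpredD ?rpredZ.
Qed.

Definition image_sub U V (f : {linear U -> V}) A := submod_of (image_prop f A).

(** Membership is defined by recursion on the generators instead of by a sum with coefficients, so
    that facts about spans follow by induction on the list. *)
Fixpoint spn M (s : seq M) (x : M) : Prop :=
  if s is v :: s' then exists a : R, spn s' (x - a *: v) else x = 0.

Lemma spn_prop M (s : seq M) : submod_prop (spn s).
Proof.
elim: s => [|w s [s0 sD]] /=; first exact: scale0_prop.
split; first by exists 0; rewrite scale0r subrr.
move=> a u v [b ub] [c vc]; exists (a * b + c).
by rewrite scalerDl opprD addrACA -scalerA -scalerBr; apply: sD.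
Qed.

Definition span M (s : seq M) : submodClosed M := submod_of (spn_prop s).

Lemma in_span M (s : seq M) x : (x \in span s) <-> spn s x.
Proof. exact: in_sub. Qed.

Lemma span_cons M (v : M) s x : (x \in span (v :: s)) <-> exists a, x - a *: v \in span s.
Proof.
rewrite in_span /=; split=> -[a]; first by move/in_span; exists a.
by move/in_span; exists a.
Qed.

Lemma span_nil M (x : M) : (x \in span [::]) <-> x = 0.
Proof. by rewrite in_span. Qed.

Lemma mem_span M (s : seq M) x : x \in s -> x \in span s.
Proof.
elim: s => // v s IH; rewrite inE => /predU1P[->|/IH xs]; apply/span_cons.
  by exists 1; rewrite scale1r subrr rpred0.
by exists 0; rewrite scale0r subr0.
Qed.

Lemma span_sub M (s : seq M) (A : submodClosed M) :
  {subset s <= A} -> {subset span s <= A}.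
Proof.
elim: s => [|v s IH] sA x; first by move=> /span_nil ->; rewrite rpred0.
case/span_cons=> a /IH xs; rewrite -(subrK (a *: v) x) rpredD //.
  by apply: xs => y ys; apply: sA; rewrite inE ys orbT.
by rewrite rpredZ // sA ?mem_head.
Qed.

Lemma span_catl M (s t : seq M) : {subset span s <= span (s ++ t)}.
Proof. by apply: span_sub => x xs; apply: mem_span; rewrite mem_cat xs. Qed.

Lemma span_catr M (s t : seq M) : {subset span t <= span (s ++ t)}.
Proof. by apply: span_sub => x xs; apply: mem_span; rewrite mem_cat xs orbT. Qed.

Lemma span_sum M (s : seq M) x : x \in span s ->
  exists a : nat -> R, x = \sum_(i < size s) a i *: s`_i.
Proof.
elim: s x => [|v s IH] x; first by move=> /span_nil ->; exists (fun=> 0); rewrite big_ord0.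
case/span_cons=> a /IH[b xE]; exists (fun i => if i is j.+1 then b j else a).
by rewrite big_ord_recl /= -[LHS](subrK (a *: v)) addrC xE.
Qed.

Lemma sum_span M (s : seq M) (a : nat -> R) : \sum_(i < size s) a i *: s`_i \in span s.
Proof. by apply: rpred_sum => i _; rewrite rpredZ // mem_span // mem_nth. Qed.

Lemma span_map U V (f : {linear U -> V}) (s : seq U) x :
  x \in span s -> f x \in span (map f s).
Proof.
elim: s x => [|v s IH] x; first by move=> /span_nil ->; rewrite linear0 rpred0.
by case/span_cons=> a /IH xs; apply/span_cons; exists a; rewrite -linearZ -linearB.
Qed.

Lemma span_map_inv U V (f : {linear U -> V}) (s : seq U) y :
  y \in span (map f s) -> exists2 x, x \in span s & y = f x.
Proof.
elim: s y => [|v s IH] y /=; first by move=> /span_nil ->; exists 0; rewrite ?rpred0 ?linear0.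
case/span_cons=> a /IH[x xs E]; exists (x + a *: v); last by rewrite linearD linearZ -E subrK.
by apply/span_cons; exists a; rewrite addrK.
Qed.

Definition fgs M (A : submodClosed M) : Prop :=
  exists s : seq M, {subset s <= A} /\ {subset A <= span s}.

Definition noeth M : Prop := forall A : submodClosed M, fgs A.

Definition fgm M : Prop := exists s : seq M, forall x, x \in span s.

Lemma fin_genP M : fin_gen M <-> fgm M.
Proof.
split=> [[n [v vP]]|[s sP]].
  exists [seq v i | i : 'I_n] => x; have [a ->] := vP x.
  by apply: rpred_sum => i _; rewrite rpredZ // mem_span // map_f ?mem_enum.
exists (size s), (fun i => s`_i) => x; have [a ->] := span_sum (sP x).
by exists (fun i => a i).
Qed.

Lemma fgs_sub_type M (A : submodClosed M) : fin_gen (submod_type A) <-> fgs A.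
Proof.
have lv : linear (@submod_val R M A) by [].
rewrite fin_genP; split=> [[s sP]|[s [sA As]]].
  exists (map val s); split=> [_ /mapP[u _ ->]|x xA]; first exact: valP.
  exact: (@span_map _ _ (mklin lv) s (SubmodType xA)).
have [t ts] : exists t : seq (submod_type A), map val t = s.
  elim: s sA {As} => [|v s IH] sA; first by exists [::].
  case: IH => [x xs|t <-]; first by apply: sA; rewrite inE xs orbT.
  by exists (SubmodType (sA v (mem_head _ _)) :: t).
exists t => x; have := As _ (valP x); rewrite -ts => /(@span_map_inv _ _ (mklin lv) t)[y yt E].
by rewrite (val_inj E).
Qed.

Lemma noetherianP : noetherian R <-> noeth R^o.
Proof. by split=> h I; apply/fgs_sub_type. Qed.

(** Induction on the generators: the coefficients of [v] in elements of [A], modulo [W] and the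
    other generators, form an ideal. It contains [K], because [k *: v] lies in [W]; hence finite
    generation is needed only for ideals above [K]. The case [K = 0] is the usual one; the general
    case serves for a ring not yet known to be Noetherian. *)
Lemma noeth_span_rel (K : ideal R) M (W : submodClosed M) (s : seq M) :
  (forall J : ideal R, {subset K <= J} -> fgs J) ->
  (forall v k, v \in s -> k \ini K -> k *: v \in W) ->
  forall A : submodClosed M, {subset W <= A} -> {subset A <= subD W (span s)} ->
  exists t : seq M, {subset t <= A} /\ {subset A <= subD W (span t)}.
Proof.
move=> hK; elim: s => [|v s IH] hs A WA As; first by exists [::].
have Jp : @submod_prop R R^o (fun a => exists2 d, d \in A & d - (a : R) *: v \in subD W (span s)).
  split; first by exists 0; rewrite ?scale0r ?subrr rpred0.
  move=> c a b [d dA da] [e eA eb]; exists (c *: d + e); first by rewrite rpredD ?rpredZ.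
  by rewrite scalerDl opprD addrACA -scalerA -scalerBr rpredD ?rpredZ.
have [|t [tJ Jt]] := hK (submod_of Jp).
  move=> k kK; apply/in_sub; exists 0; rewrite ?rpred0 // sub0r submodN //.
  by apply: subDl; apply: hs kK; apply: mem_head.
have [r [rA rt]] : exists r : seq M, {subset r <= A} /\ forall a : R^o, a \in span t ->
    exists2 d, d \in span r & d - (a : R) *: v \in subD W (span s).
  elim: t tJ {Jt} => [|b t IHt] tJ.
    exists [::]; split=> // a /span_nil ->.
    by exists 0; rewrite ?scale0r ?subrr rpred0.
  case: IHt => [x xt|r [rA rt]]; first by apply: tJ; rewrite inE xt orbT.
  have /in_sub[e eA eb] := tJ b (mem_head _ _).
  exists (e :: r); split=> [x|a /span_cons[c /rt[d dr da]]].
    by rewrite inE => /predU1P[->|/rA].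
  exists (d + c *: e); first by apply/span_cons; exists c; rewrite addrK.
  have -> : d + c *: e - (a : R) *: v =
     (d - (a - c *: b : R) *: v) + c *: (e - (b : R) *: v).
    by rewrite scalerBl scalerBr scalerA opprB -[RHS]addrA [X in _ = _ + X]addrC subrKA addrA.
  by rewrite rpredD ?rpredZ.
have [w k ws||x /in_sub[] //|u [uA Au]] := IH _ (subI A (subD W (span s))).
- by apply: hs; rewrite inE ws orbT.
- by move=> x xW; apply/in_sub; split; [exact: WA|exact: subDl].
exists (r ++ u); split=> [x|x xA].
  by rewrite mem_cat => /orP[/rA //|/uA /in_sub[]].
have /in_sub[w wW /span_cons[a xa]] := As _ xA.
have [|d dr da] := rt a.
  apply: Jt; apply/in_sub; exists x => //; apply/in_sub; exists w => //.
  by rewrite addrAC.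
have /Au/in_sub[w' w'W xu] : x - d \in subI A (subD W (span s)).
  apply/in_sub; split; first by rewrite submodB // (span_sub rA).
  have -> : x - d = (x - (a : R) *: v) - (d - (a : R) *: v) by rewrite opprB subrKA.
  apply: submodB => //; apply/in_sub; exists w => //; by rewrite addrAC.
apply/in_sub; exists w' => //; rewrite -(subrK d (x - w')); apply: rpredD; last exact: span_catl.
by apply: span_catr; rewrite addrAC.
Qed.

Lemma noeth_span M (s : seq M) : noeth R^o ->
  forall A : submodClosed M, {subset A <= span s} -> fgs A.
Proof.
move=> hR A As; have [|v k _ /in_sub0 ->|x /in_sub0 ->|x /As xs|t [tA At]] :=
  @noeth_span_rel (sub0 R^o) M (sub0 M) s _ _ A.
- by move=> J _; apply: hR.
- by rewrite scale0r rpred0.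
- exact: rpred0.
- exact: subDr.
exists t; split=> // x /At/in_sub[w /in_sub0 ->]; by rewrite subr0.
Qed.

Lemma noeth_fg M : noeth R^o -> fgm M -> noeth M.
Proof. by move=> hR [s sP] A; apply: (noeth_span hR (s := s)). Qed.

Lemma noeth_chain M (D : nat -> submodClosed M) : noeth M ->
  (forall i, {subset D i <= D i.+1}) -> exists n, forall i, {subset D i <= D n}.
Proof.
move=> hM hD.
have mono i j : (i <= j)%N -> {subset D i <= D j}.
  by move=> /subnK <-; elim: (j - i)%N => // k IH x /IH /hD.
have Up : @submod_prop R M (fun x => exists i, x \in D i).
  split; first by exists 0%N; rewrite rpred0.
  move=> a u v [i ui] [j vj]; exists (maxn i j).
  apply: rpredD; first apply: rpredZ; first exact: (mono i _ (leq_maxl _ _)).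
  exact: (mono j _ (leq_maxr _ _)).
have [s [sU Us]] := hM (submod_of Up).
have [n sn] : exists n, {subset s <= D n}.
  elim: s sU {Us} => [|v s IH] sU; first by exists 0%N.
  case: IH => [x xs|n sn]; first by apply: sU; rewrite inE xs orbT.
  have /in_sub[i vi] := sU v (mem_head _ _).
  exists (maxn i n) => x; rewrite inE => /predU1P[->|/sn].
    exact: (mono i _ (leq_maxl _ _)).
  exact: (mono n _ (leq_maxr _ _)).
exists n => i x xi; apply: (span_sub sn); apply: Us; apply/in_sub.
by exists i.
Qed.

(** Without a maximal member, choice would pick a strictly larger member each time and produce a
    chain that never stops. *)
Lemma noeth_max M (F : submodClosed M -> Prop) : noeth M -> (exists A, F A) ->
  exists A, F A /\ forall B, F B -> {subset A <= B} -> {subset B <= A}.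
Proof.
move=> hM [A0 FA0]; apply: contrapT => hn.
have nxt (A : {A | F A}) : {B : {A | F A} | {subset projT1 A <= projT1 B} /\
    ~ {subset projT1 B <= projT1 A}}.
  apply: cid; apply: contrapT => h; apply: hn; exists (projT1 A); split=> [|B FB AB].
    exact: projT2.
  by apply: contrapT => BA; apply: h; exists (exist _ B FB).
pose D := fix D n : {A | F A} := if n is k.+1 then projT1 (nxt (D k)) else exist _ A0 FA0.
have [n nP] := @noeth_chain M (fun i => projT1 (D i)) hM (fun i => (projT2 (nxt (D i))).1).
by have [_] := projT2 (nxt (D n)); apply; apply: (nP n.+1).
Qed.

End Submodules.

Definition mkrm (R S : pzRingType) (f : R -> S) (fD : zmod_morphism f)
    (fM : monoid_morphism f) : {rmorphism R -> S} :=
  HB.pack f (GRing.isZmodMorphism.Build R S f fD) (GRing.isMonoidMorphism.Build R S f fM).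

Section QuotientMap.
Variables (R : comPzRingType) (I : ideal R).

Definition qpi (x : R) : quotient_ring I := quotient_pi I (x : R^o).

Lemma qpiB : zmod_morphism qpi.
Proof.
have lp : linear (quotient_pi I) by move=> a u v; rewrite quotient_piD quotient_piZ.
exact: (raddfB (mklin lp)).
Qed.

Lemma qpiM : monoid_morphism qpi.
Proof. by split=> // x y; apply: quotient_piM. Qed.

HB.instance Definition _ := GRing.isZmodMorphism.Build R (quotient_ring I) qpi qpiB.
HB.instance Definition _ := GRing.isMonoidMorphism.Build R (quotient_ring I) qpi qpiM.

Lemma qpi_eq x y : (qpi x = qpi y) <-> (x - y \ini I).
Proof. by split=> [h|h]; apply/quotient_eqP. Qed.

Lemma qpi_eq0 x : (qpi x = 0) <-> (x \ini I).
Proof. by rewrite -(rmorph0 qpi) qpi_eq subr0. Qed.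

Lemma qpi_surj u : exists x, u = qpi x.
Proof. by exists (quotient_repr u); rewrite /= /qpi quotient_reprK. Qed.

End QuotientMap.

(** * The determinant trick *)

Section Determinant.
Variables (R : comPzRingType).

(** Cramer's rule: apply the adjugate of [B] to the vector of relations. *)
Lemma det_kills (M : lmodType R) (W : submodClosed M) n (B : 'M[R]_n) (v : 'I_n -> M) :
  (forall i, \sum_j B i j *: v j \in W) -> forall k, \det B *: v k \in W.
Proof.
move=> BW k.
have -> : \det B *: v k = \sum_i \adj B k i *: (\sum_j B i j *: v j).
  transitivity (\sum_j (\adj B *m B) k j *: v j).
    rewrite mul_adj_mx (bigD1 k) //= mxE eqxx mulr1n big1 ?addr0 // => j jk.
    by rewrite mxE eq_sym (negPf jk) mulr0n scale0r.
  under [RHS]eq_bigr => i _ do rewrite scaler_sumr.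
  rewrite exchange_big; apply: eq_bigr => j _; rewrite mxE scaler_suml.
  by apply: eq_bigr => i _; rewrite scalerA.
by apply: rpred_sum => i _; rewrite rpredZ.
Qed.

(** The element [c] is the determinant of [a - P] for a matrix [P] with entries in [I]; modulo [I]
    it is [a ^+ size s]. Working modulo [W] replaces passing to a quotient module. *)
Lemma cayley (I : ideal R) (M : lmodType R) (W : submodClosed M) (s : seq M) (a : R) :
  (forall x, x \in s -> exists c : nat -> R, (forall i, c i \ini I) /\
     a *: x - \sum_(i < size s) c i *: s`_i \in W) ->
  exists c : R, (c - a ^+ size s \ini I) /\ forall x, x \in s -> c *: x \in W.
Proof.
move=> h; set n := size s.
have hi (i : 'I_n) : {c : nat -> R | (forall i, c i \ini I) /\
     a *: s`_i - \sum_(i < size s) c i *: s`_i \in W}.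
  by apply/cid/h/mem_nth.
pose P : 'M[R]_n := \matrix_(i, j) projT1 (hi i) j.
exists (\det (a%:M - P)); split.
  apply/qpi_eq; rewrite -det_map_mx rmorphXn /= -det_scalar; congr (\det _).
  apply/matrixP => i j; rewrite !mxE raddfB raddfMn /=.
  have /qpi_eq0 -> := (projT2 (hi i)).1 j.
  by rewrite subr0.
move=> x xs; have xi : (index x s < n)%N by rewrite index_mem.
have := det_kills (W := W) (B := a%:M - P) (v := fun i : 'I_n => s`_i) _ (Ordinal xi).
rewrite /= nth_index //; apply=> i.
have [_] := projT2 (hi i); congr (_ \in W).
under [RHS]eq_bigr => j _ do rewrite !mxE scalerBl.
rewrite sumrB; congr (_ - _); rewrite (bigD1 i) //= eqxx mulr1n big1 ?addr0 // => j ji.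
by rewrite eq_sym (negPf ji) mulr0n scale0r.
Qed.

End Determinant.

(** * Prime ideals, associated primes and prime filtrations *)

Section Ideals.
Variable R : comPzRingType.
Implicit Types (I J P Q : ideal R).

Definition idl (x : R) : ideal R := @span R R^o [:: (x : R^o)].

Lemma in_idl (x y : R) : (y \ini idl x) <-> exists a, y = a * x.
Proof.
rewrite /idl span_cons; split=> -[a].
  by move/span_nil/eqP; rewrite subr_eq0 => /eqP ->; exists a.
by move=> ->; exists a; apply/span_nil; rewrite subrr.
Qed.

Lemma mem_idl (x : R) : x \ini idl x.
Proof. by apply/in_idl; exists 1; rewrite mul1r. Qed.

Lemma prime_expn P (x : R) n : prime_ideal P -> x ^+ n \ini P -> x \ini P.
Proof.
case=> P1 PM; elim: n => [|n IH]; first by rewrite expr0 => h; case/negP: P1.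
by rewrite exprS => /PM[].
Qed.

Lemma prime_notM P (x y : R) : prime_ideal P -> ~ (x \ini P) -> ~ (y \ini P) ->
  ~ (x * y \ini P).
Proof. by case=> _ PM hx hy /PM[]. Qed.

Lemma prime_not1 P : prime_ideal P -> ~ ((1 : R) \ini P).
Proof. by case=> /negP. Qed.

Lemma prime_notX P (x : R) n : prime_ideal P -> ~ (x \ini P) -> ~ (x ^+ n \ini P).
Proof. by move=> hP hx /(prime_expn hP). Qed.

(** An ideal maximal among those above [J] and disjoint from the multiplicative set [T] is prime;
    the Noetherian hypothesis provides it. *)
Lemma prime_avoiding (J : ideal R) (T : R -> Prop) : noeth R^o -> T 1 ->
  (forall a b, T a -> T b -> T (a * b)) -> (forall a, T a -> ~ (a \ini J)) ->
  exists Q, [/\ prime_ideal Q, {subset J <= Q} & forall a, T a -> ~ (a \ini Q)].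
Proof.
move=> hR T1 TM TJ.
pose F (Q : ideal R) := {subset J <= Q} /\ forall a, T a -> ~ (a \ini Q).
have [|Q [[JQ TQ] Qmax]] := @noeth_max R R^o F hR.
  by exists J; split.
exists Q; split=> //; split; first by apply/negP/TQ.
move=> x y xyQ; apply: contrapT => h.
have key z : ~ (z \ini Q) -> exists2 a, T a & exists q r, [/\ q \ini Q & a = q + r * z].
  move=> zQ; apply: contrapT => hz; apply: zQ.
  apply: (Qmax (subD Q (idl z))).
  - split=> [w /JQ wQ|a Ta]; first exact: subDl.
    case/in_sub=> q qQ /in_idl[r /eqP ar]; apply: hz; exists a => //.
    by exists q, r; split=> //; rewrite -(eqP ar) addrC subrK.
  - by move=> w wQ; apply: subDl.
  - by apply: subDr; apply: mem_idl.
have [xQ yQ] : ~ (x \ini Q) /\ ~ (y \ini Q) by split=> hh; apply: h; [left|right].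
have [a Ta [q [r [qQ aE]]]] := key x xQ; have [b Tb [q' [r' [qQ' bE]]]] := key y yQ.
apply: (TQ (a * b)); first exact: TM.
have -> : a * b = q * b + (r * x * q' + r * r' * (x * y)).
  rewrite aE mulrDl; congr (_ + _); rewrite bE mulrDr; congr (_ + _).
  by rewrite mulrACA mulrA.
apply: ideal_add; first exact: ideal_mulr.
by apply: ideal_add; apply: ideal_mull.
Qed.

(** [P] is minimal over [J], so [a] is nilpotent modulo [J] after localisation at [P]. Otherwise the
    products [t * a ^+ k] would be avoided by a prime above [J], which lies inside [P] and hence
    equals it, although [a] is in [P]. *)
Lemma locally_nilpotent (J P : ideal R) (a : R) : noeth R^o -> prime_ideal P ->
  (forall Q, prime_ideal Q -> {subset J <= Q} -> {subset Q <= P} -> {subset P <= Q}) ->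
  a \ini P -> exists t k, ~ (t \ini P) /\ t * a ^+ k \ini J.
Proof.
move=> hR hP hmin aP; apply: contrapT => hn.
pose T (b : R) := exists t k, ~ (t \ini P) /\ b = t * a ^+ k.
have [||b [t [k [tP ->]]] h|Q [hQ JQ TQ]] := @prime_avoiding J T hR.
- by exists 1, 0%N; split; [exact: prime_not1|rewrite mulr1].
- move=> _ _ [t [k [tP ->]]] [t' [k' [tP' ->]]]; exists (t * t'), (k + k')%N.
  by split; [exact: prime_notM|rewrite exprD mulrACA].
- by apply: hn; exists t, k.
have QP : {subset Q <= P}.
  move=> t tQ; apply: contrapT => tP; apply: (TQ t) => //.
  by exists t, 0%N; split=> //; rewrite mulr1.
have aQ := hmin Q hQ JQ QP a aP.
by apply: (TQ a) => //; exists 1, 1%N; split; [exact: prime_not1|rewrite mul1r].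
Qed.

Lemma prime_avoidance (I : ideal R) k (P : nat -> ideal R) :
  (forall i, (i < k)%N -> prime_ideal (P i)) ->
  (forall i, (i < k)%N -> ~ {subset I <= P i}) ->
  exists x, x \ini I /\ forall i, (i < k)%N -> ~ (x \ini P i).
Proof.
elim: k P => [|k IH] P hP hI; first by exists 0; split=> //; apply: ideal0.
have hPk := hP k (ltnSn k).
have [[i [ik Pik]]|hn] := pselect (exists i, (i < k)%N /\ {subset P i <= P k}).
  (* When [P i] is contained in [P k], avoiding [P k] suffices for both: [P k] takes the place of
     [P i] and the family loses one member. *)
  have [|j jk|x [xI xP]] := IH (fun j => if j == i then P k else P j).
  - by move=> j jk; case: eqP => _; apply: hP => //; apply: ltnW.
  - by case: eqP => _; apply: hI => //; apply: ltnW.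
  exists x; split=> // j; have [->|ji] := eqVneq j i.
    by move=> _ /Pik; have := xP i ik; rewrite eqxx.
  rewrite ltnS leq_eqVlt => /predU1P[->|jk]; first by have := xP i ik; rewrite eqxx.
  by have := xP j jk; rewrite (negPf ji).
have [j jk|j jk|x [xI xP]] := IH P.
- by apply: hP; apply: ltnW.
- by apply: hI; apply: ltnW.
have [xk|xk] := pselect (x \ini P k); last first.
  by exists x; split=> // j; rewrite ltnS leq_eqVlt => /predU1P[->|/xP].
have [y [yI yP yk]] : exists y, [/\ y \ini I, forall i, (i < k)%N -> y \ini P i & ~ (y \ini P k)].
  have [b bI bk] : exists2 b, b \ini I & ~ (b \ini P k).
    apply: contrapT => h; apply: (hI k (ltnSn k)) => b bI.
    by apply: contrapT => bk; apply: h; exists b.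
  have aP (i : 'I_k) : {a : R | a \ini P i /\ ~ (a \ini P k)}.
    apply: cid; apply: contrapT => h; apply: hn; exists i; split=> // a ai.
    by apply: contrapT => ak; apply: h; exists a.
  exists (b * \prod_(i < k) projT1 (aP i)); split.
  - exact: ideal_mulr.
  - move=> i ik; apply: ideal_mull; rewrite (bigD1 (Ordinal ik)) //=.
    by apply: ideal_mulr; have [] := projT2 (aP (Ordinal ik)).
  - apply: prime_notM => //; elim/big_ind: _ => [|u v|i _]; first exact: prime_not1.
      exact: prime_notM.
    by have [] := projT2 (aP i).
exists (x + y); split; first exact: ideal_add.
move=> j; rewrite ltnS leq_eqVlt => /predU1P[->|jk] h.
  by apply: yk; rewrite -[y](addKr x) addrC ideal_sub.
by apply: (xP j jk); rewrite -[x](addrK y) ideal_sub ?yP.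
Qed.

Definition colon (M : lmodType R) (W : submodClosed M) (x : M) : ideal R :=
  submod_of (@preim_prop R R^o M (mklin (fun a u v => etrans (scalerDl _ _ _)
    (congr1 (fun w => w + _) (esym (scalerA _ _ _))) : (a *: u + v : R^o) *: x = _)) W).

Lemma in_colon (M : lmodType R) (W : submodClosed M) (x : M) (a : R) :
  (a \ini colon W x) <-> (a *: x \in W).
Proof. exact: in_sub. Qed.

Definition subR (M : lmodType R) (W : submodClosed M) (x : M) : submodClosed M :=
  subD W (span [:: x]).

Lemma in_subR (M : lmodType R) (W : submodClosed M) (x y : M) :
  (y \in subR W x) <-> exists r, y - r *: x \in W.
Proof.
rewrite in_sub; split=> [[w wW /span_cons[r /span_nil/eqP]]|[r h]].
  by rewrite subr_eq0 => /eqP E; exists r; rewrite -E subKr.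
exists (y - r *: x) => //; rewrite subKr rpredZ // mem_span ?mem_head //.
Qed.

(** Among the annihilators of the nonzero multiples of the class of [x], a maximal one is prime. *)
Lemma ass_exists (M : lmodType R) (W : submodClosed M) (x : M) : noeth R^o ->
  x \notin W -> exists a : R, a *: x \notin W /\ prime_ideal (colon W (a *: x)).
Proof.
move=> hR xW.
pose F (J : ideal R) := exists a : R, a *: x \notin W /\ J =i colon W (a *: x).
have [|J [[a [aW Ja]] Jmax]] := @noeth_max R R^o F hR.
  by exists (colon W x), 1; rewrite scale1r.
exists a; split=> //; split.
  by apply/negP => /in_colon; rewrite scale1r; apply/negP.
move=> u v /in_colon; rewrite mulrC -scalerA => uv.
have [uW|uW] := boolP (u *: (a *: x) \in W); first by left; apply/in_colon.
right; rewrite -Ja; apply: (Jmax (colon W ((u * a) *: x))).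
- by exists (u * a); split=> //; rewrite -scalerA.
- move=> r; rewrite Ja => /in_colon ra; apply/in_colon.
  by rewrite -scalerA scalerA mulrC -scalerA rpredZ.
- by apply/in_colon; rewrite -scalerA.
Qed.

(** A prime filtration in the form of an induction principle: a property kept when an element with
    prime annihilator modulo [W] is adjoined reaches the whole module, and no filtration has to be
    recorded. *)
Lemma prime_filtration (M : lmodType R) (T : submodClosed M -> Prop) (W0 : submodClosed M) :
  noeth R^o -> noeth M -> T W0 ->
  (forall W x, T W -> x \notin W -> prime_ideal (colon W x) -> T (subR W x)) ->
  exists2 W, T W & forall x, x \in W.
Proof.
move=> hR hM T0 TS; have [|W [TW Wmax]] := @noeth_max _ _ T hM; first by exists W0.
exists W => // x; apply: contrapT => /negP xW.
have [a [aW hp]] := ass_exists hR xW.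
case/negP: (aW); apply: (Wmax _ (TS W _ TW aW hp)) => [w wW|].
  by apply/in_subR; exists 0; rewrite scale0r subr0.
by apply/in_subR; exists 1; rewrite scale1r subrr rpred0.
Qed.

(** The [P i] are the annihilators of the factors of a prime filtration. They include all associated
    primes, and each prime over the annihilator contains one of them. *)
Lemma finite_ass (M : lmodType R) : noeth R^o -> noeth M ->
  exists k (P : nat -> ideal R), [/\ forall i, (i < k)%N -> prime_ideal (P i),
   forall i, (i < k)%N -> {subset ann M <= P i},
   forall y : M, prime_ideal (colon (sub0 M) y) ->
     exists2 i, (i < k)%N & colon (sub0 M) y =i P i &
   forall Q, prime_ideal Q -> {subset ann M <= Q} ->
     exists2 i, (i < k)%N & {subset P i <= Q}].
Proof.
move=> hR hM.
pose T (W : submodClosed M) := exists k (P : nat -> ideal R),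
  [/\ forall i, (i < k)%N -> prime_ideal (P i),
   forall i, (i < k)%N -> {subset ann M <= P i},
   forall y, y \in W -> prime_ideal (colon (sub0 M) y) ->
     exists2 i, (i < k)%N & colon (sub0 M) y =i P i &
   forall Q, prime_ideal Q ->
     (forall a : R, (forall w, w \in W -> a *: w = 0) -> a \ini Q) ->
     exists2 i, (i < k)%N & {subset P i <= Q}].
have [||W [k [P [h1 h2 h3 h4]]] Wfull] := @prime_filtration M T (sub0 M) hR hM.
- exists 0%N, (fun=> ideal_unit R); split=> // [y /in_sub0 -> [/negP[]]|Q [/negP Q1 _] h].
    by apply/in_colon; rewrite scaler0 rpred0.
  by case: Q1; apply: h => w /in_sub0 ->; rewrite scaler0.
- move=> W x [k [P [h1 h2 h3 h4]]] xW hp.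
  exists k.+1, (fun i => if i == k then colon W x else P i); split.
  + move=> i; case: eqP => // /eqP ik; rewrite ltnS leq_eqVlt (negPf ik) /=; exact: h1.
  + move=> i; case: eqP => [_ _ a /in_sub h|/eqP ik].
      by apply/in_colon; rewrite h rpred0.
    rewrite ltnS leq_eqVlt (negPf ik) /=; exact: h2.
  + move=> y /in_subR[r yW] hy.
    (* A nonzero multiple of [y] has the same annihilator as [y], because that is prime. If one lies
       in [W], the primes found before suffice; otherwise the annihilator of [y] is that of its
       class modulo [W], hence that of [x]. *)
    have [[s [syW sy0]]|hn] := pselect (exists s : R, s *: y \in W /\ s *: y != 0).
      have sE : colon (sub0 M) (s *: y) =i colon (sub0 M) y.
        move=> a; apply/idP/idP => /in_colon/in_sub0 h; apply/in_colon/in_sub0.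
          have asy : a * s \ini colon (sub0 M) y by apply/in_colon/in_sub0; rewrite -scalerA.
          case: (hy.2 _ _ asy) => /in_colon/in_sub0 // h'.
          by rewrite h' eqxx in sy0.
        by rewrite scalerA mulrC -scalerA h scaler0.
      have [|i ik iE] := h3 _ syW.
        case: hy => hy1 hy2; split; first by rewrite sE.
        by move=> u v; rewrite !sE; apply: hy2.
      exists i; first exact: ltnW.
      by move=> a; rewrite (ltn_eqF ik) -iE sE.
    exists k => // a; rewrite eqxx.
    have rW : r *: x \notin W.
      apply/negP => rx; apply: hn; exists 1; rewrite scale1r; split.
        by rewrite -(subrK (r *: x) y) rpredD.
      apply/eqP => y0; case/negP: hy.1; apply/in_colon/in_sub0.
      by rewrite y0 scaler0.
    have aE : (a *: y \in W) = (a \in colon W x).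
      apply/idP/idP => h.
        have /(hp.2 a r)[//|/in_colon] : a * r \ini colon W x; last by rewrite (negPf rW).
        apply/in_colon; rewrite -scalerA -[r *: x](subKr y) scalerBr submodB //.
        by rewrite rpredZ.
      rewrite -(subrK (r *: x) y) scalerDr; apply: rpredD; first exact: rpredZ.
      by rewrite scalerA mulrC -scalerA; apply: rpredZ; apply/in_colon.
    rewrite -aE; apply/idP/idP => [/in_colon/in_sub0 -> //|h]; first exact: rpred0.
    apply/in_colon/in_sub0; apply: contrapT => /eqP h0.
    by apply: hn; exists a.
  + move=> Q hQ hh.
    have [hW|hW] := pselect (forall a : R, (forall w, w \in W -> a *: w = 0) -> a \ini Q).
      have [i ik iE] := h4 Q hQ hW; exists i; first exact: ltnW.
      by rewrite (ltn_eqF ik).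
    exists k => //; rewrite eqxx => b bp.
    apply: contrapT => bQ; apply: hW => a aW.
    have /(hQ.2 a b)[] // : a * b \ini Q.
    apply: hh => w /in_subR[r wW]; rewrite -[w](subrK (r *: x)) scalerDr.
    have -> : a * b *: (w - r *: x) = b *: (a *: (w - r *: x)) by rewrite scalerA mulrC.
    have -> : a * b *: (r *: x) = r *: (a *: (b *: x)) by rewrite !scalerA mulrC mulrA.
    by rewrite !aW ?scaler0 ?addr0 //; apply/in_colon.
exists k, P; split=> // [y|Q hQ h]; first by apply: h3.
by apply: h4 => // a aW; apply: h; apply/in_sub => x; apply: aW.
Qed.

End Ideals.

(** * Local rings and Nakayama's lemma *)

Section LocalRings.
Variables (R : comPzRingType) (m : ideal R).

Lemma local_ringI : ~ ((1 : R) \ini m) ->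
  (forall a : R, ~ (a \ini m) -> exists b, a * b = 1) -> local_ring m.
Proof.
move=> m1 mU.
have sub (J : ideal R) : (1 : R^o) \notin J -> {subset J <= m}.
  move=> J1 a aJ; apply: contrapT => /mU[b ab]; case/negP: J1.
  by rewrite -ab; apply: (ideal_mulr b aJ).
split; first by split=> [|J mJ J1]; [apply/negP|apply: sub].
move=> m' [m1' mmax]; have s := sub m' m1'.
by move=> x; apply/idP/idP; [apply: s|apply: mmax => //; apply/negP].
Qed.

Hypothesis hm : noetherian_local m.

Lemma local_noeth : noeth R^o. Proof. exact/noetherianP/hm.1. Qed.

Lemma local_not1 : ~ ((1 : R) \ini m). Proof. by apply/negP; case: hm.2 => -[]. Qed.

Lemma local_unit (a : R) : ~ (a \ini m) -> exists b, a * b = 1.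
Proof.
move=> am; apply: contrapT => hn.
pose F (J : ideal R) := (a \ini J) /\ (1 : R^o) \notin J.
have [|J [[aJ J1] Jmax]] := @noeth_max R R^o F local_noeth.
  exists (idl a); split; first exact: mem_idl.
  by apply/negP => /in_idl[b E]; apply: hn; exists b; rewrite mulrC.
apply: am; rewrite -(hm.2.2 J) //; split=> // K JK K1.
by apply: Jmax => //; split=> //; apply: JK.
Qed.

Lemma local_prime : prime_ideal m.
Proof.
split; first exact/negP/local_not1.
move=> x y xy; apply: contrapT => h.
have [|b ab] := @local_unit x; first by move=> hx; apply: h; left.
by apply: h; right; rewrite -[y]mul1r -ab mulrAC; apply: ideal_mulr.
Qed.

Lemma sub_local (J : ideal R) : ~ ((1 : R) \ini J) -> {subset J <= m}.
Proof.
move=> J1 x xJ; apply: contrapT => /local_unit[b xb].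
by apply: J1; rewrite -xb; apply: ideal_mulr.
Qed.

Lemma prime_sub_local (P : ideal R) : prime_ideal P -> {subset P <= m}.
Proof. by move/prime_not1/sub_local. Qed.

(** The case [a = 1] of the determinant trick: the determinant is congruent to 1 modulo [m], hence a
    unit. *)
Lemma nakayama (M : lmodType R) (W : submodClosed M) (s : seq M) :
  (forall x, x \in s -> exists c : nat -> R, (forall i, c i \ini m) /\
     x - \sum_(i < size s) c i *: s`_i \in W) -> {subset s <= W}.
Proof.
move=> h; have [|c [cm cW]] := @cayley R m M W s 1.
  by move=> x /h[c cP]; exists c; rewrite scale1r.
rewrite expr1n in cm.
have [|b cb] := @local_unit c.
  by move=> h'; apply: local_not1; rewrite -[1](subKr c) ideal_sub.
by move=> x /cW h'; rewrite -[x]scale1r -cb mulrC -scalerA rpredZ.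
Qed.

End LocalRings.

(** * Chains of primes and Krull's height theorem *)

Section Chains.
Variable R : comPzRingType.
Implicit Types (I J P Q : ideal R).

(** Chains of the quotient by [I] written inside [R], so that dimensions of different quotients are
    compared without comparing quotient rings. *)
Definition chain I (n : nat) : Prop := exists P : nat -> ideal R,
  [/\ forall i, (i <= n)%N -> prime_ideal (P i),
      forall i, (i < n)%N -> {subset P i <= P i.+1} /\ ~ {subset P i.+1 <= P i}
    & {subset I <= P 0%N}].

Lemma chainS I n : chain I n.+1 -> chain I n.
Proof.
case=> P [hP hs hI]; exists P; split=> // i hi; first by apply: hP; apply: leqW.
by apply: hs; apply: ltnW.
Qed.

Lemma chain_le I n k : (k <= n)%N -> chain I n -> chain I k.
Proof. by move=> /subnK <-; elim: (n - k)%N => // j IH /chainS. Qed.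

Lemma chain_mono I J n : {subset I <= J} -> chain J n -> chain I n.
Proof. by move=> IJ [P [hP hs hI]]; exists P; split=> // x /IJ /hI. Qed.

Lemma chain0 I P : prime_ideal P -> {subset I <= P} -> chain I 0%N.
Proof. by move=> hP IP; exists (fun=> P); split. Qed.

Lemma chain_sub (P : nat -> ideal R) n :
  (forall i, (i < n)%N -> {subset P i <= P i.+1} /\ ~ {subset P i.+1 <= P i}) ->
  forall i j, (i <= j <= n)%N -> {subset P i <= P j}.
Proof.
move=> hs i j /andP[/subnK <-]; elim: (j - i)%N => [_ x|k IH h x xi]; first by rewrite add0n.
by have [hsub _] := hs _ h; apply: hsub; apply: IH => //; apply: ltnW.
Qed.

Lemma prime_chain_chain n : prime_chain R n <-> chain (sub0 R^o) n.
Proof.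
split=> [[P [hP hs]]|[P [hP hs _]]]; exists P; split=> //.
by move=> x /in_sub0 ->; apply: rpred0.
Qed.

Lemma chain_quotient I n : prime_chain (quotient_ring I) n <-> chain I n.
Proof.
split=> [[P [hP hs]]|[P [hP hs hI]]].
  pose pre (Q : ideal (quotient_ring I)) : R^o -> Prop := fun x => (qpi I x \ini Q).
  have prep (K : ideal (quotient_ring I)) : submod_prop (pre K).
    split; first by rewrite /pre raddf0; apply: ideal0.
    move=> a u v uQ vQ; rewrite /pre -[a *: u + v]/((a : R) * u + v : R) rmorphD rmorphM.
    by apply: ideal_add => //; apply: ideal_mull.
  exists (fun i => submod_of (prep (P i))); split.
  - move=> i /hP[P1 PM]; split.
      by apply/negP => /in_sub; rewrite /pre rmorph1; apply/negP.
    move=> x y /in_sub; rewrite /pre rmorphM => /PM[]; by [left; apply/in_sub|right; apply/in_sub].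
  - move=> i /hs[h1 h2]; split=> [x /in_sub xP|h]; first by apply/in_sub/h1.
    apply: h2 => u; have [x ->] := qpi_surj u => xP.
    by have /h/in_sub : x \ini submod_of (prep (P i.+1)) by apply/in_sub.
  - by move=> x xI; apply/in_sub; rewrite /pre; move/qpi_eq0: (xI) => ->; apply: ideal0.
pose im (Q : ideal R) : (quotient_ring I)^o -> Prop := fun u => exists2 x, x \ini Q & u = qpi I x.
have imp Q : submod_prop (im Q).
  split; first by exists 0; rewrite ?raddf0 //; apply: ideal0.
  move=> a _ _ [x xQ ->] [y yQ ->]; have [b ->] := qpi_surj a.
  exists (b * x + y); last by rewrite -[b * x + y]/(b * x + y : R) rmorphD rmorphM.
  by apply: ideal_add => //; apply: ideal_mull.
have mem i x : (i <= n)%N -> (qpi I x \ini submod_of (imp (P i))) <-> (x \ini P i).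
  move=> hi; split=> [/in_sub[y yP /qpi_eq xy]|xP]; last by apply/in_sub; exists x.
  rewrite -(subrK y x); apply: ideal_add => //.
  by apply: (chain_sub hs (i := 0) (j := i)) => //; apply: hI.
exists (fun i => submod_of (imp (P i))); split.
- move=> i hi; have [P1 PM] := hP i hi; split.
    by apply/negP; rewrite -(rmorph1 (qpi I)) => /(mem _ _ hi); apply/negP.
  move=> u v; have [x ->] := qpi_surj u; have [y ->] := qpi_surj v.
  rewrite -rmorphM => /(mem _ _ hi) /PM[] h; [left|right]; exact/mem.
- move=> i hi; have [h1 h2] := hs i hi; split=> [u|h].
    have [x ->] := qpi_surj u => /(mem _ _ (ltnW hi)) /h1 ?; exact/mem.
  apply: h2 => x /(mem _ _ hi) /h ?; apply/mem; last by eassumption.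
  exact: ltnW.
Qed.

Lemma krull_dim_N1 : krull_dim R = (-1)%:E <-> ~ prime_chain R 0.
Proof.
rewrite /krull_dim; case: pselect => h; last first.
  by split=> // hn; case: h; exists 0%N; apply/negP => /asboolP.
case: ex_minnP => k /negP hk kmin; split=> [[/eqP]|h0].
  rewrite subr_eq addNr => /eqP k0; case: k k0 hk kmin => // _ hk _ h0.
  by apply: hk; apply/asboolP.
have /kmin : ~~ `[< prime_chain R 0 >] by apply/negP => /asboolP.
by rewrite leqn0 => /eqP ->.
Qed.

Lemma krull_dim_fin n : krull_dim R = (n%:Z)%:E <-> prime_chain R n /\ ~ prime_chain R n.+1.
Proof.
have down k j : (k <= j)%N -> prime_chain R j -> prime_chain R k.
  by rewrite !prime_chain_chain; apply: chain_le.
rewrite /krull_dim; case: pselect => h; last first.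
  split=> // -[_ hn]; case: h; exists n.+1; exact/asboolPn.
case: ex_minnP => k /negP hk kmin; split=> [[/eqP]|[h1 h2]].
  rewrite subr_eq -[1]/(1%N%:Z) -PoszD addn1 => /eqP[kE]; subst k; split.
    by apply: contrapT => hn; have /kmin : ~~ `[< prime_chain R n >]; [exact/asboolPn|rewrite ltnn].
  by move=> h'; apply: hk; apply/asboolP.
have -> : k = n.+1; last by rewrite -addn1 PoszD addrK.
apply/eqP; rewrite eqn_leq; apply/andP; split.
  by apply: kmin; apply/asboolPn.
rewrite ltnNge; apply/negP => kn; apply: hk; apply/asboolP; exact: down kn h1.
Qed.

End Chains.

Lemma krull_dim_eq (R S : comPzRingType) : (forall n, prime_chain R n <-> prime_chain S n) ->
  krull_dim R = krull_dim S.
Proof.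
move=> h; have E n : ~~ `[< prime_chain R n >] = ~~ `[< prime_chain S n >].
  by congr (~~ _); apply/asbool_equiv_eq.
rewrite /krull_dim; case: pselect => h1; case: pselect => h2 //.
- case: ex_minnP => k hk kmin; case: ex_minnP => l hl lmin.
  have -> : k = l; last by [].
  by apply/eqP; rewrite eqn_leq kmin ?lmin // ?E // -E.
- by case: h2; case: h1 => n hn; exists n; rewrite -E.
- by case: h1; case: h2 => n hn; exists n; rewrite E.
Qed.

Lemma krull_dim_quot_eq (R S : comPzRingType) (I : ideal R) (J : ideal S) :
  (forall n, chain I n <-> chain J n) ->
  krull_dim (quotient_ring I) = krull_dim (quotient_ring J).
Proof. by move=> h; apply: krull_dim_eq => n; rewrite !chain_quotient. Qed.

(** A prime containing a product of ideals contains one of the factors; hence the dimension modulo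
    the product is the largest of the dimensions modulo the factors. *)
Lemma chain_bigmul (R : comPzRingType) d (J : nat -> ideal R) n :
  chain (\big[@ideal_mul R/ideal_unit R]_(i < d) J i) n <->
  exists2 i, (i < d)%N & chain (J i) n.
Proof.
split=> [[P [hP hs hI]]|[i id]]; last first.
  apply: chain_mono => x; rewrite -(big_mkord xpredT J).
  elim: d i id J x => [//|d IH] [|i] id J x; rewrite big_nat_recl // => /in_sub[s [/allP sP ->]].
    rewrite big_seq; apply: ideal_sum => p /sP /andP[p1 p2]; exact: ideal_mulr.
  rewrite big_seq; apply: ideal_sum => p /sP /andP[p1 p2]; apply: ideal_mull.
  exact: (IH i id (fun j => J j.+1) _ p2).
suff [i id iP] : exists2 i, (i < d)%N & {subset J i <= P 0%N}.
  by exists i => //; exists P; split.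
have h0 := hP 0%N isT; apply: contrapT => hn.
have key k : (k <= d)%N -> exists2 x, x \ini (\big[@ideal_mul R/ideal_unit R]_(d - k <= i < d) J i) & ~ (x \ini P 0%N).
  elim: k => [|k IH] kd.
    by exists 1; [rewrite subn0 big_geq //; apply/in_sub|exact: prime_not1].
  have [x xI xP] := IH (ltnW kd).
  have [y yJ yP] : exists2 y, y \ini J (d - k.+1)%N & ~ (y \ini P 0%N).
    apply: contrapT => h; apply: hn; exists (d - k.+1)%N; first by rewrite ltn_subrL (leq_ltn_trans _ kd).
    by move=> y yJ; apply: contrapT => yP; apply: h; exists y.
  exists (y * x); last exact: prime_notM.
  rewrite big_ltn ?ltn_subrL ?(leq_ltn_trans _ kd) // -subSn // subSS.
  by apply/in_sub; exists [:: (y, x)]; rewrite /= yJ xI big_seq1.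
have [x] := key d (leqnn d); rewrite subnn big_mkord => /hI; exact.
Qed.

Section Krull.
Variable R : comPzRingType.
Hypothesis hR : noeth R^o.
Implicit Types (I J P Q : ideal R).

(* Descending chain condition for the submodules of [M_P] above [W0], [P] being
   minimal over the annihilator of [M / W0], without forming [M_P]. *)
Lemma saturated_dcc (M : lmodType R) (W0 : submodClosed M) P (D : nat -> submodClosed M) :
  noeth M -> prime_ideal P ->
  (forall Q, prime_ideal Q -> (forall a : R, (forall x : M, a *: x \in W0) -> a \ini Q) ->
     {subset Q <= P} -> {subset P <= Q}) ->
  (forall i, {subset W0 <= D i}) -> (forall i, {subset D i.+1 <= D i}) ->
  (forall i (t : R) x, ~ (t \ini P) -> t *: x \in D i -> x \in D i) ->
  exists n, forall i, (n <= i)%N -> {subset D n <= D i}.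
Proof.
move=> hM hP hmin W0D Ddec Dsat.
have Dle i j : (i <= j)%N -> {subset D j <= D i}.
  by move=> /subnK <-; elim: (j - i)%N => // k IH x /Ddec /IH.
pose T (W : submodClosed M) := {subset W0 <= W} /\
  exists n, forall i, (n <= i)%N -> forall x, x \in W -> x \in D n -> x \in D i.
have [||W [_ [n nP]] Wfull] := @prime_filtration _ M T W0 hR hM.
- by split=> //; exists 0%N => i _ x xW _; apply: W0D.
- move=> W x [W0W [n nP]] xW hp; split.
    by move=> w /W0W wW; apply/in_subR; exists 0; rewrite scale0r subr0.
  have [pP|pP] := pselect ({subset colon W x <= P}); last first.
    have [b bp bP] : exists2 b, b \ini colon W x & ~ (b \ini P).
      apply: contrapT => h; apply: pP => b bp; apply: contrapT => bP.
      by apply: h; exists b.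
    exists n => i ni y /in_subR[r yW] yD.
    apply: (Dsat i b) => //; apply: (nP i ni); last by rewrite rpredZ.
    rewrite -[y](subrK (r *: x)) scalerDr; apply: rpredD; first exact: rpredZ.
    by rewrite scalerA mulrC -scalerA; apply: rpredZ; apply/in_colon.
  have Pp := hmin _ hp (fun a ha => iffRL (in_colon _ _ _) (W0W _ (ha x))) pP.
  have [[i0 hi0]|hn] := pselect (exists i, forall y, y \in subR W x -> y \in D i -> y \in W).
    exists (maxn i0 n) => i hi y yW yD.
    apply: (nP i); first by apply: leq_trans hi; apply: leq_maxr.
      by apply: hi0 => //; apply: Dle yD; apply: leq_maxl.
    by apply: Dle yD; apply: leq_maxr.
  exists n => i ni z /in_subR[r' zW] zD.
  have [y [/in_subR[r yW] yD yn]] : exists y, [/\ y \in subR W x, y \in D i & y \notin W].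
    apply: contrapT => h; apply: hn; exists i => y yW yD; apply: contrapT => /negP yn.
    by apply: h; exists y.
  have rP : ~ (r \ini P).
    move=> /Pp /in_colon rx; case/negP: yn.
    by rewrite -[y](subrK (r *: x)) rpredD.
  apply: (Dsat i r) => //.
  have -> : r *: z = (r *: (z - r' *: x) - r' *: (y - r *: x)) + r' *: y.
    by rewrite !scalerBr !scalerA (mulrC r') opprB addrA subrK subrK.
  apply: rpredD; last exact: rpredZ.
  apply: (nP i ni); first by apply: submodB; apply: rpredZ.
  have -> : r *: (z - r' *: x) - r' *: (y - r *: x) = r *: z - r' *: y.
    by rewrite !scalerBr !scalerA (mulrC r') opprB addrA subrK.
  by apply: submodB; apply: rpredZ => //; apply: Dle yD.
by exists n => i ni x xD; apply: (nP i ni).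
Qed.

Lemma common_multiplier (M : lmodType R) (A : submodClosed M) P (s : seq M) : prime_ideal P ->
  (forall g, g \in s -> exists2 t : R, ~ (t \ini P) & t *: g \in A) ->
  exists2 t : R, ~ (t \ini P) & forall g, g \in s -> t *: g \in A.
Proof.
move=> hP; elim: s => [|v s IH] h; first by exists 1; first exact: prime_not1.
have [t tP tv] := h v (mem_head _ _).
have [|u uP us] := IH; first by move=> g gs; apply: h; rewrite inE gs orbT.
exists (t * u); first exact: prime_notM.
move=> g; rewrite inE => /predU1P[->|/us gu]; last by rewrite -scalerA rpredZ.
by rewrite mulrC -scalerA rpredZ.
Qed.

Lemma ideal_mul_span (I J : ideal R) (s : seq R^o) (x : R) : {subset J <= span s} ->
  x \ini ideal_mul I J ->
  exists c : nat -> R, (forall i, c i \ini I) /\ x = \sum_(i < size s) c i * s`_i.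
Proof.
move=> Js /in_sub[t [tP ->]]; elim: t tP => [|[a b] t IH] /=.
  exists (fun=> 0); split=> [i|]; first exact: ideal0.
  by rewrite big_nil big1 // => i _; rewrite mul0r.
case/andP=> /andP[/= aI /Js/span_sum[d bE]] /IH[c [cI E]].
exists (fun i => a * d i + c i); split=> [i|].
  by apply: ideal_add => //; apply: ideal_mulr.
rewrite big_cons E /= bE mulr_sumr -big_split; apply: eq_bigr => i _ /=.
by rewrite mulrDl mulrA.
Qed.

Lemma mem_ideal_exp (I : ideal R) (a : R) n : a \ini I -> a ^+ n \ini ideal_exp I n.
Proof.
move=> aI; elim: n => [|n IH]; first by rewrite /ideal_exp big_ord0; apply/in_sub.
rewrite /ideal_exp big_ord_recl exprS; apply/in_sub; exists [:: (a, a ^+ n)].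
by rewrite big_seq1 /= aI IH.
Qed.

(** * Krull's principal ideal theorem *)

Section PrincipalIdeal.
Variables (P0 Q P : ideal R) (x : R).
Hypotheses (hP0 : prime_ideal P0) (hQ : prime_ideal Q) (hP : prime_ideal P).
Hypotheses (P0Q : {subset P0 <= Q}) (QP : {subset Q <= P}) (nP : ~ {subset P <= Q}).
Hypothesis hmin : forall q, prime_ideal q -> {subset P0 <= q} -> x \ini q ->
  {subset q <= P} -> {subset P <= q}.

(* The symbolic powers of [Q] modulo [P0]. *)
Let symb_prop n : @submod_prop R R^o (fun a => exists2 s : R, ~ (s \ini Q) &
  s * (a : R) \ini subD (ideal_exp Q n) P0).
Proof.
split; first by exists 1; [exact: prime_not1|rewrite mulr0; apply: ideal0].
move=> c a b [s sQ sa] [t tQ tb]; exists (s * t); first exact: prime_notM.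
rewrite -[c *: a]/(c * a) mulrDr; apply: ideal_add.
  have -> : s * t * (c * a) = t * c * (s * a) by ring.
  exact: ideal_mull.
by rewrite -mulrA; apply: ideal_mull.
Qed.

Let symb n : ideal R := submod_of (symb_prop n).

Let symb_dec n : {subset symb n.+1 <= symb n}.
Proof.
move=> a /in_sub[s sQ /in_sub[b bQ sb]]; apply/in_sub; exists s => //.
apply/in_sub; exists b => //; apply: (@ideal_exp_sub _ _ _ 1).
by [].
Qed.

Let symb_sat n (s a : R) : ~ (s \ini Q) -> s * a \ini symb n -> a \ini symb n.
Proof.
move=> sQ /in_sub[t tQ h]; apply/in_sub; exists (t * s); first exact: prime_notM.
by rewrite -mulrA.
Qed.

(** The contraction to [R] of the ideal generated by [symb n] and [x] in the localisation at [P]. *)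
Let isat_prop n : @submod_prop R R^o (fun a => exists2 t : R, ~ (t \ini P) &
  t * (a : R) \ini subD (symb n) (idl x)).
Proof.
split; first by exists 1; [exact: prime_not1|rewrite mulr0; apply: ideal0].
move=> c a b [s sQ sa] [t tQ tb]; exists (s * t); first exact: prime_notM.
rewrite -[c *: a]/(c * a) mulrDr; apply: ideal_add.
  have -> : s * t * (c * a) = t * c * (s * a) by ring.
  exact: ideal_mull.
by rewrite -mulrA; apply: ideal_mull.
Qed.

(** Krull's argument in [R / P0] localised at [P], with denominators cleared by hand. Modulo [x]
    this ring is Artinian, so the symbolic powers of [Q] become stationary modulo [x]; the
    determinant trick removes [x], and a second use of it, at [Q], puts a power of [Q] inside
    [P0]. *)
Lemma principal_ideal_theorem : x \ini P -> {subset Q <= P0}.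
Proof.
move=> xP.
have xQ : ~ (x \ini Q) by move=> xQ; apply: nP; apply: hmin.
have hM : noeth R^o := hR.
have [|i a h|i a /in_sub[t tP /in_sub[b bQ tb]]|i t a tP /in_sub[u uP h]|n hn] :=
  @saturated_dcc R^o (subD P0 (idl x)) P (fun n => submod_of (isat_prop n)) hM hP.
- move=> q hq hJ qP; apply: hmin => // [a aP|].
    by apply: hJ => y; apply: subDl; rewrite -[_ *: _]/(a * y); apply: ideal_mulr.
  by apply: hJ => y; apply: subDr; apply/in_idl; exists y; rewrite mulrC.
- apply/in_sub; exists 1; first exact: prime_not1.
  rewrite mul1r; move/in_sub: h => [b bP ab]; apply/in_sub; exists b => //.
  by apply/in_sub; exists 1; [exact: prime_not1|rewrite mul1r; apply: subDr].
- by apply/in_sub; exists t => //; apply/in_sub; exists b => //; apply: symb_dec.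
- by apply/in_sub; exists (u * t); [exact: prime_notM|rewrite -mulrA].
have stab : {subset symb n <= symb n.+1}.
  have [s [sA As]] := hM (symb n).
  have h1 g : g \in s -> exists2 t : R, ~ (t \ini P) & t *: g \in subD (symb n.+1) (ideal_mul (idl x) (symb n)).
    move=> /sA gn.
    have : g \in submod_of (isat_prop n).
      by apply/in_sub; exists 1; [exact: prime_not1|rewrite mul1r; apply: subDl].
    move/(hn n.+1 (leqnSn n))/in_sub=> [t tP /in_sub[b bn /in_idl[r E]]].
    exists t => //; apply/in_sub; exists b => //; rewrite -[t *: g]/(t * g) E mulrC.
    apply/in_sub; exists [:: (x : R^o, r : R^o)]; rewrite big_seq1 /= mem_idl andbT; split=> //.
    (* Since [x] is outside [Q], the multiple [r * x] can be in the symbolic power only if [r]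
       is. *)
    apply: (symb_sat xQ); rewrite mulrC -E; apply: ideal_sub; last exact: symb_dec.
    exact: ideal_mull.
  have [t tP ts] := common_multiplier hP h1.
  have [g gs|c [ct cW]] := @cayley R (idl x) R^o (symb n.+1) s t.
    have /in_sub[b bn h] := ts g gs.
    have [c [cI E]] := ideal_mul_span As h.
    exists c; split=> //; have -> : \sum_(i < size s) c i *: s`_i = t *: g - b by [].
    by rewrite subKr.
  have cP : ~ (c \ini P).
    move=> cP; apply: (prime_notX (n := size s) hP tP).
    rewrite -[_ ^+ _](subKr c) ; apply: ideal_sub => //.
    have /in_idl[r ->] := ct; exact: ideal_mull.
  move=> a /As; apply: (span_sub (A := symb n.+1)) => g gs.
  by apply: (symb_sat (s := c)); [move=> /QP|apply: cW].
have [s [sA As]] := hM (ideal_exp Q n).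
have h1 g : g \in s -> exists2 t : R, ~ (t \ini Q) & t *: g \in subD (ideal_exp Q n.+1) P0.
  move=> /sA gn; have /stab/in_sub// : g \in symb n.
  by apply/in_sub; exists 1; [exact: prime_not1|rewrite mul1r; apply: subDl].
have [t tQ ts] := common_multiplier hQ h1.
have [g gs|c [ct cW]] := @cayley R Q R^o P0 s t.
  have /in_sub[b bn h] := ts g gs.
  have [|c [cI E]] := @ideal_mul_span Q (ideal_exp Q n) s b As.
    by move: bn; rewrite /ideal_exp big_ord_recl.
  by exists c; split=> //; have <- : b = \sum_(i < size s) c i *: s`_i by [].
have cQ : ~ (c \ini Q).
  move=> cQ; apply: (prime_notX (n := size s) hQ tQ).
  by rewrite -[_ ^+ _](subKr c); apply: ideal_sub.
move=> a aQ; apply: (prime_expn hP0 (n := n)).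
have := mem_ideal_exp n aQ; move/As; apply: span_sub => g /cW.
by case/(hP0.2)=> // /P0Q.
Qed.

End PrincipalIdeal.

(** Induction on the number of generators. The prime below the top is replaced by a maximal one,
    [Q], and some generator [y] is outside [Q]. The top prime is then minimal over [Q] and [y], so
    every other generator [z] satisfies [t * z ^+ n = b + c * y] with [b] in [Q] and [t] outside the
    top prime. By the principal ideal theorem, [Q] is minimal over [C 0] and the elements [b], which
    are one fewer. *)
Lemma krull_height (th : seq R) r (C : nat -> ideal R) :
  (forall i, (i <= r)%N -> prime_ideal (C i)) ->
  (forall i, (i < r)%N -> {subset C i <= C i.+1} /\ ~ {subset C i.+1 <= C i}) ->
  (forall x, x \in th -> x \ini C r) ->
  (forall q, prime_ideal q -> {subset C 0%N <= q} -> {subset q <= C r} ->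
     (forall x, x \in th -> x \ini q) -> {subset C r <= q}) ->
  (r <= size th)%N.
Proof.
move: {2}(size th) (leqnn (size th)) => k; elim: k th r C => [|k IH] th r C.
  rewrite leqn0 size_eq0 => /eqP -> hC hs _ hmin; case: r hC hs hmin => // r hC hs hmin.
  have [_ []] := hs 0%N isT.
  move=> x x1; apply: (hmin (C 0%N)) => //; first exact: hC.
    by apply: (chain_sub hs); rewrite leqnn andbT.
  by apply: (chain_sub hs (i := 1%N) (j := r.+1)) x1; rewrite leqnn.
move=> sth hC hs hth hmin; case: r hC hs hth hmin => // r hC hs hth hmin.
have hP := hC r.+1 (leqnn _).
pose F q := [/\ prime_ideal q, {subset C r <= q}, {subset q <= C r.+1} & ~ {subset C r.+1 <= q}].
have [|Q [[hQ CQ QP nQ] Qmax]] := @noeth_max R R^o F hR.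
  by exists (C r); have [h1 h2] := hs r (leqnn _); split=> //; apply: hC; apply: leqnSn.
have C0Q : {subset C 0%N <= Q}.
  by move=> a aC; apply: CQ; apply: (chain_sub hs (i := 0%N) (j := r)) aC; rewrite leqnSn.
have [y yth yQ] : exists2 y, y \in th & ~ (y \ini Q).
  apply: contrapT => h; apply: nQ; apply: hmin => // x xth.
  by apply: contrapT => xQ; apply: h; exists x.
have Pmin q : prime_ideal q -> {subset subD Q (idl y) <= q} -> {subset q <= C r.+1} ->
    {subset C r.+1 <= q}.
  move=> hq hJ qP; apply: contrapT => nq; apply: yQ; apply: (Qmax q).
  - by split=> // a /CQ aQ; apply: hJ; apply: subDl.
  - by move=> a aQ; apply: hJ; apply: subDl.
  - by apply: hJ; apply: subDr; apply: mem_idl.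
have /choice[b bP] z : exists b : R, z \in th -> b \ini Q /\ exists t n c,
    ~ (t \ini C r.+1) /\ t * z ^+ n = b + c * y.
  have [zth|zth] := boolP (z \in th); last by exists 0.
  have [t [n [tP /in_sub[b bQ /in_idl[c E]]]]] := locally_nilpotent hR hP Pmin (hth z zth).
  by exists b => _; split=> //; exists t, n, c; rewrite -E addrC subrK.
pose th' := [seq b z | z <- rem y th].
have sth' : size th' = (size th).-1 by rewrite size_map size_rem.
pose C' i := if i == r then Q else C i.
have := IH th' r C'; rewrite sth' /C' eqxx.
have th0 : (0 < size th)%N by case: (th) yth.
rewrite -[X in _ -> (X < _)%N]/(r) => IH'.
rewrite -(prednK th0) ltnS; apply: IH' => {IH}.
- by move: sth; rewrite -{1}(prednK th0) ltnS.
- by move=> i ir; case: eqP => // _; apply: hC; apply: leqW.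
- move=> i ir; rewrite (ltn_eqF ir); have [h1 h2] := hs i (leqW ir).
  case: eqP => // ei; split=> [a /h1|h]; first by rewrite ei => /CQ.
  by apply: h2 => a; rewrite ei => /CQ /h.
- by move=> _ /mapP[z /mem_rem zth ->]; have [] := bP z zth.
move=> q hq C0q qQ hq'.
apply: contrapT => nq.
have C0q' : {subset C 0%N <= q}.
  by move: C0q; case: eqP => // r0 Qq; case: nq.
apply: nq; apply: (@principal_ideal_theorem q Q (C r.+1) y) => //; last exact: hth.
move=> q' hq'' qq' yq' q'P; apply: hmin => // [a /C0q' /qq' //|z zth].
have [->//|zy] := eqVneq z y.
have [bQ [t [n [c [tP E]]]]] := bP z zth.
apply: (prime_expn hq'' (n := n)).
have : t * z ^+ n \ini q'.
  rewrite E; apply: ideal_add; last exact: ideal_mull.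
  by apply: qq'; apply: hq'; apply: map_f; move: zth; rewrite (perm_mem (perm_to_rem yth)) inE (negPf zy).
by case/(hq''.2) => // /q'P.
Qed.

Lemma chain_bound (m J : ideal R) (th : seq R) r : noetherian_local m ->
  (forall x, x \in th -> x \ini m) ->
  (forall q, prime_ideal q -> {subset J <= q} -> (forall x, x \in th -> x \ini q) -> {subset m <= q}) ->
  chain J r -> (r <= size th)%N.
Proof.
move=> hm thm hmin [C [hC hs hJ]].
(* The given chain may stop below [m]; its last prime is enlarged to [m], over which the hypothesis
   on [th] speaks. *)
pose C' i := if i == r then m else C i.
have hm' := local_prime hm.
have [r0|r0] := posnP r; first by rewrite r0.
apply: (krull_height (C := C')); rewrite /C' ?eqxx //.
- by move=> i ir; case: eqP => // _; apply: hC.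
- move=> i ir; rewrite (ltn_eqF ir); have [h1 h2] := hs i ir.
  have Cm := prime_sub_local hm (hC i.+1 ir).
  case: eqP => // ei; split=> [a /h1 /Cm //|h].
  by apply: h2 => a /Cm /h.
move=> q hq C0q _; apply: hmin => // a /hJ.
by move: C0q; rewrite eq_sym (gtn_eqF r0); apply.
Qed.

End Krull.

Lemma zmod_morphism_add (U V : zmodType) (f : U -> V) : zmod_morphism f ->
  {morph f : x y / x + y}.
Proof.
move=> fB x y.
have f0 : f 0 = 0 by rewrite -(subrr 0) fB subrr.
by rewrite -{1}(opprK y) fB -[- y]sub0r fB f0 sub0r opprK.
Qed.

(** * Injective resolutions *)

Section ExtendAdditive.
Variables (B D : zmodType).
Hypothesis Ddiv : forall n (d : D), exists e, e *+ n.+1 = d.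

(* The graph of an additive map from a subgroup of [B] to [D]. *)
Definition additive_graph (H : B -> D -> Prop) : Prop :=
  [/\ H 0 0, forall x c y d, H x c -> H y d -> H (x - y) (c - d) &
      forall d, H 0 d -> d = 0].

Lemma additive_graph_mulz H x c (k : int) :
  additive_graph H -> H x c -> H (x *~ k) (c *~ k).
Proof.
move=> [H0 HB _] Hu.
have Hn n : H (x *+ n) (c *+ n).
  elim: n => [|n IH]; first by rewrite !mulr0n.
  by have := HB _ _ _ _ IH (HB _ _ _ _ H0 Hu); rewrite !sub0r !opprK -!mulrSr.
case: k => n; first exact: Hn.
rewrite NegzE !mulrNz -sub0r -[- (c *~ _)]sub0r; apply: HB => //; exact: Hn.
Qed.

(** The multiples of [b] in the domain are those of a least positive one, if any is positive; [e] is
    a quotient of its value, and 0 if there is none. Every choice compatible with the graph extends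
    it to [b]. *)
Lemma additive_graph_step H b : additive_graph H ->
  exists e, forall k c, H (b *~ k) c -> c = e *~ k.
Proof.
move=> hH; case: (hH) => H0 HB Hf.
have Hu x c c' : H x c -> H x c' -> c = c'.
  move=> h h'; apply/eqP; rewrite -subr_eq0; apply/eqP/Hf.
  by have := HB _ _ _ _ h h'; rewrite subrr.
have [[n nP]|hn] := pselect (exists n, `[< exists d, H (b *+ n.+1) d >]); last first.
  exists 0 => k c hk; rewrite mul0rz; case: k hk => [[|n]|n] hk.
  - exact: Hf.
  - by case: hn; exists n; apply/asboolP; exists c.
  case: hn; exists n; apply/asboolP; exists (- c).
  have := additive_graph_mulz (-1) hH hk; rewrite !mulrN1z.
  by rewrite NegzE mulrNz opprK.
have hex : exists n, `[< exists d, H (b *+ n.+1) d >] by exists n.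
case: (ex_minnP hex) => {nP}{}n /asboolP[d nd] nmin.
have [e ee] := Ddiv n d; exists e => k c hk.
have kE := divz_eq k n.+1%:Z.
have bE : b *~ k = (b *+ n.+1) *~ (k %/ n.+1%:Z)%Z + b *~ (k %% n.+1%:Z)%Z.
  by rewrite {1}kE mulrzDr pmulrn -mulrzA mulrC.
have hq := additive_graph_mulz (k %/ n.+1%:Z)%Z hH nd.
have r0 : (k %% n.+1%:Z)%Z = 0.
  have rge : 0 <= (k %% n.+1%:Z)%Z by rewrite modz_ge0.
  have rlt : (k %% n.+1%:Z)%Z < n.+1%:Z by rewrite ltz_pmod.
  have := HB _ _ _ _ hk hq; rewrite bE addrAC subrr add0r.
  case: (k %% n.+1%:Z)%Z rge rlt => // -[//|r] _ rlt hr.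
  have := nmin r; rewrite leqNgt; move: rlt; rewrite ltz_nat ltnS => -> /=.
  by move=> h; suff: false by []; apply: h; apply/asboolP; eexists; exact: hr.
move: kE; rewrite r0 addr0 => kE; rewrite kE mulrC mulrzA -pmulrn ee.
by apply: Hu hk _; rewrite bE r0 mulr0z addr0.
Qed.

Lemma extend_additive G : additive_graph G ->
  exists2 h : B -> D, zmod_morphism h & forall b d, G b d -> h b = d.
Proof.
move=> hG; case: (hG) => G0 _ _.
pose gr (A : set (B * D)) b d := A (b, d).
pose P (A : set (B * D)) :=
  A = set0 \/ additive_graph (gr A) /\ forall b d, G b d -> A (b, d).
have [|A [PA Amax]] := @Zorn_bigcup _ P.
  move=> F FP Ftot.
  have [[X [FX Xn]]|hn] := pselect (exists X, F X /\ X <> set0); last first.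
    left; apply/seteqP; split=> // x [X FX Xx]; case: hn; exists X; split=> // X0.
    by move: Xx; rewrite X0.
  right; have [//|[[X0 XB Xf] GX]] := FP _ FX.
  have good Y y : F Y -> Y y -> additive_graph (gr Y).
    by move=> FY Yy; have [Y0|[]//] := FP _ FY; move: Yy; rewrite Y0.
  split; last by move=> b d /GX Xx; exists X.
  split; first by exists X.
    move=> x c y d [Y FY Yu] [Z FZ Zv].
    have [YZ|ZY] := Ftot _ _ FY FZ.
      by exists Z => //; have [_ hB _] := good _ _ FZ Zv; apply: hB => //; apply: YZ.
    by exists Y => //; have [_ hB _] := good _ _ FY Yu; apply: hB => //; apply: ZY.
  by move=> d [Y FY Yd]; have [_ _ hf] := good _ _ FY Yd; apply: hf.
have [A0|[hA GA]] := PA.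
  case: (Amax (fun u => G u.1 u.2)); last by right; split.
  rewrite A0; split=> // h; exact: (h (0, 0) G0).
case: (hA) => H0 HB Hf.
have tot b : exists d, A (b, d).
  have [e he] := additive_graph_step b hA.
  pose A' : set (B * D) := fun u => exists k, A (u.1 - b *~ k, u.2 - e *~ k).
  have AA' u : A u -> A' u by case: u => x c h; exists 0; rewrite !mulr0z !subr0.
  exists e; apply: contrapT => nAe; apply: (Amax A').
    split=> // h; apply: nAe; apply: h; exists 1; rewrite !mulr1z !subrr //.
  right; split; last by move=> x c /GA /AA'.
  split; first exact: AA'.
    move=> x c y d [k ku] [l lv]; exists (k - l); rewrite /= !mulrzBr.
    have E (V : zmodType) (x1 x2 x3 x4 : V) : x1 - x2 - (x3 - x4) = x1 - x3 - (x2 - x4).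
      by rewrite !opprD addrACA.
    by rewrite E [X in A (_, X)]E; apply: HB ku lv.
  move=> d [k]; rewrite /= sub0r -mulrNz => /he /eqP.
  by rewrite mulrNz subr_eq addNr => /eqP.
have [h hP] := choice tot.
have hu b d : A (b, d) -> h b = d.
  move=> bd; apply/eqP; rewrite -subr_eq0; apply/eqP/Hf.
  by have := HB _ _ _ _ (hP b) bd; rewrite subrr.
exists h => [x y|b d /GA /hu //]; apply: hu; exact: HB.
Qed.
End ExtendAdditive.

(** * The injective cogenerator Q/Z *)

Section RatModZ.

Lemma int_rat_prop : @submod_prop int (zmodule rat) (fun x => (x : rat) \is a Num.int).
Proof. by split=> [|a u v uZ vZ]; rewrite ?rpred0 // scalezrE rpredD // rpredMz. Qed.

Definition rat_mod_int : lmodType int := quotient_mod (submod_of int_rat_prop).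

Let pi (x : rat) : rat_mod_int := quotient_pi (submod_of int_rat_prop) (x : zmodule rat).

Lemma rat_mod_intB : zmod_morphism pi.
Proof.
have lp : linear (pi : zmodule rat -> _) by move=> a u v; rewrite /pi quotient_piD quotient_piZ.
exact: (linearB (mklin lp)).
Qed.

Let piM := HB.pack_for {additive rat -> rat_mod_int} pi
  (GRing.isZmodMorphism.Build _ _ pi rat_mod_intB).

Let pi0 x : pi x = 0 <-> x \is a Num.int.
Proof.
rewrite -[0](raddf0 piM) /=; split=> [/quotient_eqP/in_sub|h]; first by rewrite subr0.
by apply/quotient_eqP/in_sub; rewrite subr0.
Qed.

Let pi_0 : pi 0 = 0. Proof. exact: (raddf0 piM). Qed.

Let piMn x n : pi (x *+ n) = pi x *+ n.
Proof. exact: (raddfMn piM). Qed.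

Lemma rat_mod_int_div n (d : rat_mod_int) : exists e, e *+ n.+1 = d.
Proof.
pose q : rat := quotient_repr d; exists (pi (q / n.+1%:R)).
have qE : q / n.+1%:R *+ n.+1 = q by rewrite -[LHS]mulr_natr divfK ?pnatr_eq0.
rewrite -piMn qE; exact: quotient_reprK.
Qed.

(** An element of finite order [n] is sent to the class of [1 / n], one of infinite order to that of
    [1 / 2]; divisibility extends the map. *)
Lemma rat_mod_int_separates (B : zmodType) (x : B) : x != 0 ->
  exists2 h : B -> rat_mod_int, zmod_morphism h & h x != 0.
Proof.
move=> x0.
have [q [q0 qP]] : exists q : rat, q \isn't a Num.int /\
    forall k : int, x *~ k = 0 -> q *~ k \is a Num.int.
  have [[n nP]|hn] := pselect (exists n, x *+ n.+1 == 0); last first.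
    exists (1 / 2%:R); split; first by [].
    move=> k kx; suff -> : k = 0 by [].
    case: k kx => [[//|n]|n] kx; case: hn; exists n; first exact/eqP.
    by rewrite -oppr_eq0; apply/eqP.
  have hex : exists n, x *+ n.+1 == 0 by exists n.
  case: (ex_minnP hex) => {nP}{}n /eqP nx nmin.
  have n0 : (n.+1%:R : rat) != 0 by rewrite pnatr_eq0.
  exists (n.+1%:R^-1); split.
    case: n nx nmin n0 => [|n] nx nmin n0; first by move: x0; rewrite -nx mulr1n eqxx.
    apply/negP => /intrP[z zE].
    have q0 : (0 : rat) < n.+2%:R^-1 by rewrite invr_gt0 ltr0n.
    have q1 : n.+2%:R^-1 < (1 : rat) by rewrite invf_lt1 ?ltr0n // ltr1n.
    move: q0 q1; rewrite zE ltr0z -[1]/(1%:~R) ltr_int.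
    by case: z {zE} => [[|[|z]]|z].
  move=> k kx; have kE := divz_eq k n.+1%:Z.
  have r0 : (k %% n.+1%:Z)%Z = 0.
    have rge : 0 <= (k %% n.+1%:Z)%Z by rewrite modz_ge0.
    have rlt : (k %% n.+1%:Z)%Z < n.+1%:Z by rewrite ltz_pmod.
    have := kx; rewrite {1}kE mulrzDr mulrC mulrzA -pmulrn nx mul0rz add0r.
    case: (k %% n.+1%:Z)%Z rge rlt => // -[//|r] _ rlt hr.
    have := nmin r; rewrite leqNgt; move: rlt; rewrite ltz_nat ltnS => -> /=.
    by move=> h; suff: false by []; apply: h; apply/eqP.
  have qE : (n.+1%:R^-1 : rat) *+ n.+1 = 1 by rewrite -[LHS]mulr_natr mulVf.
  rewrite kE r0 addr0 mulrC mulrzA -pmulrn qE.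
  by apply/intrP; exists (k %/ n.+1%:Z)%Z.
pose G b (d : rat_mod_int) := exists k : int, b = x *~ k /\ d = pi (q *~ k).
have [|h hB hG] := @extend_additive B rat_mod_int rat_mod_int_div G.
  split; first by exists 0; rewrite !mulr0z pi_0.
    move=> _ _ _ _ [k [-> ->]] [l [-> ->]]; exists (k - l).
    by rewrite !mulrzBr rat_mod_intB.
  by move=> d [k [kx ->]]; apply/pi0/qP.
exists h => //; apply/eqP; rewrite (hG x (pi q)) => [/pi0|]; first exact/negP.
by exists 1; rewrite !mulr1z.
Qed.
End RatModZ.

Section InjectiveHull.
Variables (R : comPzRingType) (T : Type).

(* A product of copies, indexed by [T], of the injective module Hom_Z(R, Q/Z). *)
Record coinduced := Coinduced {
  coind_fun : T -> R -> rat_mod_int;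
  _ : forall t, zmod_morphism (coind_fun t)
}.

Lemma coind_eq (f g : coinduced) : (forall t r, coind_fun f t r = coind_fun g t r) -> f = g.
Proof.
case: f => f hf; case: g => g hg /= fg.
have E : f = g by apply: funext => t; apply: funext => r.
by case: _ / E in hg *; rewrite (Prop_irrelevance hf hg).
Qed.

Lemma coindB (f : coinduced) t a b : coind_fun f t (a - b) = coind_fun f t a - coind_fun f t b.
Proof. by case: f => f hf /=; apply: hf. Qed.

HB.instance Definition _ := gen_eqMixin coinduced.
HB.instance Definition _ := gen_choiceMixin coinduced.

Lemma coind0_subproof (t : T) : zmod_morphism (fun _ : R => 0 : rat_mod_int).
Proof. by move=> a b; rewrite subrr. Qed.
Definition coind0 := Coinduced coind0_subproof.

Lemma coindN_subproof (f : coinduced) t : zmod_morphism (fun r => - coind_fun f t r).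
Proof. by move=> a b; rewrite coindB opprB opprK addrC. Qed.
Definition coind_opp f := Coinduced (coindN_subproof f).

Lemma coindD_subproof (f g : coinduced) t :
  zmod_morphism (fun r => coind_fun f t r + coind_fun g t r).
Proof. by move=> a b; rewrite !coindB opprD addrACA. Qed.
Definition coind_add f g := Coinduced (coindD_subproof f g).

Lemma coind_addA : associative coind_add.
Proof. by move=> f g h; apply: coind_eq => t r /=; rewrite addrA. Qed.
Lemma coind_addC : commutative coind_add.
Proof. by move=> f g; apply: coind_eq => t r /=; rewrite addrC. Qed.
Lemma coind_add0 : left_id coind0 coind_add.
Proof. by move=> f; apply: coind_eq => t r /=; rewrite add0r. Qed.
Lemma coind_addN : left_inverse coind0 coind_opp coind_add.
Proof. by move=> f; apply: coind_eq => t r /=; rewrite addNr. Qed.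

HB.instance Definition _ :=
  GRing.isZmodule.Build coinduced coind_addA coind_addC coind_add0 coind_addN.

Lemma coindZ_subproof (a : R) (f : coinduced) t : zmod_morphism (fun r => coind_fun f t (r * a)).
Proof. by move=> r s; rewrite mulrBl coindB. Qed.
Definition coind_scale a f := Coinduced (coindZ_subproof a f).

Lemma coind_scaleA a b f : coind_scale a (coind_scale b f) = coind_scale (a * b) f.
Proof. by apply: coind_eq => t r /=; rewrite mulrA. Qed.
Lemma coind_scale1 : left_id 1 coind_scale.
Proof. by move=> f; apply: coind_eq => t r /=; rewrite mulr1. Qed.
Lemma coind_scaleDr : right_distributive coind_scale +%R.
Proof. by move=> a f g; apply: coind_eq => t r. Qed.
Lemma coind_scaleDl f : {morph coind_scale^~ f : a b / a + b}.
Proof.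
move=> a b; apply: coind_eq => t r /=.
by rewrite mulrDr (zmod_morphism_add (coindB f t)).
Qed.

HB.instance Definition _ := GRing.Zmodule_isLmodule.Build R coinduced
  coind_scaleA coind_scale1 coind_scaleDr coind_scaleDl.

(** A linear map into the product amounts to a family of additive maps into Q/Z, obtained by
    evaluation at 1. These extend one by one, and [h t (r *: b)] recovers the linear map. *)
Lemma coinduced_injective : injective_module coinduced.
Proof.
move=> A B f g fI.
have H (t : T) : exists h : B -> rat_mod_int, zmod_morphism h /\
    forall a, h (f a) = coind_fun (g a) t 1.
  pose G b d := exists a, b = f a /\ d = coind_fun (g a) t 1.
  have [|h hB hG] := @extend_additive B rat_mod_int rat_mod_int_div G.
    split; first by exists 0; rewrite !linear0.
      move=> _ _ _ _ [a [-> ->]] [b [-> ->]]; exists (a - b).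
      by rewrite !linearB.
    by move=> d [a [/esym]]; rewrite -[RHS](linear0 f) => /fI -> ->; rewrite linear0.
  by exists h; split=> // a; apply: hG; exists a.
have [h hP] := choice H.
have hD t x y : h t (x + y) = h t x + h t y.
  by apply: zmod_morphism_add; exact: (hP t).1.
have kB b t : zmod_morphism (fun r : R => h t (r *: b)).
  by move=> r s; rewrite scalerBl (hP t).1.
pose k b : coinduced := Coinduced (kB b).
have kl : linear k.
  move=> a u v; apply: coind_eq => t r /=.
  by rewrite scalerDr scalerA hD.
exists (mklin kl) => a; apply: coind_eq => t r /=.
by rewrite -linearZ (hP t).2 linearZ /= mul1r.
Qed.

End InjectiveHull.

(** * Existence of injective resolutions *)

Section Resolutions.
Variable R : comPzRingType.
Implicit Types M E V : lmodType R.

(** Indexed by all additive maps from [M] to Q/Z, which makes the embedding of [M] canonical. It is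
    not an injective envelope, as nothing minimal is claimed. *)
Definition hull M : lmodType R := coinduced R {f : M -> rat_mod_int | zmod_morphism f}.

Lemma hull_mapB M (x : M) (t : {f : M -> rat_mod_int | zmod_morphism f}) :
  zmod_morphism (fun r : R => sval t (r *: x)).
Proof. by case: t => f hf r s /=; rewrite scalerBl hf. Qed.

Definition hull_fun M (x : M) : hull M := Coinduced (hull_mapB x).

Lemma hull_fun_linear M : linear (@hull_fun M).
Proof.
move=> a u v; apply: coind_eq => -[f fB] r /=.
have fD := zmod_morphism_add fB.
by rewrite scalerDr fD scalerA.
Qed.

Definition hull_map M : {linear M -> hull M} := mklin (@hull_fun_linear M).

Lemma hull_map_inj M : injective (hull_map M).
Proof.
move=> x y xy; apply: contrapT => /eqP; rewrite -subr_eq0 => n0.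
have [h hB] := rat_mod_int_separates n0.
case/eqP; have := congr1 (fun z : hull M => coind_fun z (exist _ h hB) 1) xy.
by rewrite /= !scale1r hB => ->; rewrite subrr.
Qed.

Lemma quotient_pi_linear M (W : submodClosed M) : linear (quotient_pi W).
Proof. by move=> a u v; rewrite quotient_piD quotient_piZ. Qed.

Definition qmap M (W : submodClosed M) : {linear M -> quotient_mod W} :=
  mklin (@quotient_pi_linear M W).

Lemma qmap0 M (W : submodClosed M) x : qmap W x = 0 <-> x \in W.
Proof.
rewrite -[0](linear0 (qmap W)) -{2}[x]subr0.
by split=> [/quotient_eqP|xW]; last exact/quotient_eqP.
Qed.

Fixpoint cosyzygy M n : lmodType R :=
  if n is k.+1 then quotient_mod (image_sub (hull_map (cosyzygy M k)) (submod_full _)) else M.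

Lemma res_diff_linear M n :
  linear (fun x : hull (cosyzygy M n) => hull_map (cosyzygy M n.+1) (qmap _ x)).
Proof. by move=> a u v; rewrite !linearP. Qed.

(** This rules out the default branch in the definition of local cohomology. *)
Lemma injective_resolution_exists M :
  exists E : augmented_sequence M, injective_resolution E.
Proof.
exists (@AugmentedSequence R M (fun n => hull (cosyzygy M n))
  (fun n => mklin (@res_diff_linear M n)) (hull_map M)).
have ker0 n x : hull_map (cosyzygy M n.+1) (qmap _ x) = 0 <->
    exists y, x = hull_map (cosyzygy M n) y.
  split=> [|[y ->]].
    rewrite -[0](linear0 (hull_map (cosyzygy M n.+1))) => /hull_map_inj/qmap0/in_sub[y _ ->].
    by exists y.
  rewrite (iffRL (qmap0 _ _)) ?linear0 //; apply/in_sub; exists y => //.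
  exact/in_sub.
split=> [n||x|n x].
- exact: coinduced_injective.
- exact: hull_map_inj.
- exact: (ker0 0%N x).
rewrite (ker0 n.+1 x : seq_diff _ n.+1 x = 0 <-> _); split=> -[y ->]; last by exists (qmap _ y).
by exists (quotient_repr y); rewrite /= quotient_reprK.
Qed.

(** Injectivity for the inclusion of the image of [d], on which [w] is well defined because it
    vanishes on the kernel of [d]. *)
Lemma inj_ext (X V E : lmodType R) (d : {linear X -> V}) (w : {linear X -> E}) :
  injective_module E -> (forall x, d x = 0 -> w x = 0) ->
  exists h : {linear V -> E}, forall x, h (d x) = w x.
Proof.
move=> hE dw; pose A := image_sub d (submod_full X).
have lv : linear (@submod_val R V A) by [].
have pre (a : submod_type A) : exists x, d x = val a.
  by have /in_sub[x _ ->] := valP a; exists x.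
have [p pP] := choice pre.
have pE a x : d x = val a -> w (p a) = w x.
  move=> xa; apply/eqP; rewrite -subr_eq0 -linearB; apply/eqP/dw.
  by rewrite linearB pP xa subrr.
have gl : linear (fun a => w (p a)).
  move=> c u v; rewrite -linearP; apply: pE; rewrite linearP !pP.
  by rewrite linearP.
have [h hP] := hE _ _ (mklin lv) (mklin gl) (fun x y e => val_inj e).
exists h => x.
have dA : d x \in A by apply/in_sub; exists x => //; apply/in_sub.
by have := hP (SubmodType dA); rewrite /= => ->; apply: pE.
Qed.

End Resolutions.

(** * Torsion complexes and local cohomology *)

Section TorsionAndGoodness.
Variable R : comPzRingType.
Implicit Types (M C Q : lmodType R) (ys : seq R).

(** A list in place of an ideal: it can be shortened in inductions and mapped along a ring
    morphism. *)
Definition tors M ys (z : M) : Prop := forall y, y \in ys -> exists k, y ^+ k *: z = 0.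

Lemma tors_nil M (z : M) : tors [::] z. Proof. by move=> y. Qed.

Lemma tors_prop M ys : submod_prop (@tors M ys).
Proof.
split=> [y _|a u v uT vT y yys]; first by exists 0%N; rewrite scaler0.
have [[k ku] [l lv]] := (uT y yys, vT y yys); exists (k + l)%N.
have e1 : y ^+ (k + l) *: u = 0 by rewrite exprD mulrC -scalerA ku scaler0.
have e2 : y ^+ (k + l) *: v = 0 by rewrite exprD -scalerA lv scaler0.
by rewrite scalerDr scalerA mulrC -scalerA e1 scaler0 e2 addr0.
Qed.

Lemma tors0 M ys : tors ys (0 : M). Proof. by case: (tors_prop M ys). Qed.

Lemma torsP M ys a (u v : M) : tors ys u -> tors ys v -> tors ys (a *: u + v).
Proof. by case: (tors_prop M ys) => _; apply. Qed.

Lemma torsD M ys (u v : M) : tors ys u -> tors ys v -> tors ys (u + v).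
Proof. by move=> uT; rewrite -[u]scale1r; apply: torsP. Qed.

Lemma torsZ M ys a (u : M) : tors ys u -> tors ys (a *: u).
Proof. by move=> uT; rewrite -[_ *: _]addr0; apply: torsP => //; apply: tors0. Qed.

Lemma torsN M ys (u : M) : tors ys u -> tors ys (- u).
Proof. by rewrite -scaleN1r; apply: torsZ. Qed.

Lemma torsB M ys (u v : M) : tors ys u -> tors ys v -> tors ys (u - v).
Proof. by move=> uT vT; apply: torsD => //; apply: torsN. Qed.

Lemma tors_map M Q (f : {linear M -> Q}) ys z : tors ys z -> tors ys (f z).
Proof. by move=> zT y /zT[k kz]; exists k; rewrite -linearZ kz linear0. Qed.

Lemma tors_pair M Q ys (z : (M * Q)%type) : tors ys z <-> tors ys z.1 /\ tors ys z.2.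
Proof.
split=> [zT|[h1 h2] y yys].
  by split=> y /zT[k]; case: z {zT} => a b [h1 h2]; exists k.
have [[k ku] [l lv]] := (h1 y yys, h2 y yys); exists (k + l)%N.
case: z ku lv {h1 h2} => a b /= ka lb; congr (_, _).
  by rewrite /= exprD mulrC -scalerA ka scaler0.
by rewrite /= exprD -scalerA lb scaler0.
Qed.

Lemma tors_cons M x ys (z : M) : tors (x :: ys) z <-> (exists k, x ^+ k *: z = 0) /\ tors ys z.
Proof.
split=> [h|[h1 h2] y]; last by rewrite inE => /predU1P[->|/h2].
by split=> [|y yys]; apply: h; rewrite inE ?eqxx ?yys ?orbT.
Qed.

(* Up to [x]-torsion, [P] is [x]-divisible on elements that are torsion for the
   later entries. This is all that is needed of injective modules, and unlike
   injectivity it can be restricted along a ring morphism. *)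
Fixpoint good M ys (P : M -> Prop) : Prop :=
  if ys is x :: ys' then good ys' P /\ forall z, P z -> tors ys' z ->
    exists z', [/\ P z', tors ys' z' & exists N, x ^+ N *: (x *: z' - z) = 0]
  else True.

Lemma good_ext M ys (P P' : M -> Prop) : (forall z, P z <-> P' z) -> good ys P -> good ys P'.
Proof.
move=> PP'; elim: ys => //= x ys IH [gP h]; split; first exact: IH.
by move=> z /PP' Pz zT; have [z' [/PP' ? ? ?]] := h z Pz zT; exists z'.
Qed.

Lemma good0 M ys : good ys (fun z : M => z = 0).
Proof.
elim: ys => //= x ys IH; split=> // z -> _; exists 0; split=> //; first exact: tors0.
by exists 0%N; rewrite scaler0 subrr scaler0.
Qed.

Lemma good_divide M x ys (P : M -> Prop) k z : good (x :: ys) P -> P z -> tors ys z ->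
  exists z', [/\ P z', tors ys z' & exists N, x ^+ N *: (x ^+ k *: z' - z) = 0].
Proof.
move=> [_ h] Pz zT; elim: k => [|k [z1 [Pz1 z1T [N zE]]]].
  by exists z; split=> //; exists 0%N; rewrite !expr0 !scale1r subrr.
have [z' [Pz' z'T [N' z1E]]] := h z1 Pz1 z1T; exists z'; split=> //; exists (N + N')%N.
have -> : x ^+ k.+1 *: z' - z = x ^+ k *: (x *: z' - z1) + (x ^+ k *: z1 - z).
  by rewrite scalerBr scalerA -exprSr subrKA.
rewrite scalerDr [in X in _ + X]exprD [x ^+ N * _]mulrC -scalerA zE scaler0 addr0.
by rewrite scalerA exprD mulrAC -scalerA z1E scaler0.
Qed.

(** First lift to an element [c1] that is torsion for the later entries. Then [x ^+ k *: c1] lies in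
    the kernel; dividing it there by [x ^+ k], up to [x]-torsion, gives a correction that makes the
    lift [x]-torsion too. *)
Lemma good_lift C Q (d : {linear C -> Q}) ys c : good ys (fun z => d z = 0) ->
  tors ys (d c) -> exists2 c', d c' = d c & tors ys c'.
Proof.
elim: ys => [|x ys IH] gk; first by exists c.
move=> /tors_cons[[k kc] cT]; have [c1 c1E c1T] := IH gk.1 cT.
have [|z' [dz' z'T [N zE]]] := good_divide k gk (z := x ^+ k *: c1) _ (torsZ _ c1T).
  by rewrite linearZ /= c1E.
exists (c1 - z'); first by rewrite linearB dz' subr0.
apply/tors_cons; split; last exact: torsB.
exists (N + k)%N; rewrite exprD -scalerA scalerBr -opprB scalerN zE oppr0 //.
Qed.

Lemma good_image C Q (d : {linear C -> Q}) ys : good ys (fun z => d z = 0) ->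
  good ys (fun _ : C => True) -> good ys (fun z => exists c, z = d c).
Proof.
elim: ys => //= x ys IH [gk hk] [gC hC]; split; first exact: IH.
move=> _ [c ->] cT; have [c1 c1E c1T] := good_lift gk cT.
have [c2 [_ c2T [N cE]]] := hC c1 I c1T.
exists (d c2); split; [by exists c2|exact: tors_map|exists N].
by rewrite -c1E -linearZ -linearB -linearZ cE linear0.
Qed.

Lemma good_prod M Q ys : good ys (fun _ : M => True) -> good ys (fun _ : Q => True) ->
  good ys (fun _ : (M * Q)%type => True).
Proof.
elim: ys => //= x ys IH [gM hM] [gQ hQ]; split; first exact: IH.
move=> [a b] _ /tors_pair[/= aT bT].
have [a' [_ a'T [k ka]]] := hM a I aT; have [b' [_ b'T [l lb]]] := hQ b I bT.
exists (a', b'); split=> //; first exact/tors_pair.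
exists (k + l)%N; congr (_, _) => /=.
  by rewrite exprD mulrC -scalerA ka scaler0.
by rewrite exprD -scalerA lb scaler0.
Qed.

(** Let [J] be the annihilator of [z] and let the ideals [(J : x ^+ n)] be stationary from [n] on.
    Then sending [x ^+ n.+1 * s + j] to [x ^+ n * s *: z] is well defined on the ideal generated by
    [x ^+ n.+1] and [J]. The value at 1 of an extension to [R] is the required quotient; [J] kills
    it, so it inherits the torsion of [z]. *)
Lemma good_injective E ys : noeth R^o -> injective_module E -> good ys (fun _ : E => True).
Proof.
move=> hR hE; elim: ys => //= x ys IH; split=> // z _ zT.
pose J : ideal R := colon (sub0 E) z.
have JP a : a \ini J <-> a *: z = 0 by rewrite in_colon in_sub0.
have Dp n : @submod_prop R R^o (fun a => x ^+ n * (a : R) \ini J).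
  split; first by rewrite mulr0 ideal0.
  move=> a u v uJ vJ; rewrite mulrDr; apply: ideal_add => //.
  by rewrite mulrCA; apply: ideal_mull.
have [n nP] : exists n, forall i, {subset submod_of (Dp i) <= submod_of (Dp n)}.
  apply: noeth_chain => // i a /in_sub h; apply/in_sub.
  by rewrite exprS -mulrA; apply: ideal_mull.
pose X : lmodType R := (R^o * submod_type J)%type.
have dl : linear (fun p : X => x ^+ n.+1 * (p.1 : R) + val p.2 : R^o).
  move=> a [p1 p2] [q1 q2].
  change (x ^+ n.+1 * (a * (p1 : R) + (q1 : R)) + (a * (val p2 : R) + (val q2 : R)) =
    a * (x ^+ n.+1 * (p1 : R) + (val p2 : R)) + (x ^+ n.+1 * (q1 : R) + (val q2 : R))).
  ring.
have wl : linear (fun p : X => (x ^+ n * (p.1 : R)) *: z).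
  move=> a [p1 p2] [q1 q2].
  change ((x ^+ n * (a * (p1 : R) + (q1 : R))) *: z =
    a *: ((x ^+ n * (p1 : R)) *: z) + (x ^+ n * (q1 : R)) *: z).
  by rewrite mulrDr mulrCA scalerDl -(scalerA a).
have [|h hP] := @inj_ext R X R^o E (mklin dl) (mklin wl) hE.
  move=> [s j] /= sj; apply/JP.
  suff /in_sub : (s : R^o) \in submod_of (Dp n) by [].
  apply: (nP n.+1); apply/in_sub.
  move/eqP: sj; rewrite addr_eq0 => /eqP ->; apply: ideal_opp; exact: valP.
exists (h 1); split=> //.
  move=> y /zT[k /JP kz]; exists k.
  have := hP (0, SubmodType kz); rewrite /= !mulr0 add0r scale0r => <-.
  by rewrite -linearZ /GRing.scale /= mulr1.
exists n; rewrite scalerBr scalerA -exprSr.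
have := hP (1, 0); rewrite /= !mulr1 addr0 => <-.
by rewrite -linearZ /GRing.scale /= mulr1 subrr.
Qed.

End TorsionAndGoodness.

(** * Complexes, mapping cones and torsion *)

Section Complexes.
Variable R : comPzRingType.
Implicit Types (M N : lmodType R) (ys : seq R).

Record cplx := Cplx {
  cobj :> nat -> lmodType R;
  cdiff : forall n, {linear cobj n -> cobj n.+1};
  cdd : forall n x, cdiff n.+1 (cdiff n x) = 0
}.
Implicit Types C F E : cplx.

(** Cycles and boundaries of the torsion subcomplex stay predicates on the full complex; the empty
    list gives those of the complex itself. *)
Definition cyc ys C n (x : C n) : Prop := tors ys x /\ cdiff C n x = 0.

Definition bnd ys C n : C n -> Prop :=
  match n with
  | 0 => fun x => x = 0
  | k.+1 => fun x => exists2 y, tors ys y & x = cdiff C k y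
  end.

Definition acyclic ys C : Prop := forall n (x : C n), cyc ys x -> bnd ys x.

Lemma cyc_nil ys C n (x : C n) : cyc ys x -> cyc [::] x.
Proof. by case=> _ dx; split=> //; apply: tors_nil. Qed.

Lemma cyc0 ys C n : cyc ys (0 : C n).
Proof. by split; [exact: tors0|exact: linear0]. Qed.

Lemma cycP ys C n a (x y : C n) : cyc ys x -> cyc ys y -> cyc ys (a *: x + y).
Proof.
move=> [xT dx] [yT dy]; split; first exact: torsP.
by rewrite linearP dx dy scaler0 addr0.
Qed.

Lemma cycB ys C n (x y : C n) : cyc ys x -> cyc ys y -> cyc ys (x - y).
Proof. by move=> hx hy; rewrite addrC -scaleN1r; apply: cycP. Qed.

Lemma cycZ ys C n a (x : C n) : cyc ys x -> cyc ys (a *: x).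
Proof. by move=> hx; rewrite -[_ *: _]addr0; apply: cycP => //; apply: cyc0. Qed.

Lemma bnd0 ys C n : bnd ys (0 : C n).
Proof. by case: n => [|n] //=; exists 0; [exact: tors0|rewrite linear0]. Qed.

Lemma bndP ys C n a (x y : C n) : bnd ys x -> bnd ys y -> bnd ys (a *: x + y).
Proof.
case: n x y => [|n] x y /=; first by move=> -> ->; rewrite scaler0 addr0.
by move=> [x' x'T ->] [y' y'T ->]; exists (a *: x' + y'); [exact: torsP|rewrite linearP].
Qed.

Lemma bndD ys C n (x y : C n) : bnd ys x -> bnd ys y -> bnd ys (x + y).
Proof. by move=> hx; rewrite -[x]scale1r; apply: bndP. Qed.

Lemma bndN ys C n (x : C n) : bnd ys x -> bnd ys (- x).
Proof. by move=> hx; rewrite -scaleN1r -[_ *: _]addr0; apply: bndP => //; apply: bnd0. Qed.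

(** All kernels are good: the first is zero, and by exactness each later one is the image of a good
    module with good kernel. Torsion cycles then have torsion preimages. *)
Lemma acyclic_tors ys C : (forall n, good ys (fun _ : C n => True)) ->
  acyclic [::] C -> acyclic ys C.
Proof.
move=> hg hC.
have K n : good ys (fun z : C n => cdiff C n z = 0).
  elim: n => [|n IH].
    apply: good_ext (@good0 _ _ ys) => z; split=> [->|dz]; first exact: linear0.
    by apply: (hC 0%N); split=> //; exact: tors_nil.
  apply: good_ext (good_image IH (hg n)) => z; split=> [[c ->]|dz]; first exact: cdd.
  have [|c _ ->] := hC n.+1 z; last by exists c.
  by split=> //; exact: tors_nil.
move=> [|n] x xc; first exact: (hC 0%N x (cyc_nil xc)).
have [c _ xE] := hC n.+1 x (cyc_nil xc).
have [|c' c'E c'T] := good_lift (K n) (c := c) (ys := ys); first by rewrite -xE; case: xc.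
by exists c' => //; rewrite c'E.
Qed.

Section Maps.
Variables (F E : cplx) (u : forall n, {linear F n -> E n}).

Definition cmap : Prop := forall n x, u n.+1 (cdiff F n x) = cdiff E n (u n x).

Definition quasi_iso ys : Prop :=
  (forall n (x : F n), cyc ys x -> bnd ys (u n x) -> bnd ys x) /\
  (forall n (y : E n), cyc ys y -> exists2 x, cyc ys x & bnd ys (y - u n x)).

Hypothesis hu : cmap.

Lemma cmap_cyc ys n (x : F n) : cyc ys x -> cyc ys (u n x).
Proof. by move=> [xT dx]; split; [exact: tors_map|rewrite -hu dx linear0]. Qed.

Lemma cmap_bnd ys n (x : F n) : bnd ys x -> bnd ys (u n x).
Proof.
case: n x => [|n] x /=; first by move=> ->; rewrite linear0.
by move=> [y yT ->]; exists (u n y); [exact: tors_map|rewrite hu].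
Qed.

(** Shifted by one degree from the usual mapping cone, so that it starts in degree 0 with [F 0]. *)
Definition cone_obj n : lmodType R := if n is k.+1 then (F k.+1 * E k)%type else F 0%N.

Definition cone_fun n : cone_obj n -> cone_obj n.+1 :=
  match n with
  | 0 => fun a => (cdiff F 0 a, u 0 a)
  | k.+1 => fun p => (cdiff F k.+1 p.1, u k.+1 p.1 - cdiff E k p.2)
  end.

Lemma cone_fun_linear n : linear (@cone_fun n).
Proof.
case: n => [|n] a p q; first by rewrite /= !linearP.
case: p q => [p1 p2] [q1 q2]; congr (_, _); first by rewrite /= linearP.
change (u n.+1 (a *: p1 + q1) - cdiff E n (a *: p2 + q2) =
  a *: (u n.+1 p1 - cdiff E n p2) + (u n.+1 q1 - cdiff E n q2)).
by rewrite !linearP addrACA -scalerDr.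
Qed.

Lemma cone_dd n x : cone_fun (cone_fun x) = 0 :> cone_obj n.+2.
Proof.
case: n x => [|n] x /=; first by rewrite cdd hu subrr.
by rewrite linearB /= !cdd hu subr0 subrr.
Qed.

Definition cone : cplx :=
  @Cplx cone_obj (fun n => mklin (@cone_fun_linear n)) cone_dd.

Lemma quasi_iso_cone ys : quasi_iso ys -> acyclic ys cone.
Proof.
move=> [inj sur] [|[|n]].
- move=> a [aT [da ua]]; apply: (inj 0%N) => //; by split.
- move=> [a b] [/tors_pair[/= aT bT] [da /eqP]]; rewrite subr_eq0 => /eqP uab.
  have [|a' a'T aE] := inj 1%N a (conj aT da); first by exists b.
  have [|x [xT dx] /eqP] := sur 0%N (b - u 0%N a').
    split; first by apply: torsB => //; apply: tors_map.
    by rewrite linearB -hu -aE -uab subrr.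
  rewrite subr_eq add0r subr_eq => /eqP bE.
  exists (a' + x); first exact: torsD.
  by rewrite /= linearD dx addr0 -aE linearD addrC -bE.
move=> [a b] [/tors_pair[/= aT bT] [da /eqP]]; rewrite subr_eq0 => /eqP uab.
have [|a' a'T aE] := inj n.+2 a (conj aT da); first by exists b.
have [|x [xT dx] [b' b'T bE]] := sur n.+1 (b - u n.+1 a').
  split; first by apply: torsB => //; apply: tors_map.
  by rewrite linearB -hu -aE -uab subrr.
exists (a' + x, - b'); first by apply/tors_pair; split; [exact: torsD|exact: torsN].
rewrite /= linearD dx addr0 -aE; congr (_, _).
by rewrite linearN opprK linearD -bE addrC addrA [X in X + _]addrAC !subrK.
Qed.

Lemma cone_quasi_iso ys : acyclic ys cone -> quasi_iso ys.
Proof.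
move=> hc; split=> [[|n] x [xT dx]|n y [yT dy]].
- by move=> /= ux; apply: (hc 0%N x); split=> //=; rewrite dx ux.
- move=> [e eT uxe].
  have : bnd ys ((x, e) : cone n.+1).
    by apply: hc; split; [exact/tors_pair|rewrite /= dx uxe subrr].
  case: n x e xT dx eT uxe => [|n] x e xT dx eT uxe [y].
    by move=> yT [-> _]; exists y.
  by case: y => y1 y2 /tors_pair[y1T _] [-> _]; exists y1.
have : bnd ys ((0, y) : cone n.+1).
  apply: hc; split; first by apply/tors_pair; split=> //; apply: tors0.
  by rewrite /= !linear0 dy subrr.
case: n y yT dy => [|n] y yT dy [c].
  by move=> cT [dc ->]; exists c => //=; rewrite subrr.
case: c => c1 c2 /tors_pair[/= c1T c2T] [dc1 ->]; exists c1 => //.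
by exists (- c2); [exact: torsN|rewrite linearN addrAC subrr add0r].
Qed.

(** Taking torsion commutes with the cone, whose terms are good again; the claim thus reduces to
    keeping one complex acyclic. *)
Lemma quasi_iso_tors ys : (forall n, good ys (fun _ : F n => True)) ->
  (forall n, good ys (fun _ : E n => True)) -> quasi_iso [::] -> quasi_iso ys.
Proof.
move=> gF gE q; apply: cone_quasi_iso; apply: acyclic_tors; last exact: quasi_iso_cone.
by case=> [|n]; [exact: gF|exact: (@good_prod _ (F n.+1) (E n) ys (gF _) (gE _))].
Qed.

End Maps.

(** The comparison theorem. The invariant [ok], that kernels go to kernels, is what lets injectivity
    produce the next map. *)
Lemma chain_extend F E (u0 : {linear F 0%N -> E 0%N}) :
  (forall n, injective_module (E n)) ->
  (forall n x, cdiff F n.+1 x = 0 -> exists y, x = cdiff F n y) ->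
  (forall x, cdiff F 0 x = 0 -> cdiff E 0 (u0 x) = 0) ->
  exists2 u : forall n, {linear F n -> E n}, cmap u & u 0%N = u0.
Proof.
move=> hE hF h0.
pose ok n (v : {linear F n -> E n}) := forall x, cdiff F n x = 0 -> cdiff E n (v x) = 0.
have nxt n (v : {v | ok n v}) : {w : {w | ok n.+1 w} |
    forall x, sval w (cdiff F n x) = cdiff E n (sval v x)}.
  case: v => v vok; apply: cid.
  have lw : linear (fun x => cdiff E n (v x)) by move=> a x y; rewrite !linearP.
  have [w wP] := @inj_ext _ _ _ _ (cdiff F n) (mklin lw) (hE n.+1) vok.
  have wok : ok n.+1 w by move=> y /hF[x ->]; rewrite wP /= cdd.
  by exists (exist _ w wok).
pose U := fix U n : {v | ok n v} := if n is k.+1 then sval (nxt k (U k)) else exist _ u0 h0.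
by exists (fun n => sval (U n)) => // n x; have := svalP (nxt n (U n)) x.
Qed.

Definition resolves C M (aug : {linear M -> C 0%N}) : Prop :=
  [/\ injective aug, forall x, cdiff C 0 x = 0 <-> exists y, x = aug y &
      forall n x, cdiff C n.+1 x = 0 -> exists y, x = cdiff C n y].

Lemma resolution_map M N F E (augF : {linear N -> F 0%N}) (augE : {linear M -> E 0%N})
    (psi : {linear N -> M}) :
  resolves augF -> resolves augE -> (forall n, injective_module (E n)) ->
  exists2 u : forall n, {linear F n -> E n}, cmap u &
    forall x, u 0%N (augF x) = augE (psi x).
Proof.
move=> [iF kF eF] [iE kE eE] hE.
have lw : linear (fun x => augE (psi x)) by move=> a x y; rewrite !linearP.
have [|u0 u0P] := @inj_ext _ _ _ _ augF (mklin lw) (hE 0%N).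
  by move=> x; rewrite -[0](linear0 augF) => /iF ->; rewrite linear0.
have [x /kF[y ->]|u hu uE] := @chain_extend F E u0 hE eF.
  by rewrite u0P; apply/kE; exists (psi y).
by exists u => // x; rewrite uE u0P.
Qed.

Lemma resolution_quasi_iso M N F E (augF : {linear N -> F 0%N}) (augE : {linear M -> E 0%N})
    (psi : {linear N -> M}) (u : forall n, {linear F n -> E n}) :
  resolves augF -> resolves augE -> cmap u ->
  (forall x, u 0%N (augF x) = augE (psi x)) -> injective psi -> (forall y, exists x, psi x = y) ->
  quasi_iso u [::].
Proof.
move=> [iF kF eF] [iE kE eE] hu uE pi ps; split=> [[|n] x [_ dx]|[|n] y [_ dy]].
- have /kF[y ->] := dx; rewrite uE /= -[0](linear0 augE) => /iE.
  by rewrite -[0](linear0 psi) => /pi ->; rewrite linear0.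
- by move=> _; have [y ->] := eF n x dx; exists y => //; apply: tors_nil.
- have /kE[z ->] := dy; have [x <-] := ps z; exists (augF x); last by rewrite uE /= subrr.
  by split; [exact: tors_nil|apply/kF; exists x].
exists 0; first exact: cyc0.
by have [z ->] := eE n y dy; exists z; [exact: tors_nil|rewrite linear0 subr0].
Qed.

End Complexes.

(** * Cohomology presented by classes of cycles *)

Section CohomologyClasses.
Variable R : comPzRingType.
Implicit Types (H M : lmodType R) (ys : seq R) (C F E : cplx R).

(* [cls] presents [H] as the [n]-th cohomology of the [ys]-torsion of [C]. *)
Definition presents ys C n H (cls : C n -> H) : Prop :=
  [/\ forall a x y, cyc ys x -> cyc ys y -> cls (a *: x + y) = a *: cls x + cls y,
      forall h, exists2 x, cyc ys x & h = cls x &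
      forall x, cyc ys x -> (cls x = 0 <-> bnd ys x)].

Lemma presents_sub ys C n H (cls : C n -> H) x y : presents ys cls ->
  cyc ys x -> cyc ys y -> cls (x - y) = cls x - cls y.
Proof. by move=> [l _ _] xc yc; rewrite addrC -scaleN1r l // scaleN1r addrC. Qed.

Lemma presents_eq ys C n H (cls : C n -> H) x y : presents ys cls ->
  cyc ys x -> cyc ys y -> (cls x = cls y <-> bnd ys (x - y)).
Proof.
move=> h xc yc; case: (h) => _ _ k; rewrite -k; last exact: cycB.
by rewrite (presents_sub h xc yc); split=> [->|/eqP]; rewrite ?subrr // subr_eq0 => /eqP.
Qed.

Lemma presents_quasi_iso ys F E (u : forall n, {linear F n -> E n}) n H (cls : E n -> H) :
  cmap u -> quasi_iso u ys -> presents ys cls -> presents ys (fun x : F n => cls (u n x)).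
Proof.
move=> hu [inj sur] h; case: (h) => l s k; split=> [a x y xc yc|z|x xc].
- by rewrite linearP l //; apply: cmap_cyc.
- have [y yc ->] := s z; have [x xc b] := sur n y yc; exists x => //.
  by apply/(presents_eq h yc) => //; apply: cmap_cyc.
rewrite k; last exact: cmap_cyc.
by split; [exact: inj|exact: cmap_bnd].
Qed.

(** Maps between quotients are given by relations on representatives. For a linear relation, being
    single valued need only be checked at 0. *)
Lemma linear_of_rel H H' (rho : H -> H' -> Prop) : (forall h, exists h', rho h h') ->
  (forall a x x' y y', rho x x' -> rho y y' -> rho (a *: x + y) (a *: x' + y')) ->
  (forall h', rho 0 h' -> h' = 0) ->
  exists f : {linear H -> H'}, forall h h', rho h h' -> f h = h'.
Proof.
move=> tot lin fun0; have [f fP] := choice tot.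
have fu x y y' : rho x y -> rho x y' -> y = y'.
  move=> h h'; apply/eqP; rewrite -subr_eq0; apply/eqP/fun0.
  by have := lin (-1) _ _ _ _ h' h; rewrite !scaleN1r addNr addrC.
have lf : linear f by move=> a x y; apply: fu (fP _) _; apply: lin.
by exists (mklin lf) => h h'; apply: fu.
Qed.

Lemma presents_map ys C n H (cls : C n -> H) C' n' H' (cls' : C' n' -> H')
    (v : {linear C n -> C' n'}) :
  presents ys cls -> presents ys cls' -> (forall x, cyc ys x -> cyc ys (v x)) ->
  (forall x, bnd ys x -> bnd ys (v x)) ->
  exists f : {linear H -> H'}, forall x, cyc ys x -> f (cls x) = cls' (v x).
Proof.
move=> [l s k] [l' s' k'] vc vb.
pose rho h h' := exists x, [/\ cyc ys x, h = cls x & h' = cls' (v x)].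
have [h|a _ _ _ _ [x [xc -> ->]] [y [yc -> ->]]|h' [x [xc /esym/k-/(_ xc) xb ->]]|f fP] :=
    @linear_of_rel H H' rho.
- by have [x xc ->] := s h; exists (cls' (v x)), x.
- exists (a *: x + y); rewrite linearP l // l' //; try exact: vc.
  by split=> //; exact: cycP.
- by apply/k'; [exact: vc|exact: vb].
by exists f => x xc; apply: fP; exists x.
Qed.

Lemma presents_iso ys C n H H' (cls : C n -> H) (cls' : C n -> H') :
  presents ys cls -> presents ys cls' -> exists f : {linear H -> H'}, bijective f.
Proof.
move=> h h'; have lid : linear (@id (C n)) by [].
have [f fP] := presents_map (v := mklin lid) h h' (fun _ h => h) (fun _ h => h).
have [g gP] := presents_map (v := mklin lid) h' h (fun _ h => h) (fun _ h => h).
exists f; exists g => z.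
  by case: h => _ s _ in fP gP *; have [x xc ->] := s z; rewrite fP // gP.
by case: h' => _ s _ in fP gP *; have [x xc ->] := s z; rewrite gP // fP.
Qed.

(** Induction on a bound for the sum of the exponents: multiplying [x] by an element of [ys] lowers
    its exponent by one, and a product of one factor more than this bound always suffices. *)
Lemma tors_exp ys (I : ideal R) M (x : M) : (forall a : R, a \ini I -> a \in span (ys : seq R^o)) ->
  tors ys x -> exists n, forall a : R, a \ini ideal_exp I n -> a *: x = 0.
Proof.
move=> Iys xT.
have [k kP] : exists k : R -> nat, forall y, y \in ys -> y ^+ k y *: x = 0.
  have h (y : R) : exists k, y \in ys -> y ^+ k *: x = 0.
    have [/xT[k ky]|] := boolP (y \in ys); first by exists k.
    by exists 0%N.
  by have [k kP] := choice h; exists k.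
have [N NP] : exists N : nat, (\sum_(y <- ys) k y <= N)%N by eexists.
exists N.+1.
elim: N k x kP NP {xT} => [|N IH] k x kP NP a aI.
  suff yx0 (y : R) : y \in ys -> y *: x = 0.
    have : a \ini I by move: aI; rewrite /ideal_exp big_ord_recl; case/in_sub=> s [/allP h ->];
      rewrite big_seq; apply: ideal_sum => p /h /andP[pI _]; apply: ideal_mulr.
    move=> /Iys; suff : {subset span (ys : seq R^o) <= colon (sub0 M) x}.
      by move=> h /h /in_colon /in_sub0.
    by apply: span_sub => y /yx0 yx; apply/in_colon/in_sub0.
  move=> yys; have := kP y yys; suff -> : k y = 0%N by rewrite expr0 scale1r => ->; rewrite scaler0.
  by apply/eqP; rewrite -leqn0; apply: leq_trans NP; rewrite (big_rem y yys) /= leq_addr.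
have yx0 (y : R) (b : R) : y \in ys -> b \ini ideal_exp I N.+1 -> b *: (y *: x) = 0.
  move=> yys; case ky : (k y) => [|j].
    by have := kP y yys; rewrite ky expr0 scale1r => -> _; rewrite !scaler0.
  apply: (IH (fun z => if z == y then j else k z)) => [z zys|].
    case: eqP => [->|_]; first by rewrite scalerA -exprSr -ky kP.
    by rewrite scalerA mulrC -scalerA kP // scaler0.
  rewrite -ltnS; apply: leq_trans NP; rewrite !(big_rem y yys) /= eqxx ky ltnS leq_add2l.
  by apply: leq_sum => z _; case: eqP => // ->; rewrite ky.
move: aI; rewrite /ideal_exp big_ord_recl; case/in_sub=> s [/allP h ->].
rewrite scaler_suml big_seq big1 // => p /h /andP[/Iys pI pE].
suff /(_ _ pI) : {subset span (ys : seq R^o) <= colon (sub0 M) ((p.2 : R) *: x)}.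
  by move=> /in_colon/in_sub0; rewrite scalerA.
by apply: span_sub => y yys; apply/in_colon/in_sub0; rewrite scalerA mulrC -scalerA yx0.
Qed.

Lemma torsion_tors ys (I : ideal R) M (x : M) :
  (forall a : R, a \ini I <-> a \in span (ys : seq R^o)) -> (x \in torsion M I) <-> tors ys x.
Proof.
move=> Iys; rewrite in_sub; split; last by apply: tors_exp => a /Iys.
move=> [n nP] y yys; exists n; apply: nP; apply: mem_ideal_exp.
by apply/Iys; apply: mem_span.
Qed.

Section LocalCohomology.
Hypothesis hR : noeth R^o.
Variables (m : ideal R) (ys : seq R).
Hypothesis hys : forall a : R, a \ini m <-> a \in span (ys : seq R^o).

Lemma augmented_dd M (E : augmented_sequence M) : injective_resolution E ->
  forall n x, seq_diff E n.+1 (seq_diff E n x) = 0.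
Proof. by move=> [_ _ _ h] n x; apply/h; exists x. Qed.

(** In degrees at least 0, local cohomology is unfolded only here; all later arguments use the
    presentation by classes. *)
Lemma lc_presented M : exists C (aug : {linear M -> C 0%N}),
  [/\ resolves aug, forall n, injective_module (C n) &
      forall n : nat, exists cls : C n -> local_cohomology m n%:Z M, presents ys cls].
Proof.
rewrite /local_cohomology.
case: pselect => [h|]; last by case; exact: injective_resolution_exists.
case: (cid h) => E hE /=.
pose C := Cplx (augmented_dd hE).
case: (hE) => Ei ai a0 an; exists C, (seq_aug E); split=> // [|n].
  by split=> // n x /an.
have tP k (z : E k) : (z \in torsion (E k) m) <-> tors ys z by apply: torsion_tors.
have cP (x : E n) : (x \in submod_of (torsion_cocycle_prop m E n)) <-> cyc (C := C) ys x.
  by rewrite in_sub; split=> -[h1 h2]; split=> //; apply/tP.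
have bP (x : E n) : torsion_coboundary m x <-> bnd (C := C) ys x.
  case: n x {cP} => [|n] x //=.
  by split=> -[y yT ->]; exists y => //; apply/tP.
(* Outside the torsion cocycles the value 0 is a mere default. *)
pose cls (x : E n) : torsion_cohomology m E n :=
  if pselect (x \in submod_of (torsion_cocycle_prop m E n)) is left h
  then quotient_pi _ (SubmodType h) else 0.
have clsE x (hx : x \in submod_of (torsion_cocycle_prop m E n)) :
    cls x = quotient_pi _ (SubmodType hx).
  by rewrite /cls; case: pselect => // hx'; congr quotient_pi; apply: val_inj.
exists cls; split=> [a x y /cP xc /cP yc|z|x /cP xc].
- have ac : a *: x + y \in submod_of (torsion_cocycle_prop m E n) by apply: rpredD; [apply: rpredZ|].
  rewrite !clsE; etransitivity; last exact: (linearP (qmap _) a (SubmodType xc) (SubmodType yc)).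
  by congr quotient_pi; apply: val_inj.
- rewrite -(quotient_reprK z); case: (quotient_repr z) => x xc.
  by exists x; [exact/cP|rewrite clsE].
rewrite clsE -bP.
apply: (iff_trans (qmap0 _ (SubmodType xc))).
by rewrite !in_sub.
Qed.

(** A resolution by good modules computes local cohomology: its comparison map to an injective
    resolution is a quasi-isomorphism and remains one on torsion. *)
Lemma lc_on (M N : lmodType R) F (augF : {linear N -> F 0%N}) (psi : {linear N -> M}) :
  resolves augF -> (forall n, good ys (fun _ : F n => True)) ->
  injective psi -> (forall y, exists x, psi x = y) ->
  forall n : nat, exists cls : F n -> local_cohomology m n%:Z M, presents ys cls.
Proof.
move=> rF gF pi ps n; have [E [augE [rE hE /(_ n)[cls hcls]]]] := lc_presented M.
have [u hu uE] := resolution_map psi rF rE hE.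
exists (fun x => cls (u n x)); apply: (presents_quasi_iso hu _ hcls).
apply: quasi_iso_tors => // [k|]; first exact: good_injective.
exact: resolution_quasi_iso rF rE hu uE pi ps.
Qed.

End LocalCohomology.
End CohomologyClasses.

(** * The long exact sequence of local cohomology *)

Section ShortExactSequences.
Variable R : comPzRingType.
Hypothesis hR : noeth R^o.
Implicit Types (ys : seq R).

Section Connecting.
Variables (A B C : lmodType R) (al : {linear A -> B}) (be : {linear B -> C}).
Hypotheses (ali : injective al) (bes : forall c, exists b, be b = c)
  (kbe : forall b, be b = 0 <-> exists a, b = al a).
Variables (FA EB EC : cplx R) (augA : {linear A -> FA 0%N}) (augB : {linear B -> EB 0%N})
  (augC : {linear C -> EC 0%N}).
Hypotheses (rA : resolves augA) (rB : resolves augB) (rC : resolves augC).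
Hypotheses (eA : forall n, injective_module (FA n)) (eB : forall n, injective_module (EB n))
  (eC : forall n, injective_module (EC n)).
Variable u : forall n, {linear FA n -> EB n}.
Hypotheses (hu : cmap u) (uE : forall x, u 0%N (augA x) = augB (al x)).

Let X := cone hu.

Let cone_exact1 (x : X 1%N) : cdiff X 1 x = 0 -> exists a b,
  x = (cdiff FA 0 a, u 0%N a + augB b).
Proof.
case: x => a b [da /eqP]; rewrite subr_eq0 => /eqP ub.
case: rA rB => _ _ exA [_ kB _]; have [a' aE] := exA 0%N a da.
have /kB[c cE] : cdiff EB 0 (b - u 0%N a') = 0 by rewrite linearB -hu -aE ub subrr.
by exists a', c; rewrite -cE aE addrC subrK.
Qed.

Let cone_exact2 n (x : X n.+2) : cdiff X n.+2 x = 0 -> exists y, x = cdiff X n.+1 y.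
Proof.
case: x => a b [da /eqP]; rewrite subr_eq0 => /eqP ub.
case: rA rB => _ _ exA [_ _ exB]; have [a' aE] := exA n.+1 a da.
have /exB[c cE] : cdiff EB n.+1 (b - u n.+1 a') = 0 by rewrite linearB -hu -aE ub subrr.
by exists (a', - c); rewrite /= linearN opprK -cE aE addrC subrK.
Qed.

Definition tail_cplx (F : cplx R) : cplx R :=
  @Cplx R (fun n => F n.+1) (fun n => cdiff F n.+1) (fun n => @cdd R F n.+1).

Definition shift_obj (F : cplx R) n : lmodType R := if n is k.+1 then F k else zero_module R.

Definition shift_fun F n : shift_obj F n -> shift_obj F n.+1 :=
  match n with 0 => fun=> 0 | k.+1 => cdiff F k end.

Lemma shift_linear F n : linear (@shift_fun F n).
Proof. by case: n => [|n] a p q; rewrite /= ?scaler0 ?addr0 // linearP. Qed.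

Lemma shift_dd F n x : shift_fun (@shift_fun F n x) = 0.
Proof. by case: n x => [|n] x /=; rewrite ?linear0 // cdd. Qed.

Definition shift_cplx F : cplx R := @Cplx R (shift_obj F)
  (fun n => mklin (@shift_linear F n)) (@shift_dd F).

(** The cone of a map between resolutions of [A] and [B] resolves the cokernel [C], one degree up.
    The maps [w] compare it with a resolution of [C], and they are a quasi-isomorphism on torsion as
    well. This replaces a simultaneous resolution of the three modules. *)
Lemma connecting_map : exists w : forall n, {linear X n.+1 -> EC n},
  [/\ forall n x, w n.+1 (cdiff X n.+1 x) = cdiff EC n (w n x),
      forall ys n x, bnd ys x -> bnd ys (w n x),
      forall ys n x, cyc ys x -> bnd ys (w n x) -> bnd ys x &
      forall ys n y, cyc ys y -> exists2 x, cyc ys x & bnd ys (y - w n x)].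
Proof.
case: (rA) (rB) (rC) => iA kA exA [iB kB exB] [iC kC exC].
have dl : linear (fun p : (FA 0%N * B)%type => (cdiff FA 0 p.1, u 0%N p.1 + augB p.2) : X 1%N).
  move=> a [p1 p2] [q1 q2]; congr (_, _); first by rewrite /= linearP.
  change (u 0%N (a *: p1 + q1) + augB (a *: p2 + q2) =
    a *: (u 0%N p1 + augB p2) + (u 0%N q1 + augB q2)).
  by rewrite !linearP addrACA -scalerDr.
have wl : linear (fun p : (FA 0%N * B)%type => augC (be p.2)).
  by move=> a [p1 p2] [q1 q2]; rewrite /= !linearP.
have [|w0 w0P] := @inj_ext R _ _ _ (mklin dl) (mklin wl) (@eC 0%N).
  move=> [a b] [/= /kA[c ->]]; rewrite uE -linearD -[0](linear0 augB) => /iB/eqP.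
  rewrite addr_eq0 => /eqP bE.
  suff -> : be b = 0 by rewrite linear0.
  by apply/kbe; exists (- c); rewrite linearN bE opprK.
have [||w hw wE] := @chain_extend R (tail_cplx X) EC w0 (@eC).
- by move=> n x /cone_exact2.
- by move=> x /cone_exact1[a [b ->]]; rewrite (w0P (a, b)); apply/kC; exists (be b).
have w00 a : w0 (cdiff X 0 a) = 0.
  by have := w0P (a, 0); rewrite /= !linear0 addr0.
(* Degree 0 of the cone has no counterpart in the resolution of [C]; the zero module prepended to
   the latter makes [w] a map of complexes. *)
pose w' n : {linear X n -> shift_cplx EC n} :=
  match n return {linear X n -> shift_cplx EC n} with
  | 0 => mklin (fun a p q => esym (etrans (congr1 (+%R^~ _) (scaler0 _ a)) (addr0 _)))
  | k.+1 => w k end.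
have hw' : cmap w'.
  case=> [|n] x; first by rewrite /= wE w00.
  exact: hw.
have q0 : quasi_iso w' [::].
  split=> [[|[|n]] x [_ dx]|[|[|n]] y [_ dy]].
  - move=> _; case: dx => /kA[c ->]; rewrite uE -[0](linear0 augB) => /iB.
    by rewrite -[0](linear0 al) => /ali ->; rewrite linear0.
  - have [a [b ->]] := cone_exact1 dx; move=> [e _].
    rewrite /= wE (w0P (a, b)) /= => wz.
    have {wz}: augC (be b) = 0 by [].
    rewrite -[0](linear0 augC) => /iC /kbe[c ->].
    exists (a + augA c); first exact: tors_nil.
    have dc : cdiff FA 0 (augA c) = 0 by apply/kA; exists c.
    by rewrite /= !linearD dc addr0 uE.
  - by have [z ->] := cone_exact2 dx; exists z => //; apply: tors_nil.
  - exists 0; [exact: cyc0|exact: thinmx0].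
  - have /kC[c ->] := dy; have [b <-] := bes c; exists (0, augB b).
      split; first exact: tors_nil.
      have db : cdiff EB 0 (augB b) = 0 by apply/kB; exists b.
      by rewrite /= !linear0 db subrr.
    exists 0; first exact: tors_nil.
    by rewrite /= wE; have := w0P (0, b); rewrite /= !linear0 add0r => ->; rewrite subrr.
  exists 0; first exact: cyc0.
  by have [z ->] := exC n y dy; exists z; [exact: tors_nil|rewrite linear0 subr0].
have q ys : quasi_iso w' ys.
  apply: quasi_iso_tors q0 => // [[|n]|[|n]].
  - exact: (good_injective _ hR (@eA 0%N)).
  - exact: (good_prod (good_injective _ hR (@eA n.+1)) (good_injective _ hR (@eB n))).
  - by apply: good_ext (@good0 _ _ ys) => z; split=> // _; exact: thinmx0.
  exact: (good_injective _ hR (@eC n)).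
exists w; split=> [|ys n x|ys n x xc|ys n y yc].
- exact: hw.
- by move/(cmap_bnd hw'); case: n x => [|n] x [z zT E]; [exact: E|by exists z].
- move=> wb; apply: ((q ys).1 n.+1 x xc).
  case: n x xc wb => [|n] x xc; last by case=> z zT E; exists z.
  by move=> E; exists 0; [exact: tors0|exact: E].
have [|x xc xb] := (q ys).2 n.+1 y.
  by case: yc.
exists x => //; case: n y yc x xc xb => [|n] y yc x xc [z zT E]; [exact: E|by exists z].
Qed.

Let bnd_fst ys n (p : X n.+1) : bnd ys p -> bnd ys p.1.
Proof.
case: n p => [|n] p [q qT ->]; first by exists q.
by exists q.1 => //; case/tors_pair: qT.
Qed.

Let bnd_snd ys n (y : EB n) : bnd ys ((0, y) : X n.+1) ->
  exists2 a : FA n, cyc ys a & bnd ys (y - u n a).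
Proof.
case: n y => [|n] y; first by move=> [a aT [da ->]]; exists a => //=; rewrite subrr.
move=> [[a b] /tors_pair[/= aT bT] [da ->]]; exists a => //.
by rewrite addrAC subrr add0r; apply: (@bndN _ ys EB n.+1); exists b.
Qed.

Let bnd_pair ys n (y : EB n) : bnd ys y -> bnd ys ((0, y) : X n.+1).
Proof.
case: n y => [|n] y; first by move=> ->; apply: (@bnd0 _ ys X 1%N).
move=> [e eT ->]; exists (0, - e).
  by apply/tors_pair; split; [exact: tors0|exact: torsN].
by rewrite /= !linear0 sub0r linearN opprK.
Qed.

(** The map [g] is induced by [w] on elements [(0, y)] of the cone. If this is a boundary, its first
    component provides the class of [A] that maps to [y]. *)
Lemma les_exact ys n (HA HB HC : lmodType R) (clsA : FA n -> HA) (clsB : EB n -> HB) (clsC : EC n -> HC) :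
  presents ys clsA -> presents ys clsB -> presents ys clsC ->
  exists (f : {linear HA -> HB}) (g : {linear HB -> HC}), forall h, g h = 0 -> exists a, h = f a.
Proof.
move=> pA pB pC; have [w [hw wb wi _]] := connecting_map.
have [f fP] := presents_map pA pB (fun x => @cmap_cyc _ _ _ _ hu ys n x)
  (fun x => @cmap_bnd _ _ _ _ hu ys n x).
have jl : linear (fun y : EB n => (0, y) : X n.+1).
  move=> a y z; congr (_, _); change (0 = a *: 0 + 0 :> FA n.+1).
  by rewrite scaler0 addr0.
have vl : linear (fun y : EB n => w n (mklin jl y)) by move=> a y z; rewrite !linearP.
have jc (y : EB n) : cyc ys y -> cyc ys (mklin jl y).
  move=> [yT dy]; split; first by apply/tors_pair; split=> //; apply: tors0.
  by rewrite /= !linear0 dy subrr.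
have jb (y : EB n) : bnd ys y -> bnd ys (w n (mklin jl y)).
  by move=> yb; apply: wb; apply: bnd_pair.
have wc (x : X n.+1) : cyc ys x -> cyc ys (w n x).
  move=> [xT dx]; split; first exact: tors_map.
  by rewrite -hw dx linear0.
have [g gP] := presents_map (v := mklin vl) pB pC (fun y yc => wc _ (jc y yc)) jb.
exists f, g => h gh; case: (pB) => _ sB _; case: (pC) => _ _ kC.
have [y yc hE] := sB h; move: gh; rewrite hE gP // kC; last exact/wc/jc.
move=> /(wi _ _ _ (jc y yc)).
move=> /bnd_snd[a ac ab]; exists (clsA a); rewrite fP //.
by apply/(presents_eq pB yc) => //; apply: cmap_cyc.
Qed.

(** The connecting map: the class of [w p], for a cycle [p] of the cone, goes to the class of
    [p.1]. *)
Lemma les_connect ys n (HC HA : lmodType R) (clsC : EC n -> HC) (clsA : FA n.+1 -> HA) :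
  presents ys clsC -> presents ys clsA ->
  exists f : {linear HC -> HA}, forall a, cyc ys a -> bnd ys (u n.+1 a) ->
    exists h, clsA a = f h.
Proof.
move=> pC pA; have [w [hw wb wi ws]] := connecting_map.
have wc (x : X n.+1) : cyc ys x -> cyc ys (w n x).
  move=> [xT dx]; split; first exact: tors_map.
  by rewrite -hw dx linear0.
have fc (x : X n.+1) : cyc ys x -> cyc ys x.1 by move=> [/tors_pair[xT _] [dx _]].
pose rho h h' := exists p : X n.+1, [/\ cyc ys p, h = clsC (w n p) & h' = clsA p.1].
case: (pC) (pA) => lC sC kC [lA sA kA].
have [h|c _ _ _ _ [p [pc -> ->]] [q [qc -> ->]]|h' [p [pc]]|f fP] := @linear_of_rel _ _ _ rho.
- have [y yc ->] := sC h; have [x xc xb] := ws _ _ y yc.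
  by exists (clsA x.1), x; split=> //; apply/(presents_eq pC yc) => //; apply: wc.
- exists (c *: p + q); split; first exact: cycP.
    by rewrite linearP lC //; apply: wc.
  by rewrite -lA //; apply: fc.
- move=> /esym/kC-/(_ (wc _ pc))/(wi _ _ _ pc) pb ->; apply/kA; first exact: fc.
  exact: bnd_fst.
exists f => a ac [b bT ab].
have abc : cyc ys ((a, b) : X n.+1).
  case: ac => aT da; split; first exact/tors_pair.
  by rewrite /= da ab subrr.
by exists (clsC (w n (a, b))); apply/esym/fP; exists (a, b).
Qed.

Lemma les_vanish ys n : (forall y : EB n, cyc ys y -> bnd ys y) ->
  (forall a : FA n.+1, cyc ys a -> bnd ys a) -> forall y : EC n, cyc ys y -> bnd ys y.
Proof.
move=> hB hA y yc; have [w [hw wb wi ws]] := connecting_map.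
have [[a b] [/tors_pair[/= aT bT] [da /eqP]]] := ws _ _ y yc.
rewrite subr_eq0 => /eqP ab yb.
have [a' a'T aE] := hA a (conj aT da).
rewrite -(subrK (w n (a, b)) y); apply: bndD => //; apply: wb.
have /hB bb : cyc ys (b - u n a').
  split; first by apply: torsB => //; apply: tors_map.
  by rewrite linearB -hu -aE ab subrr.
case: n y yc a b aT bT da ab yb a' a'T aE bb {hA hB} =>
  [|n] y yc a b aT bT da ab yb a' a'T aE.
  by move=> /eqP; rewrite subr_eq0 => /eqP ->; exists a'; rewrite //= -aE.
move=> [e eT bE]; exists (a', - e).
  by apply/tors_pair; split=> //; apply: torsN.
by rewrite /= linearN opprK -bE aE addrC subrK.
Qed.

End Connecting.

Lemma noeth_ideal (m : ideal R) : exists ys : seq R, forall a : R, a \ini m <-> a \in span (ys : seq R^o).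
Proof.
have [ys [ysm mys]] := hR m; exists ys => a; split; first exact: mys.
exact: (span_sub ysm).
Qed.

Lemma presents_zero ys (C : cplx R) n (H : lmodType R) (cls : C n -> H) : presents ys cls ->
  (forall h : H, h = 0) <-> (forall y : C n, cyc ys y -> bnd ys y).
Proof.
move=> [l s k]; split=> h y; first by move=> yc; apply/k.
by have [x xc ->] := s y; apply/k => //; apply: h.
Qed.

Variable m : ideal R.

Section Consequences.
Variables (A B C : lmodType R) (al : {linear A -> B}) (be : {linear B -> C}).
Hypotheses (ali : injective al) (bes : forall c, exists b, be b = c)
  (kbe : forall b, be b = 0 <-> exists a, b = al a).

Lemma lc_exact (n : nat) : exists (f : {linear local_cohomology m n%:Z A -> local_cohomology m n%:Z B})
  (g : {linear local_cohomology m n%:Z B -> local_cohomology m n%:Z C}),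
  forall h, g h = 0 -> exists a, h = f a.
Proof.
have [ys hys] := noeth_ideal m.
have [FA [augA [rA eA /(_ n)[clsA pA]]]] := lc_presented hys A.
have [EB [augB [rB eB /(_ n)[clsB pB]]]] := lc_presented hys B.
have [EC [augC [rC eC /(_ n)[clsC pC]]]] := lc_presented hys C.
have [u hu uE] := resolution_map al rA rB eB.
exact: (les_exact (@ali) bes kbe rA rB rC eA eB eC hu uE pA pB pC).
Qed.

Lemma lc_vanish (n : nat) : (forall h : local_cohomology m n%:Z B, h = 0) ->
  (forall h : local_cohomology m n.+1%:Z A, h = 0) ->
  forall h : local_cohomology m n%:Z C, h = 0.
Proof.
have [ys hys] := noeth_ideal m.
have [FA [augA [rA eA /(_ n.+1)[clsA pA]]]] := lc_presented hys A.
have [EB [augB [rB eB /(_ n)[clsB pB]]]] := lc_presented hys B.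
have [EC [augC [rC eC /(_ n)[clsC pC]]]] := lc_presented hys C.
have [u hu uE] := resolution_map al rA rB eB.
rewrite (presents_zero pA) (presents_zero pB) (presents_zero pC).
move=> hB hA; exact: (les_vanish (@ali) bes kbe rA rB rC eA eB eC hu uE hB hA).
Qed.

End Consequences.

Section Multiplication.
Variables (M C : lmodType R) (x : R) (be : {linear M -> C}).
Hypotheses (xreg : forall z : M, x *: z = 0 -> z = 0) (bes : forall c, exists b, be b = c)
  (kbe : forall b, be b = 0 <-> exists a, b = x *: a).

Lemma scale_linear (V : lmodType R) : linear (fun z : V => x *: z).
Proof. by move=> a y z; rewrite scalerDr !scalerA mulrC. Qed.

Lemma scale_reg : injective (mklin (@scale_linear M)).
Proof.
by move=> y z /eqP; rewrite -subr_eq0 -linearB => /eqP/xreg/eqP; rewrite subr_eq0 => /eqP.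
Qed.

Lemma lc_kernel0 (z : local_cohomology m 0 M) : x *: z = 0 -> z = 0.
Proof.
have [ys hys] := noeth_ideal m.
have [E [aug [[iE kE exE] hE /(_ 0%N)[cls [l s k]]]]] := lc_presented hys M.
have [y yc ->] := s z; have cls0 : cls 0 = 0 by apply/k; [exact: cyc0|].
rewrite -[_ *: _]addr0 -cls0 -l; [|exact: yc|exact: cyc0].
rewrite addr0 cls0 => h; have /= xy0 := iffLR (k _ (cycZ x yc)) h; apply/k => //=.
case: yc => _ /kE[c yE]; move: xy0; rewrite yE -linearZ /= -[0](linear0 aug) => /iE/xreg ->.
by [].
Qed.

(** Source and target are resolved by the same complex, so the comparison map can be multiplication
    by [x], which then acts as [x] on cohomology. *)
Lemma lc_kernel (n : nat) :
  exists f : {linear local_cohomology m n%:Z C -> local_cohomology m n.+1%:Z M},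
    forall z, x *: z = 0 -> exists h, z = f h.
Proof.
have [ys hys] := noeth_ideal m.
have [E [aug [rE eE /(_ n.+1)[cls pE]]]] := lc_presented hys M.
have [EC [augC [rC eC /(_ n)[clsC pC]]]] := lc_presented hys C.
pose u k : {linear E k -> E k} := mklin (@scale_linear (E k)).
have hu : cmap u by move=> k y; rewrite /= linearZ.
have uE z : u 0%N (aug z) = aug (mklin (@scale_linear M) z) by rewrite /= linearZ.
have [f fP] := les_connect scale_reg bes kbe rE rE rC eE eE eC hu uE pC pE.
exists f => z; case: (pE) => l s k; have [a ac ->] := s z => xa.
apply: fP => //; apply/k; first exact: cycZ.
rewrite /= -[_ *: _]addr0 l //; last exact: cyc0.
by rewrite xa add0r; apply/k; [exact: cyc0|exact: bnd0].
Qed.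

End Multiplication.

Lemma lc_torsion (n : nat) (M : lmodType R) (z : local_cohomology m n%:Z M) (y : R) : y \ini m ->
  exists k, y ^+ k *: z = 0.
Proof.
have [ys hys] := noeth_ideal m.
have [E [aug [rE eE /(_ n)[cls [l s k]]]]] := lc_presented hys M.
have [x xc ->] := s z => ym.
have cls0 : cls 0 = 0 by apply/k; [exact: cyc0|exact: bnd0].
case: (xc) => xT _; have [N NP] := tors_exp (fun a => iffLR (hys a)) xT.
exists N; rewrite -[_ *: _]addr0 -cls0 -l //; last exact: cyc0.
by rewrite addr0 NP //; apply: mem_ideal_exp.
Qed.

End ShortExactSequences.

(** * Finite extensions *)

Section FiniteExtensions.
Variables (R S : comPzRingType) (phi : {rmorphism R -> S}).
Hypotheses (hR : noeth R^o) (hfin : fin_gen (restrict_scalars phi (S^o : lmodType S))).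
Let SR : lmodType R := restrict_scalars phi (S^o : lmodType S).

Lemma contract_prop (J : ideal S) : @submod_prop R R^o (fun a => phi a \ini J).
Proof.
split; first by rewrite rmorph0 ideal0.
move=> a u v uJ vJ; rewrite rmorphD rmorphM; apply: ideal_add => //; exact: ideal_mull.
Qed.

Definition contract (J : ideal S) : ideal R := submod_of (contract_prop J).

Lemma in_contract J a : (a \ini contract J) <-> (phi a \ini J).
Proof. exact: in_sub. Qed.

Lemma contract_prime Q : prime_ideal Q -> prime_ideal (contract Q).
Proof.
move=> hQ; split; first by apply/negP => /in_contract; rewrite rmorph1; apply: prime_not1.
by move=> x y /in_contract; rewrite rmorphM => /hQ.2[h|h]; [left|right]; apply/in_contract.
Qed.

Lemma restrict_sub_prop (V : lmodType S) (W : submodClosed V) :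
  @submod_prop R (restrict_scalars phi V) (fun x => (x : V) \in W).
Proof. by split=> [|a u v uW vW]; [exact: rpred0|apply: rpredD => //; apply: rpredZ]. Qed.

Definition restrict_sub (V : lmodType S) (W : submodClosed V) :
  submodClosed (restrict_scalars phi V) := submod_of (restrict_sub_prop W).

Lemma finite_span : exists s : seq SR, forall x, x \in span s.
Proof. exact/fin_genP. Qed.

Lemma restrict_fg (V : lmodType S) : fgm V -> fgm (restrict_scalars phi V : lmodType R).
Proof.
move=> [t tV]; have [s sS] := finite_span.
exists [seq (x : S) *: v | x <- s, v <- t] => x.
have := tV x; elim: t x {tV} => [|v t IH] x.
  by move=> /span_nil ->; apply: rpred0.
case/span_cons=> a /IH h; rewrite -(subrK (a *: v) x) addrC.
have h1 : {subset span ([seq (x : S) *: v | x <- s, v <- t] : seq (restrict_scalars phi V)) <=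
           span ([seq (x : S) *: v | x <- s, v <- v :: t] : seq (restrict_scalars phi V))}.
  apply: span_sub => y /allpairsPdep[b [w [bs wt ->]]]; apply: mem_span.
  by apply/allpairsPdep; exists b, w; rewrite inE wt orbT.
apply: rpredD; last exact: h1.
pose f (b : SR) : restrict_scalars phi V := (b : S) *: v.
have fl : linear f by move=> b y z; rewrite /f scalerDl -scalerA.
have := span_map (mklin fl) (sS (a : SR)).
apply: span_sub => _ /mapP[b bs ->]; apply: mem_span.
by apply/allpairsPdep; exists b, v; rewrite inE eqxx.
Qed.

Lemma restrict_noeth (V : lmodType S) : noeth (restrict_scalars phi V : lmodType R) -> noeth V.
Proof.
move=> h W; have [s [sW Ws]] := h (restrict_sub W); exists s; split.
  by move=> x /sW /in_sub.
move=> x xW; have /Ws : (x : restrict_scalars phi V) \in restrict_sub W by apply/in_sub.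
have p := restrict_sub_prop (span (s : seq V)).
suff hs : {subset span (s : seq (restrict_scalars phi V)) <= submod_of p} by move=> /hs/in_sub.
by apply: span_sub => y ys; apply/in_sub/mem_span.
Qed.

Lemma finite_noeth : noeth S^o.
Proof. by apply: restrict_noeth; apply: noeth_fg => //; apply: finite_span. Qed.

Lemma integral_relation (s : S) : exists n (c : nat -> R), s ^+ n = \sum_(i < n) phi (c i) * s ^+ i.
Proof.
have hS : noeth SR by apply: noeth_fg => //; apply: finite_span.
pose t n : seq SR := [seq s ^+ i | i <- iota 0 n].
have [i|n nP] := @noeth_chain _ _ (fun n => span (t n)) hS.
  apply: span_sub => x /mapP[j]; rewrite mem_iota => /andP[_ ji] ->; apply: mem_span.
  by apply/mapP; exists j => //; rewrite mem_iota /=; apply: leq_trans ji _.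
have /nP/span_sum[c] : (s ^+ n : SR) \in span (t n.+1).
  by apply: mem_span; apply/mapP; exists n => //; rewrite mem_iota /=.
rewrite size_map size_iota => E; exists n, c; rewrite E.
apply: eq_bigr => i _; rewrite (nth_map 0%N) ?size_iota // nth_iota //.
Qed.

(** A monic relation of least degree for [s] modulo [Q]; as 1 is not in [Q], its degree is
    positive. *)
Lemma minimal_relation (Q : ideal S) (s : S) : ~ ((1 : S) \ini Q) -> exists n (c : nat -> R),
  (s ^+ n.+1 - \sum_(i < n.+1) phi (c i) * s ^+ i) \ini Q /\
  forall c' : nat -> R, ~ ((s ^+ n - \sum_(i < n) phi (c' i) * s ^+ i) \ini Q).
Proof.
move=> Q1.
pose p n := `[< exists c : nat -> R, (s ^+ n - \sum_(i < n) phi (c i) * s ^+ i) \ini Q >].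
have pe : exists n, p n.
  have [n [c E]] := integral_relation s; exists n; apply/asboolP; exists c.
  by rewrite E subrr ideal0.
case: (ex_minnP pe) => -[|n] /asboolP[c cQ] nmin.
  by case: Q1; move: cQ; rewrite big_ord0 subr0.
exists n, c; split=> // c' h; have := nmin n; rewrite ltnn => h'.
by suff: false by []; apply: h'; apply/asboolP; exists c'.
Qed.

(** The witness is the constant coefficient of a monic relation of least degree for [s] modulo [P].
    All other terms are in [Q] with [s], hence so is this one; if it were in [P], a factor [s] could
    be cancelled and the degree would drop. *)
Lemma incomparability (P Q : ideal S) (s : S) : prime_ideal P -> {subset P <= Q} ->
  s \ini Q -> ~ (s \ini P) -> exists2 a : R, phi a \ini Q & ~ (phi a \ini P).
Proof.
move=> hP PQ sQ sP; have [n [c [cP nmin]]] := minimal_relation s (prime_not1 hP).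
exists (c 0%N) => [|c0].
  have /PQ := cP; rewrite big_ord_recl expr0 mulr1 /=; set T := \sum_(i < n) _ => h.
  have -> : phi (c 0%N) = (s ^+ n.+1 - T) - (s ^+ n.+1 - (phi (c 0%N) + T)).
    by ring.
  apply: ideal_sub => //; apply: ideal_sub; first exact: ideal_expn.
  by apply: ideal_sum => i _; rewrite exprS mulrCA; apply: ideal_mulr.
apply: (nmin (fun i => c i.+1)).
have : s * (s ^+ n - \sum_(i < n) phi (c i.+1) * s ^+ i) \ini P.
  suff <- : s ^+ n.+1 - \sum_(i < n.+1) phi (c i) * s ^+ i + phi (c 0%N) =
      s * (s ^+ n - \sum_(i < n) phi (c i.+1) * s ^+ i) by apply: ideal_add.
  rewrite big_ord_recl expr0 mulr1 /= opprD addrA addrAC subrK mulrBr -exprS.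
  congr (_ - _); rewrite mulr_sumr; apply: eq_bigr => i _.
  by rewrite exprS mulrCA.
by case/hP.2.
Qed.

(** The set [K] is [J + p S], written with a fixed list of generators. It avoids the image of the
    complement of [p]: if [phi a] is in it, the determinant trick gives [c], congruent to a power of
    [a] modulo [p], with [c S] inside [J], so [c] and then [a] are in [p]. *)
Lemma lying_over (J : ideal S) (p : ideal R) : prime_ideal p -> {subset contract J <= p} ->
  exists Q, [/\ prime_ideal Q, {subset J <= Q} & contract Q =i p].
Proof.
move=> hp Jp; have [s sS] := finite_span.
pose K (x : S) := exists c : nat -> R, (forall i, c i \ini p) /\
  (x - \sum_(i < size s) phi (c i) * s`_i) \ini J.
have Kp : @submod_prop S S^o K.
  split.
    exists (fun=> 0); split=> [i|]; first exact: ideal0.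
    by rewrite big1 ?subr0 ?ideal0 // => i _; rewrite rmorph0 mul0r.
  move=> a u v [c [cp cu]] [d [dp dv]].
  have he i : exists e : nat -> R, (a * s`_i : S) = \sum_(j < size s) phi (e j) * s`_j.
    by have [e eE] := span_sum (sS (a * s`_i : S)); exists e.
  have [e eP] := choice he.
  exists (fun j => \sum_(i < size s) c i * e i j + d j); split=> [j|].
    by apply: ideal_add => //; apply: ideal_sum => i _; apply: ideal_mulr.
  set X := (X in _ - X).
  suff <- : a * (u - \sum_(i < size s) phi (c i) * s`_i) +
      (v - \sum_(i < size s) phi (d i) * s`_i) = (a * u + v : S) - X.
    by apply: ideal_add => //; apply: ideal_mull.
  rewrite {}/X mulrBr addrACA -opprD; congr (_ - _).
  rewrite mulr_sumr.
  under eq_bigr => i _ do rewrite mulrCA eP mulr_sumr.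
  rewrite exchange_big -big_split /=; apply: eq_bigr => j _.
  rewrite rmorphD rmorph_sum mulrDl mulr_suml; congr (_ + _); apply: eq_bigr => i _.
  by rewrite rmorphM mulrA.
have [||t [a [ap ->]] /in_sub|Q [hQ JQ TQ]] :=
    @prime_avoiding S (submod_of Kp) (fun t => exists a, ~ (a \ini p) /\ t = phi a) finite_noeth.
- by exists 1; rewrite rmorph1; split=> //; apply: prime_not1.
- move=> _ _ [a [ap ->]] [b [bp ->]]; exists (a * b); rewrite rmorphM; split=> //.
  exact: prime_notM.
- move=> aK; have [x _|c [cp cJ]] := @cayley R p SR (restrict_sub J) s a.
    have : (x : S) * phi a \ini submod_of Kp by apply: ideal_mull; apply/in_sub.
    move/in_sub=> [c [cp cx]]; exists c; split=> //; apply/in_sub.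
    by move: cx; rewrite mulrC.
  apply: ap; apply: (prime_expn hp (n := size s)); rewrite -[_ ^+ _](subKr c); apply: ideal_sub => //.
  apply: Jp; apply/in_contract.
  pose Z : submodClosed SR := preim (mklin (@scale_linear R c SR)) (restrict_sub J).
  have ZS : {subset span s <= Z} by apply: span_sub => x /cJ h; apply/in_sub.
  have /in_sub/in_sub := ZS _ (sS (1 : S)).
  by rewrite /= /GRing.scale /= /restrict_scale /GRing.scale /= mulr1.
exists Q; split=> // [x xJ|a].
  apply: JQ; apply/in_sub; exists (fun=> 0); split=> [i|]; first exact: ideal0.
  by rewrite big1 ?subr0 // => i _; rewrite rmorph0 mul0r.
apply/idP/idP => [/in_contract aQ|ap].
  by apply: contrapT => ap; apply: (TQ (phi a)) => //; exists a.
apply/in_contract; apply: JQ; apply/in_sub.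
have [c cE] := span_sum (sS (1 : S)).
exists (fun i => a * c i); split=> [i|]; first exact: ideal_mulr.
have -> : \sum_(i < size s) phi (a * c i) * s`_i = phi a * \sum_(i < size s) phi (c i) * s`_i.
  by rewrite mulr_sumr; apply: eq_bigr => i _; rewrite rmorphM mulrA.
by rewrite -[\sum_(i < _) _]cE mulr1 subrr ideal0.
Qed.

Lemma going_up n (P : nat -> ideal R) (J : ideal S) :
  (forall i, (i <= n)%N -> prime_ideal (P i)) ->
  (forall i, (i < n)%N -> {subset P i <= P i.+1}) -> {subset contract J <= P 0%N} ->
  exists Q : nat -> ideal S, [/\ forall i, (i <= n)%N -> prime_ideal (Q i) /\ contract (Q i) =i P i,
     forall i, (i < n)%N -> {subset Q i <= Q i.+1} & {subset J <= Q 0%N}].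
Proof.
elim: n P J => [|n IH] P J hP sP JP.
  have [Q [hQ JQ cQ]] := lying_over (hP 0%N isT) JP.
  by exists (fun=> Q); split=> // -[].
have [Q0 [hQ JQ cQ]] := lying_over (hP 0%N isT) JP.
have [|||Q [hQ' sQ' JQ']] := IH (fun i => P i.+1) Q0.
- by move=> i hi; apply: hP.
- by move=> i hi; apply: sP.
- by move=> a; rewrite cQ; apply: sP.
exists (fun i => if i is k.+1 then Q k else Q0); split=> // [[|i] hi|[|i] hi] //.
- exact: hQ'.
- exact: sQ'.
Qed.

(** Chains lift by going up, and contracted chains stay strict by incomparability. *)
Lemma chain_contract (J : ideal S) n : chain (contract J) n <-> chain J n.
Proof.
split=> [[P [hP sP JP]]|[Q [hQ sQ JQ]]].
  have [i hi|Q [hQ sQ JQ]] := going_up hP _ JP; first by have [] := sP i hi.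
  exists Q; split=> // [i hi|i hi]; first by have [] := hQ i hi.
  split; first exact: sQ.
  move=> h; have [_] := sP i hi; apply=> a.
  rewrite -(hQ i.+1 hi).2 -(hQ i (ltnW hi)).2 => /in_contract/h hh; exact/in_contract.
exists (fun i => contract (Q i)); split=> [i hi|i hi|a /in_contract/JQ h]; last exact/in_contract.
  exact/contract_prime/hQ.
have [s1 s2] := sQ i hi; split=> [a /in_contract/s1 h|h]; first exact/in_contract.
have [s [sQ1 sQ0]] : exists s : S, s \ini Q i.+1 /\ ~ (s \ini Q i).
  apply: contrapT => hn; apply: s2 => s sQ1; apply: contrapT => sQ0; apply: hn.
  by exists s.
have [a aQ aQ'] := incomparability (hQ i (ltnW hi)) s1 sQ1 sQ0.
by apply: aQ'; apply/in_contract/h/in_contract.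
Qed.

Lemma ann_contract (V : lmodType S) : ann (restrict_scalars phi V : lmodType R) =i contract (ann V).
Proof.
by move=> a; apply/idP/idP => [/in_sub h|/in_contract/in_sub h]; [apply/in_contract|];
  apply/in_sub.
Qed.

Lemma chain_ann (V : lmodType S) n :
  chain (ann (restrict_scalars phi V : lmodType R)) n <-> chain (ann V) n.
Proof.
by rewrite -chain_contract; split; apply: chain_mono => a; rewrite ann_contract.
Qed.

Section Local.
Variables (m : ideal R) (n : ideal S).
Hypotheses (hm : noetherian_local m) (hn : noetherian_local n).

(** If [phi a] were a unit, then [S = m S], and Nakayama's lemma would make [S] zero. *)
Lemma contract_local a : a \ini m -> phi a \ini n.
Proof.
move=> am; apply: contrapT => /(local_unit hn)[b ab].
have [s sS] := finite_span.
have s0 : {subset s <= sub0 SR}.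
  apply: (nakayama hm) => x xs.
  have [c cE] := span_sum (sS ((b * x : S) : SR)).
  exists (fun i => a * c i); split=> [i|]; first exact: ideal_mulr.
  apply/in_sub0/eqP; rewrite subr_eq0; apply/eqP.
  transitivity (a *: ((b * x : S) : SR)).
    by rewrite /GRing.scale /= /restrict_scale /GRing.scale /= mulrA ab mul1r.
  by rewrite cE scaler_sumr; apply: eq_bigr => i _; rewrite scalerA.
apply: (local_not1 hn).
have /in_sub0 -> := span_sub s0 (sS (1 : S)); exact: ideal0.
Qed.

Lemma prime_contract_max (Q : ideal S) : prime_ideal Q -> {subset m <= contract Q} ->
  {subset n <= Q}.
Proof.
move=> hQ mQ s sn; apply: contrapT => sQ.
have [a an aQ] := incomparability hQ (prime_sub_local hn hQ) sn sQ.
apply: aQ; apply/in_contract/mQ; apply: contrapT => /(local_unit hm)[b ab].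
apply: (local_not1 hn); rewrite -[1](rmorph1 phi) -ab rmorphM; exact: ideal_mulr.
Qed.

(* Both torsion functors agree because [n] is the radical of [m S]. *)
Lemma torsion_restrict (V : lmodType S) (v : V) :
  (v \in torsion V n) <-> ((v : restrict_scalars phi V) \in torsion (restrict_scalars phi V) m).
Proof.
have [ms hms] := noeth_ideal hR m; have [ns hns] := noeth_ideal finite_noeth n.
rewrite (torsion_tors _ hms) (torsion_tors _ hns); split=> [vT y yms|vT y yns].
  have [k kP] := tors_exp (fun a => iffLR (hns a)) vT; exists k.
  rewrite /GRing.scale /= /restrict_scale rmorphXn; apply: kP; apply: mem_ideal_exp.
  by apply: contract_local; apply/hms/mem_span.
apply: contrapT => hk.
(* If no power of [y] kills [v], some prime above the annihilator of [v] avoids [y]; it contains the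
   image of [m], hence [n], hence [y]. *)
have [|_ _ [k ->] [l ->]|_ [k ->] /in_colon/in_sub0 yk|Q [hQ vQ yQ]] :=
  @prime_avoiding S (colon (sub0 V) v) (fun t => exists k, t = y ^+ k) finite_noeth.
- by exists 0%N.
- by exists (k + l)%N; rewrite exprD.
- by apply: hk; exists k.
apply: (yQ y); first by exists 1%N.
apply: (prime_contract_max hQ); last by apply/hns/mem_span.
have mQ : {subset (ms : seq R^o) <= contract Q}.
  move=> a ams; apply/in_contract; have [k ka] := vT a ams; apply: (prime_expn hQ (n := k)).
  apply: vQ; apply/in_colon/in_sub0; rewrite -rmorphXn; exact: ka.
by move=> a /hms/(span_sub mQ).
Qed.

End Local.
End FiniteExtensions.

(** * Invariance of local cohomology, and torsion modules *)

Section Presentations.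
Variable R : comPzRingType.
Hypothesis hR : noeth R^o.
Variable m : ideal R.

Lemma lc_iso (M N : lmodType R) (psi : {linear N -> M}) (i : int) :
  injective psi -> (forall y, exists x, psi x = y) ->
  exists f : {linear local_cohomology m i N -> local_cohomology m i M}, bijective f.
Proof.
move=> pi ps; case: i => n; last first.
  have l0 : linear (@id (zero_module R)) by [].
  by exists (mklin l0); exists id.
have [ys hys] := noeth_ideal hR m.
have [C [aug [rC eC /(_ n)[cls pC]]]] := lc_presented hys N.
have gC k : good ys (fun _ : C k => True) by apply: (good_injective _ hR (eC k)).
have [cls' pC'] := lc_on hR hys rC gC pi ps n.
exact: presents_iso pC pC'.
Qed.

(** On the zero module, [x = 0] is regular with cokernel the module itself. Every class is killed by
    0, so each degree is covered by the one below. *)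
Lemma lc_zero (n : nat) (M : lmodType R) : (forall x : M, x = 0) ->
  forall z : local_cohomology m n%:Z M, z = 0.
Proof.
move=> M0.
have idl : linear (@id M) by [].
have [reg sur ker] : [/\ forall z : M, (0 : R) *: z = 0 -> z = 0,
    forall c : M, exists b, mklin idl b = c &
    forall b, mklin idl b = 0 <-> exists a : M, b = (0 : R) *: a].
  by split=> [z|c|b]; [rewrite (M0 z)|exists c|split=> // _; exists 0; rewrite (M0 b) scale0r].
elim: n => [|n IH] z; first by apply: (lc_kernel0 hR reg); rewrite scale0r.
have [f fP] := lc_kernel hR m reg sur ker n.
by have [|h ->] := fP z; [rewrite scale0r|rewrite (IH h) linear0].
Qed.

Section TorsionModule.
Variable M : lmodType R.

Definition point_obj n : lmodType R := if n is 0%N then M else zero_module R.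

Lemma point_linear n : linear (fun _ : point_obj n => 0 : point_obj n.+1).
Proof. by move=> a u v; rewrite scaler0 addr0. Qed.

Definition point_cplx : cplx R :=
  @Cplx R point_obj (fun n => mklin (@point_linear n)) (fun n x => erefl).

(* A torsion module is its own good resolution. *)
Lemma lc_torsion_module (ys : seq R) : (forall a : R, a \ini m <-> a \in span (ys : seq R^o)) ->
  (forall x : M, tors ys x) ->
  (exists f : {linear M -> local_cohomology m 0 M}, forall z, exists x, z = f x) /\
  forall (n : nat) (z : local_cohomology m n.+1%:Z M), z = 0.
Proof.
move=> hys MT.
have idl : linear (@id M) by [].
have r : @resolves R point_cplx M (mklin idl).
  split=> // [x|n x _]; first by split=> // _; exists x.
  exists 0; exact: thinmx0.
have g n : good ys (fun _ : point_cplx n => True).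
  case: n => [|n] /=; last by apply: good_ext (@good0 _ _ ys) => z; split=> // _; exact: thinmx0.
  elim: ys MT {hys} => //= x ys IH MT; split.
    by apply: IH => z; have /tors_cons[] := MT z.
  move=> z _ _; exists 0; split=> //; first exact: tors0.
  have /tors_cons[[N zN] _] := MT z; exists N.
  by rewrite scaler0 sub0r scalerN zN oppr0.
have pres := lc_on hR hys r g (psi := mklin idl) (fun x y e => e) (fun y => ex_intro _ y erefl).
split=> [|n z].
  have [cls [l s k]] := pres 0%N.
  have cycT (x : M) : cyc (C := point_cplx) (n := 0) ys x by [].
  have lf : linear (cls : M -> _) by move=> a x y; apply: l.
  by exists (mklin lf) => z; have [x _ ->] := s z; exists x.
have [cls [l s k]] := pres n.+1.
have [x xc ->] := s z; apply/k => //.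
have -> : x = 0 by exact: thinmx0.
exact: (@bnd0 _ ys point_cplx n.+1).
Qed.

End TorsionModule.
End Presentations.

(** * Artinianness of local cohomology *)

Section Artinian.
Variable R : comPzRingType.

Lemma dcc_mono (M : lmodType R) (D : nat -> submodClosed M) :
  (forall i, {subset D i.+1 <= D i}) -> forall i j, (i <= j)%N -> {subset D j <= D i}.
Proof.
move=> hD i j /subnK <-; elim: (j - i)%N => // k IH x; rewrite addSn => /hD; exact: IH.
Qed.

Lemma artinian_ext (A B C : lmodType R) (f : {linear A -> B}) (g : {linear B -> C}) :
  (forall h, g h = 0 -> exists a, h = f a) -> artinian A -> artinian C -> artinian B.
Proof.
move=> ex hA hC D hD.
have [i x /in_sub h|n1 h1] := hA (fun i => preim f (D i)); first by apply/in_sub/hD.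
have [i x /in_sub[b bD ->]|n2 h2] := hC (fun i => image_sub g (D i)).
  by apply/in_sub; exists b => //; apply: hD.
exists (maxn n1 n2) => i hi x.
have mono := dcc_mono hD.
apply/idP/idP; first exact: mono.
move=> xD.
have i1 : (n1 <= i)%N := leq_trans (leq_maxl _ _) hi.
have i2 : (n2 <= i)%N := leq_trans (leq_maxr _ _) hi.
have : g x \in image_sub g (D i).
  by rewrite h2 //; apply/in_sub; exists x => //; apply: mono xD; apply: leq_maxr.
case/in_sub=> y yD xy; have [a xyE] : exists a, x - y = f a by apply: ex; rewrite linearB xy subrr.
rewrite -(subrK y x) rpredD // xyE.
have : a \in preim f (D i).
  rewrite h1 //; apply/in_sub; rewrite -xyE submodB //.
    by apply: mono xD; apply: leq_maxl.
  exact: mono yD.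
by move/in_sub.
Qed.

Lemma artinian_zero (A : lmodType R) : (forall x : A, x = 0) -> artinian A.
Proof. by move=> A0 D _; exists 0%N => i _ x; rewrite (A0 x) !rpred0. Qed.

Lemma artinian_inj (B C : lmodType R) (g : {linear B -> C}) :
  injective g -> artinian C -> artinian B.
Proof.
move=> gi; have l0 : linear (fun _ : zero_module R => 0 : B) by move=> a x y; rewrite scaler0 addr0.
apply: (artinian_ext (f := mklin l0)) => [h|]; last by apply: artinian_zero => x; exact: thinmx0.
by rewrite -[0](linear0 g) => /gi ->; exists 0.
Qed.

Lemma artinian_surj (A B : lmodType R) (f : {linear A -> B}) :
  (forall z, exists x, z = f x) -> artinian A -> artinian B.
Proof.
move=> fs hA; have l0 : linear (fun _ : B => 0 : zero_module R) by move=> a x y; rewrite scaler0 addr0.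
apply: (artinian_ext (f := f) (g := mklin l0)) => // x.
by apply: artinian_zero => y; exact: thinmx0.
Qed.

(* The submodules [x ^ k (D i :&: (0 : x ^ k.+1))] of [0 : x] decrease in both
   indices, hence are eventually constant in [i] uniformly in [k]. *)
Lemma artinian_kernel (A H : lmodType R) (x : R) (f : {linear H -> A}) : artinian H ->
  (forall z : A, x *: z = 0 -> exists h, z = f h) ->
  (forall z : A, exists k, x ^+ k *: z = 0) -> artinian A.
Proof.
move=> hH ker tor D hD; have mono := dcc_mono hD.
have Pp k i : @submod_prop R H (fun h => exists w, [/\ w \in D i, x ^+ k.+1 *: w = 0 &
    f h = x ^+ k *: w]).
  split; first by exists 0; split; rewrite ?rpred0 ?linear0 ?scaler0.
  move=> a u v [w [wD wk uE]] [w' [wD' wk' vE]]; exists (a *: w + w'); split.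
  - by rewrite rpredD ?rpredZ.
  - by rewrite scalerDr scalerA mulrC -scalerA wk scaler0 wk' addr0.
  - by rewrite linearP uE vE scalerDr !scalerA mulrC.
pose P k i := submod_of (Pp k i).
have Pi k i j : (i <= j)%N -> {subset P k j <= P k i}.
  by move=> ij h /in_sub[w [wD w0 hE]]; apply/in_sub; exists w; split=> //; apply: mono wD.
have Pk k l i : (k <= l)%N -> {subset P l i <= P k i}.
  move=> /subnK <-; elim: (l - k)%N => // d IH h; rewrite addSn => /in_sub[w [wD w0 hE]].
  apply: IH; apply/in_sub; exists (x *: w); split; first exact: rpredZ.
    by rewrite scalerA -exprSr.
  by rewrite scalerA -exprSr.
have [i h hP|n nP] := hH (fun i => P i i).
  by apply: (Pi i i i.+1 (leqnSn i)); apply: (Pk i i.+1 i.+1 (leqnSn i)).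
have [N [nN NP]] : exists N, (n <= N)%N /\ forall k, (k < n)%N -> forall i, (N <= i)%N ->
    {subset P k N <= P k i}.
  elim: {2}n => [|k [N [nN NP]]]; first by exists n.
  have [i|N' N'P] := hH (P k); first exact: Pi.
  exists (maxn N N'); split; first exact: leq_trans (leq_maxl _ _).
  move=> j; rewrite ltnS leq_eqVlt => /predU1P[->|jk] i hi h.
    move=> /(Pi _ _ _ (leq_maxr N N')) hP; rewrite N'P //.
    exact: leq_trans (leq_maxr N N') hi.
  move=> /(Pi _ _ _ (leq_maxl N N')); apply: NP => //.
  exact: leq_trans (leq_maxl N N') hi.
have key k i : (N <= i)%N -> {subset P k N <= P k i}.
  move=> hi; case: (ltnP k n) => kn; first exact: NP.
  move=> h /(Pi _ _ _ nN) /(Pk _ _ _ kn) h1.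
  apply: (Pi k i (maxn i k) (leq_maxl _ _)); apply: (Pk k (maxn i k) _ (leq_maxr _ _)).
  rewrite nP //; apply: leq_trans kn (leq_maxr _ _).
exists N => i hi z; apply/idP/idP; first exact: mono.
have [k] := tor z; elim: k z => [|k IH] z; first by rewrite scale1r => -> _; apply: rpred0.
move=> zk zD; have [|h hE] := ker (x ^+ k *: z); first by rewrite scalerA -exprS.
have /(key _ _ hi)/in_sub[w [wD w0 wE]] : h \in P k N by apply/in_sub; exists z.
rewrite -(subrK w z) rpredD //; apply: IH.
  by rewrite scalerBr hE wE subrr.
by rewrite submodB // (mono _ _ hi).
Qed.

Variable m : ideal R.
Hypothesis hm : noetherian_local m.
Let hR := local_noeth hm.

Lemma artinian_cyclic (C : lmodType R) (c : C) : (forall y, exists r : R, y = r *: c) ->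
  (forall a : R, a \ini m -> a *: c = 0) -> artinian C.
Proof.
move=> cg cm D hD.
have [h|h] := pselect (exists i, c \notin D i).
  case: h => n cn; exists n => i ni x.
  have D0 j y : (n <= j)%N -> y \in D j -> y = 0.
    move=> nj /(dcc_mono hD nj); have [r ->] := cg y => rD.
    apply: contrapT => rc; have [|b rb] := local_unit hm (a := r).
      by move=> rm; apply: rc; apply: cm.
    by case/negP: cn; rewrite -[c]scale1r -rb mulrC -scalerA rpredZ.
  by apply/idP/idP => /D0 -> //; rewrite rpred0.
exists 0%N => i _ x.
have Dc j : c \in D j by apply: contrapT => /negP cj; apply: h; exists j.
by have [r ->] := cg x; rewrite !rpredZ.
Qed.

Lemma fgm_quot (M : lmodType R) (W : submodClosed M) : fgm M -> fgm (quotient_mod W).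
Proof.
move=> [s sM]; exists (map (qmap W) s) => x; rewrite -(quotient_reprK x).
exact: (span_map (qmap W) (sM _)).
Qed.

(** The prime filtration as an induction on modules: zero modules, extensions, and cyclic modules
    with prime annihilator. *)
Lemma devissage (T : lmodType R -> Prop) :
  (forall M : lmodType R, (forall x : M, x = 0) -> T M) ->
  (forall (A B C : lmodType R) (al : {linear A -> B}) (be : {linear B -> C}),
     injective al -> (forall c, exists b, be b = c) ->
     (forall b, be b = 0 <-> exists a, b = al a) -> T A -> T C -> T B) ->
  (forall (C : lmodType R) (c : C) (p : ideal R), prime_ideal p ->
     (forall y, exists r : R, y = r *: c) -> (forall r : R, r \ini p <-> r *: c = 0) -> T C) ->
  forall M : lmodType R, fgm M -> T M.
Proof.
move=> T0 Text Tp M /(noeth_fg hR) hM.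
have valL (W : submodClosed M) : linear (@submod_val R M W) by [].
have [||W TW WM] := @prime_filtration R M (fun W => T (submod_type W)) (sub0 M) hR hM.
- by apply: T0 => -[x x0]; apply: val_inj; apply/in_sub0.
- move=> W x TW xW hp.
  have sW y : y \in W -> y \in subR W x.
    by move=> yW; apply/in_subR; exists 0; rewrite scale0r subr0.
  have il : linear (fun u : submod_type W => SubmodType (sW _ (valP u))).
    by move=> a u v; apply: val_inj.
  pose Z := submod_of (submod_restrict_prop (subR W x) W).
  have xW' : x \in subR W x by apply/in_subR; exists 1; rewrite scale1r subrr rpred0.
  apply: (Text _ _ _ (mklin il) (qmap Z)) => //.
  - by move=> u v /(congr1 val) /= uv; apply: val_inj.
  - by move=> c; exists (quotient_repr c); rewrite /= quotient_reprK.
  - move=> b; apply: (iff_trans (qmap0 _ _)); rewrite in_sub.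
    split=> [bW|[a ->]]; last exact: (valP a).
    by exists (SubmodType bW); apply: val_inj.
  apply: (Tp _ (qmap Z (SubmodType xW')) _ hp) => [y|r].
    rewrite -(quotient_reprK y); case: (quotient_repr y) => z zx.
    have /in_subR[r rP] := zx; exists r; rewrite -linearZ.
    by apply/(quotient_eqP Z)/in_sub.
  rewrite in_colon -linearZ; apply: (iff_trans _ (iff_sym (qmap0 _ _))).
  by rewrite in_sub.
(* The full submodule is only isomorphic to [M]; the property is carried over by an extension with
   zero quotient. *)
have l0 : linear (fun _ : M => 0 : zero_module R) by move=> a x y; rewrite scaler0 addr0.
apply: (Text _ _ _ (mklin (valL W)) (mklin l0)) => //.
- exact: val_inj.
- by move=> c; exists 0; rewrite /= [c]thinmx0.
- by move=> b; split=> // _; exists (SubmodType (WM b)).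
by apply: T0 => x; exact: thinmx0.
Qed.

(** Induction on the degree, reduced to [R / p]. If [p] contains [m], the module is torsion with no
    higher cohomology. Otherwise some [x] in [m] is regular; the kernel of [x] on cohomology is
    covered by the Artinian cohomology of the quotient by [x], one degree lower, and every class is
    killed by a power of [x]. *)
Lemma lc_artinian (n : nat) (M : lmodType R) : fgm M -> artinian (local_cohomology m n%:Z M).
Proof.
have [ys hys] := noeth_ideal hR m.
have dich (C : lmodType R) (c : C) (p : ideal R) : prime_ideal p ->
    (forall y, exists r : R, y = r *: c) -> (forall r : R, r \ini p <-> r *: c = 0) ->
    (forall a : R, a \ini m -> a *: c = 0) /\ (forall x : C, tors ys x) \/
    exists2 x : R, x \ini m & forall y : C, x *: y = 0 -> y = 0.
  move=> hp cg cp; have [mp|mp] := pselect (forall a : R, a \ini m -> a \ini p).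
    left; split=> [a /mp/cp //|x y yys].
    have [r ->] := cg x; exists 1%N; rewrite expr1 scalerA mulrC -scalerA.
    by rewrite (iffLR (cp y)) ?scaler0 //; apply: mp; apply/hys/mem_span.
  right; have [x [xm xp]] : exists x : R, x \ini m /\ ~ (x \ini p).
    by apply: contrapT => h; apply: mp => a am; apply: contrapT => ap; apply: h; exists a.
  exists x => // y; have [r ->] := cg y; rewrite scalerA => /cp/hp.2[//|].
  by move/cp.
elim: n M => [|n IH].
  apply: devissage => [M M0|A B C al be ali bes kbe hA hC|C c p hp cg cp].
  - by apply: artinian_zero => z; apply: (lc_zero hR M0).
  - by have [f [g fg]] := lc_exact hR m ali bes kbe 0; apply: artinian_ext fg hA hC.
  have [[cm CT]|[x xm reg]] := dich C c p hp cg cp.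
    have [[f fP] _] := lc_torsion_module hR hys CT.
    by apply: artinian_surj fP _; apply: artinian_cyclic cg cm.
  apply: artinian_zero => z; have [k] := lc_torsion hR z xm.
  elim: k => [|k IH]; first by rewrite scale1r.
  by rewrite exprS -scalerA => /(lc_kernel0 hR reg)/IH.
apply: devissage => [M M0|A B C al be ali bes kbe hA hC|C c p hp cg cp].
- by apply: artinian_zero => z; apply: (lc_zero hR M0).
- by have [f [g fg]] := lc_exact hR m ali bes kbe n.+1; apply: artinian_ext fg hA hC.
have [[cm CT]|[x xm reg]] := dich C c p hp cg cp.
  by apply: artinian_zero; apply: (lc_torsion_module hR hys CT).2.
pose W := image_sub (mklin (@scale_linear R x C)) (submod_full C).
have [b|b|f fP] := @lc_kernel R hR m C (quotient_mod W) x (qmap W) reg _ _ n.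
- by exists (quotient_repr b); rewrite /= quotient_reprK.
- apply: (iff_trans (qmap0 _ _)); rewrite in_sub; split=> [[a _ ->]|[a ->]]; exists a => //.
  exact/in_sub.
apply: (artinian_kernel (x := x) (f := f)) => //.
- apply: IH; apply: fgm_quot; exists [:: c] => y; have [r ->] := cg y.
  by rewrite rpredZ // mem_span ?mem_head.
- by move=> z; apply: lc_torsion.
Qed.
End Artinian.

(** * Restriction of scalars *)

Section BaseChange.
Variables (R S : comPzRingType) (phi : {rmorphism R -> S}).

Lemma restrict_linear (U V : lmodType S) (f : {linear U -> V}) :
  linear (f : restrict_scalars phi U -> restrict_scalars phi V).
Proof. by move=> a u v; apply: (linearP f). Qed.

Lemma restrict_exp (V : lmodType S) (a : R) k (x : V) :
  a ^+ k *: (x : restrict_scalars phi V) = phi a ^+ k *: x.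
Proof. by rewrite /GRing.scale /= /restrict_scale rmorphXn. Qed.

Lemma tors_restrict ys (V : lmodType S) (z : V) :
  tors ys (z : restrict_scalars phi V) <-> tors (map phi ys) z.
Proof.
split=> zT y; last by move=> yys; have [|k kz] := zT (phi y); [exact: map_f|exists k;
  rewrite restrict_exp].
by case/mapP=> a /zT[k kz] ->; exists k; rewrite -restrict_exp.
Qed.

Lemma good_restrict ys (V : lmodType S) (P : V -> Prop) :
  good (map phi ys) P -> good ys (P : restrict_scalars phi V -> Prop).
Proof.
elim: ys => //= x ys IH [gP h]; split; first exact: IH.
move=> z Pz /tors_restrict zT; have [z' [Pz' z'T [N zE]]] := h z Pz zT.
by exists z'; split=> //; [exact/tors_restrict|exists N; rewrite restrict_exp].
Qed.

Definition restrict_cplx (C : cplx S) : cplx R :=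
  @Cplx R (fun n => restrict_scalars phi (C n)) (fun n => mklin (restrict_linear (cdiff C n)))
    (fun n => @cdd S C n).

Lemma presents_restrict zs ys (C : cplx S) n (H : lmodType S) (cls : C n -> H) :
  (forall (V : lmodType S) (v : V), tors zs v <-> tors (map phi ys) v) ->
  presents zs cls ->
  @presents R ys (restrict_cplx C) n (restrict_scalars phi H) cls.
Proof.
move=> ht.
have tE (V : lmodType S) (v : V) : tors zs v <-> tors ys (v : restrict_scalars phi V).
  by rewrite ht tors_restrict.
have cE k (x : C k) : cyc zs x <-> @cyc R ys (restrict_cplx C) k x.
  by rewrite /cyc tE.
have bE k (x : C k) : bnd zs x <-> @bnd R ys (restrict_cplx C) k x.
  by case: k x => [|k] x //=; split=> -[y /tE]; exists y.
move=> [l s k]; split=> [a x y /cE xc /cE yc|h|x /cE xc]; first exact: l.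
- by have [x /cE xc ->] := s h; exists x.
- by rewrite k.
Qed.

Hypotheses (hR : noeth R^o) (hS : noeth S^o).
Variables (m : ideal R) (n : ideal S).
Hypothesis htors : forall (V : lmodType S) (v : V),
  (v \in torsion V n) <-> ((v : restrict_scalars phi V) \in torsion (restrict_scalars phi V) m).

Lemma lc_base_change (N : lmodType S) (M : lmodType R) (psi : {linear restrict_scalars phi N -> M})
    (i : int) : injective psi -> (forall y, exists x, psi x = y) ->
  exists f : {linear restrict_scalars phi (local_cohomology n i N) -> local_cohomology m i M},
    bijective f.
Proof.
move=> pi ps; case: i => i; last first.
  have l0 : linear (fun _ : restrict_scalars phi (zero_module S) => 0 : zero_module R).
    by move=> a x y; rewrite scaler0 addr0.
  exists (mklin l0); exists (fun=> 0) => x; first by rewrite [x](@thinmx0 S).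
  by rewrite [x]thinmx0.
have [ys hys] := noeth_ideal hR m; have [zs hzs] := noeth_ideal hS n.
have ht (V : lmodType S) (v : V) : tors zs v <-> tors (map phi ys) v.
  by rewrite -tors_restrict -(torsion_tors _ hzs) -(torsion_tors _ hys).
have [C [aug [[iC kC eC] hC /(_ i)[cls pC]]]] := lc_presented hzs N.
have r : @resolves R (restrict_cplx C) _ (mklin (restrict_linear aug)) by [].
have g k : good ys (fun _ : restrict_cplx C k => True).
  by apply: good_restrict; apply: good_injective.
have [cls' pC'] := lc_on hR hys r g pi ps i.
exact: presents_iso (presents_restrict ht pC) pC'.
Qed.

End BaseChange.

(** * Dimensions, Cohen-Macaulay conditions and filtrations under restriction *)

Section FiniteLocalExtension.
Variables (R S : comPzRingType) (m : ideal R) (n : ideal S).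
Hypotheses (hm : noetherian_local m) (hn : noetherian_local n).
Variable phi : {rmorphism R -> S}.
Hypothesis hfin : fin_gen (restrict_scalars phi (S^o : lmodType S)).
Let hR := local_noeth hm.
Let hS := local_noeth hn.
Let htors := torsion_restrict hR hfin hm hn.

Lemma ann_iso (A B : lmodType R) (f : {linear A -> B}) : injective f ->
  (forall y, exists x, f x = y) -> ann A =i ann B.
Proof.
move=> fi fs a; apply/idP/idP => /in_sub h.
  by apply/in_sub => y; have [x <-] := fs y; rewrite -linearZ h linear0.
by apply/in_sub => x; apply: fi; rewrite linearZ /= h linear0.
Qed.

Lemma bij_iso (A B : lmodType R) (f : {linear A -> B}) : bijective f ->
  injective f /\ forall y, exists x, f x = y.
Proof. by move=> fb; split; [exact: bij_inj|case: fb => g fg gf y; exists (g y)]. Qed.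

Section Module.
Variables (N : lmodType S) (M : lmodType R) (psi : {linear restrict_scalars phi N -> M}).
Hypotheses (pi : injective psi) (ps : forall y, exists x, psi x = y).

(** [M] may be any module isomorphic to the restriction of [N], since cohomology modules and
    subquotients over the two rings agree only up to isomorphism. *)
Lemma chain_ann_iso k : chain (ann N) k <-> chain (ann M) k.
Proof.
by rewrite -(chain_ann hR hfin); split; apply: chain_mono => a; rewrite (ann_iso (@pi) ps).
Qed.

Lemma mod_dim_restrict : mod_dim N = mod_dim M.
Proof. by apply: krull_dim_quot_eq => k; apply: chain_ann_iso. Qed.
End Module.

Lemma lc_iso_restrict (N : lmodType S) (M : lmodType R)
    (psi : {linear restrict_scalars phi N -> M}) i :
  injective psi -> (forall y, exists x, psi x = y) ->
  exists f : {linear restrict_scalars phi (local_cohomology n i N) -> local_cohomology m i M},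
    bijective f.
Proof. exact: (lc_base_change hR hS htors). Qed.

Lemma lc_ann_dim_restrict (N : lmodType S) (M : lmodType R)
    (psi : {linear restrict_scalars phi N -> M}) :
  injective psi -> (forall y, exists x, psi x = y) -> lc_ann_dim n N = lc_ann_dim m M.
Proof.
move=> pi ps; apply: krull_dim_quot_eq => k; rewrite /lc_ann_prod (mod_dim_restrict pi ps).
set d := (X in 'I_X).
rewrite (chain_bigmul d (fun i => ann (local_cohomology n i%:Z N))).
rewrite (chain_bigmul d (fun i => ann (local_cohomology m i%:Z M))).
by split=> -[i id h]; exists i => //; move: h;
  have [f /bij_iso[fi fs]] := lc_iso_restrict i%:Z pi ps; rewrite (chain_ann_iso fi fs).
Qed.

Definition sq_class (A : comPzRingType) (V : lmodType A) (D E : submodClosed V) x (h : x \in D) :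
  subquotient D E := qmap _ (SubmodType h).

Lemma sq_class_surj (A : comPzRingType) (V : lmodType A) (D E : submodClosed V)
  (u : subquotient D E) : exists x (h : x \in D), u = sq_class E h.
Proof.
rewrite -(quotient_reprK u); case: (quotient_repr u) => x h; exists x, h => //.
Qed.

Lemma sq_class0 (A : comPzRingType) (V : lmodType A) (D E : submodClosed V) x (h : x \in D) :
  (sq_class E h = 0) <-> (x \in E).
Proof. by apply: (iff_trans (qmap0 _ _)); rewrite in_sub. Qed.

Lemma sq_classP (A : comPzRingType) (V : lmodType A) (D E : submodClosed V) a x y
    (hx : x \in D) (hy : y \in D) (h : a *: x + y \in D) :
  sq_class E h = a *: sq_class E hx + sq_class E hy.
Proof. by rewrite /sq_class -linearP; congr (qmap _ _); apply: val_inj. Qed.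

Lemma sq_class_eq (A : comPzRingType) (V : lmodType A) (D E : submodClosed V) x y
    (hx : x \in D) (hy : y \in D) : sq_class E hx = sq_class E hy <-> x - y \in E.
Proof.
have h : - 1 *: y + x \in D by rewrite rpredD ?rpredZ.
rewrite addrC -scaleN1r -(sq_class0 E h) (sq_classP E hy hx) scaleN1r addrC.
by split=> [->|/eqP]; rewrite ?subrr // subr_eq0 => /eqP.
Qed.

Lemma subquotient_restrict (N : lmodType S) (D E : submodClosed N)
    (D' E' : submodClosed (restrict_scalars phi N)) :
  D =i (D' : {pred N}) -> E =i (E' : {pred N}) ->
  exists psi : {linear restrict_scalars phi (subquotient D E) -> subquotient D' E'},
    injective psi /\ forall y, exists x, psi x = y.
Proof.
move=> DD' EE'.
pose rho (u : restrict_scalars phi (subquotient D E)) (v : subquotient D' E') :=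
  exists x (h : x \in D) (h' : x \in D'), u = sq_class E h /\ v = sq_class E' h'.
have [u|a _ _ _ _ [x [xD [xD' [-> ->]]]] [y [yD [yD' [-> ->]]]]|v [x [h [h']]]|psi pP] :=
    @linear_of_rel R _ _ rho.
- have [x [h ->]] := sq_class_surj u.
  have h' : x \in D' by rewrite -DD'.
  by exists (sq_class E' h'), x, h, h'.
- have zD : phi a *: x + y \in D by rewrite rpredD ?rpredZ.
  have zD' : (a *: (x : restrict_scalars phi N) + y) \in D' by rewrite rpredD ?rpredZ.
  by exists (phi a *: x + y), zD, zD'; rewrite (sq_classP E xD yD) (sq_classP E' xD' yD').
- by move=> [/esym/sq_class0 xE ->]; apply/sq_class0; rewrite -EE'.
exists psi; split=> [u v|v].
  have [x [h ->]] := sq_class_surj u; have [y [k ->]] := sq_class_surj v.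
  have h' : x \in D' by rewrite -DD'.
  have k' : y \in D' by rewrite -DD'.
  rewrite (pP _ (sq_class E' h')); last by exists x, h, h'.
  rewrite (pP _ (sq_class E' k')); last by exists y, k, k'.
  by move=> /sq_class_eq h1; apply/sq_class_eq; rewrite EE'.
have [x [h' ->]] := sq_class_surj v; have h : x \in D by rewrite DD'.
by exists (sq_class E h); apply: pP; exists x, h, h'.
Qed.

Lemma submod_ann (A : comPzRingType) (V : lmodType A) (D : submodClosed V) a :
  (a \ini ann (submod_type D)) <-> forall x, x \in D -> a *: x = 0.
Proof.
rewrite in_sub; split=> [h x xD|h [x xD]]; last exact/val_inj/h.
exact: (congr1 val (h (SubmodType xD))).
Qed.

Lemma submod_dim_restrict (N : lmodType S) (D : submodClosed N)
    (D' : submodClosed (restrict_scalars phi N)) :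
  (forall a, (forall x, x \in D -> phi a *: x = 0) <-> (forall x, x \in D' -> a *: x = 0)) ->
  submod_dim D = submod_dim D'.
Proof.
move=> DD'; apply: krull_dim_quot_eq => k; rewrite -(chain_contract hR hfin).
by split; apply: chain_mono => a; [move/submod_ann=> /DD' h; apply/in_contract/submod_ann
  |move/in_contract/submod_ann=> h; apply/submod_ann/DD'].
Qed.

Lemma in_restrict (N : lmodType S) (D : submodClosed N) (x : N) :
  ((x : restrict_scalars phi N) \in restrict_sub phi D) <-> x \in D.
Proof. exact: in_sub. Qed.

Lemma restrict_subE (N : lmodType S) (D : submodClosed N) :
  D =i (restrict_sub phi D : {pred restrict_scalars phi N}).
Proof. by move=> x; apply/idP/idP => /in_restrict. Qed.

Section Sequential.
Variables (PR : lmodType R -> Prop) (PS : lmodType S -> Prop).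
Hypothesis hP : forall (N : lmodType S) (M : lmodType R)
  (psi : {linear restrict_scalars phi N -> M}),
  injective psi -> (forall y, exists x, psi x = y) -> PS N <-> PR M.
Variable N : lmodType S.
Let NR : lmodType R := restrict_scalars phi N.

Lemma extend_prop (D : submodClosed NR) : @submod_prop S N (fun x =>
  exists s : seq (S * N), (forall p, p \in s -> p.2 \in (D : {pred NR})) /\
    x = \sum_(p <- s) p.1 *: p.2).
Proof.
split; first by exists [::]; rewrite big_nil.
move=> a _ _ [s [sD ->]] [t [tD ->]]; exists ([seq (a * p.1, p.2) | p <- s] ++ t); split.
  by move=> p; rewrite mem_cat => /orP[/mapP[q /sD qD ->]|/tD].
rewrite big_cat big_map /= scaler_sumr; congr (_ + _); apply: eq_bigr => p _.
by rewrite scalerA.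
Qed.

Definition extend_sub (D : submodClosed NR) : submodClosed N := submod_of (extend_prop D).

Lemma sub_extend (D : submodClosed NR) (x : N) : x \in (D : {pred NR}) -> x \in extend_sub D.
Proof.
move=> xD; apply/in_sub; exists [:: (1, x)]; split; first by move=> p; rewrite inE => /eqP ->.
by rewrite big_seq1 scale1r.
Qed.

Lemma extend_ann (D : submodClosed NR) (a : S) : (forall x : N, x \in (D : {pred NR}) -> a *: x = 0) ->
  forall x, x \in extend_sub D -> a *: x = 0.
Proof.
move=> h _ /in_sub[s [sD ->]]; rewrite scaler_sumr big_seq big1 // => p /sD pD.
by rewrite scalerA mulrC -scalerA h // scaler0.
Qed.

Lemma extend_dim (D : submodClosed NR) : submod_dim (extend_sub D) = submod_dim D.
Proof.
apply: submod_dim_restrict => a; split=> h x; last exact: extend_ann.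
by move=> /sub_extend/h.
Qed.

Lemma restrict_dim (D : submodClosed N) : submod_dim D = submod_dim (restrict_sub phi D).
Proof. by apply: submod_dim_restrict => a; split=> h x; [move/in_restrict/h|move=> xD; apply: h; apply/in_restrict]. Qed.

Lemma extend_restrict_dim (D : submodClosed NR) :
  submod_dim (restrict_sub phi (extend_sub D)) = submod_dim D.
Proof. by rewrite -restrict_dim extend_dim. Qed.

Lemma sequentially_restrict : sequentially n PS N <-> sequentially m PR NR.
Proof.
split=> -[t [D [[D0 Dt Di] DP]]].
  exists t, (fun i => restrict_sub phi (D i)); split; last first.
    move=> i it; have [||psi [pi ps]] := @subquotient_restrict N (D i) (D i.+1)
      (restrict_sub phi (D i)) (restrict_sub phi (D i.+1)).
    - exact: restrict_subE.
    - exact: restrict_subE.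
    by apply/(hP pi ps)/DP.
  split=> [x|x|i it].
  - by rewrite -restrict_subE D0; apply/idP/idP => _; apply/in_sub.
  - by rewrite -restrict_subE Dt; apply/idP/idP => /htors.
  have [s1 s2 s3] := Di i it; split.
  - by move=> x /in_restrict/s1 h; apply/in_restrict.
  - by rewrite -!restrict_dim.
  move=> A; rewrite -restrict_dim -extend_dim => /s3 h x xA.
  by apply/in_restrict/h/sub_extend.
(* The terms are closed under [S]: the span of [D i.+1] has the same dimension, and [D i.+1] is the
   largest submodule of dimension below that of [D i]. *)
have stable i : (i <= t)%N -> extend_sub (D i) =i (D i : {pred N}).
  move=> it x; apply/idP/idP; last exact: sub_extend.
  case: i it => [|i] it h; first by rewrite D0; apply/in_sub.
  have [s1 s2 s3] := Di i it.
  have /s3 : (submod_dim (restrict_sub phi (extend_sub (D i.+1))) < submod_dim (D i))%E.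
    by rewrite extend_restrict_dim.
  by apply; apply/in_restrict.
exists t, (fun i => extend_sub (D i)); split; last first.
  move=> i it; have [||psi [pi ps]] := @subquotient_restrict N (extend_sub (D i))
    (extend_sub (D i.+1)) (D i) (D i.+1).
  - exact/stable/ltnW.
  - exact/stable.
  by apply/(hP pi ps)/DP.
split=> [x|x|i it].
- by rewrite stable // D0; apply/idP/idP => _; apply/in_sub.
- by rewrite stable // Dt; apply/idP/idP => h; apply/htors.
have [s1 s2 s3] := Di i it; split.
- by move=> x; rewrite !stable // ?(ltnW it) //; apply: s1.
- by rewrite !extend_dim.
move=> A; rewrite extend_dim restrict_dim => /s3 h x xA.
by apply: sub_extend; apply: h; apply/in_restrict.
Qed.

End Sequential.
End FiniteLocalExtension.

(** * Finite extensions of Cohen-Macaulay local rings *)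

Section CohenMacaulayRings.
Variables (R : comPzRingType) (m : ideal R).
Hypothesis hm : noetherian_local m.
Let hR := local_noeth hm.

Definition has_dim (A : comPzRingType) d : Prop := chain (sub0 A^o) d /\ ~ chain (sub0 A^o) d.+1.

Lemma mod_dim_regular (A : comPzRingType) d : has_dim A d <-> mod_dim (A^o : lmodType A) = d%:Z%:E.
Proof.
have E n : chain (ann (A^o : lmodType A)) n <-> chain (sub0 A^o) n.
  by split; apply: chain_mono => a; [move/in_sub0 => ->; apply: ideal0|
    move/in_sub/(_ 1); rewrite /GRing.scale /= mulr1 => ->; apply: rpred0].
by rewrite /mod_dim krull_dim_fin !chain_quotient !E.
Qed.

Lemma has_dim_exists : exists d, has_dim R d.
Proof.
have [th hth] := noeth_ideal hR m.
have b r : chain (sub0 R^o) r -> (r <= size th)%N.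
  apply: (@chain_bound R hR m (sub0 R^o) th r hm) => [x xth|q hq _ h a am]; first exact/hth/mem_span.
  exact: (@span_sub R R^o th q h) (iffLR (hth a) am).
have c0 : chain (sub0 R^o) 0 by apply: (chain0 (local_prime hm)) => x /in_sub0 ->; apply: ideal0.
apply: contrapT => hn.
have all n : chain (sub0 R^o) n.
  by elim: n => // n IH; apply: contrapT => h; apply: hn; exists n.
by have := b _ (all (size th).+1); rewrite ltnn.
Qed.

(** Dimension -1 of the product means that no prime contains any of the annihilators; over a local
    ring each of them is then the unit ideal. *)
Lemma cohen_macaulayP d : has_dim R d -> cohen_macaulay m (R^o : lmodType R) <->
  forall i : nat, (i < d)%N -> forall z : local_cohomology m i%:Z (R^o : lmodType R), z = 0.
Proof.
move=> /mod_dim_regular hd; rewrite /cohen_macaulay krull_dim_N1 chain_quotient /lc_ann_prod hd.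
rewrite (chain_bigmul d (fun i => ann (local_cohomology m i%:Z (R^o : lmodType R)))).
split=> [h i id z|h [i id [P [hP _ IP]]]].
  suff /in_sub/(_ z) : (1 : R) \ini ann (local_cohomology m i%:Z (R^o : lmodType R)).
    by rewrite scale1r.
  apply: contrapT => /(sub_local hm) s; apply: h; exists i => //.
  exact: chain0 (local_prime hm) s.
apply: (prime_not1 (hP 0%N isT)); apply: IP; apply/in_sub => z.
by rewrite scale1r; apply: h.
Qed.

Lemma lc_free (i : nat) : (forall z : local_cohomology m i%:Z (R^o : lmodType R), z = 0) ->
  forall e (z : local_cohomology m i%:Z 'rV[R]_e), z = 0.
Proof.
move=> h0; elim=> [|e IH] z; first by apply: (lc_zero hR) => x; rewrite [x]thinmx0.
have al : linear (fun v : 'rV[R]_e => row_mx (0 : 'rV_1) v : 'rV_(1 + e)).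
  by move=> a u v; rewrite scale_row_mx add_row_mx scaler0 addr0.
have bl : linear (fun v : 'rV[R]_(1 + e) => (v 0 (lshift e 0) : R^o)).
  by move=> a u v; rewrite !mxE.
have [u v /eq_row_mx[] //|c|b|f [g fg]] := @lc_exact R hR m _ _ _ (mklin al) (mklin bl) _ _ _ i.
- by exists (row_mx (const_mx c) 0); rewrite /= row_mxEl mxE.
- split=> [b0|[a ->]]; last by rewrite /= row_mxEl mxE.
  exists (rsubmx b); rewrite -[LHS]hsubmxK /=; congr row_mx.
  by apply/matrixP => k l; rewrite !mxE !ord1 -[RHS]b0.
have [|a ->] := fg z; first exact: h0.
by rewrite (IH a) linear0.
Qed.

End CohenMacaulayRings.

Lemma sum_ord_split (V : zmodType) (F : nat -> V) k e : (k < e)%N ->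
  \sum_(i < e) F i = \sum_(i < k) F i + (F k + \sum_(i < e) if (k < i)%N then F i else 0).
Proof.
elim: e => // e IH; rewrite ltnS leq_eqVlt => /predU1P[<-|ke].
  rewrite big_ord_recr /= [X in _ + (_ + X)]big1 ?addr0 // => i _.
  by rewrite ltnNge -ltnS ltn_ord.
by rewrite !big_ord_recr /= IH // ke !addrA.
Qed.

(** * Adjoining one element to a Cohen-Macaulay local ring *)

Section MonogenicExtension.
Variables (D : comNzRingType) (S : comNzRingType) (mD : ideal D) (n : ideal S).
Hypotheses (hD : noetherian_local mD) (hS : noetherian_local n).
Variables (f : {rmorphism D -> S}) (s : S).
Hypothesis hfin : fin_gen (restrict_scalars f (S^o : lmodType S)).
Let SD : lmodType D := restrict_scalars f (S^o : lmodType S).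
Let nD := local_noeth hD.

(** The values at [s] of polynomials of degree less than [k] with coefficients in [I]. *)
Lemma combos_prop (I : ideal D) k : @submod_prop D SD (fun x =>
  exists c : nat -> D, (forall i, c i \ini I) /\ x = \sum_(i < k) f (c i) * s ^+ i).
Proof.
split; first by exists (fun=> 0); split=> [i|]; [exact: ideal0|rewrite big1 // => i _; rewrite rmorph0 mul0r].
move=> a _ _ [c [cI ->]] [d [dI ->]]; exists (fun i => a * c i + d i); split.
  by move=> i; apply: ideal_add => //; apply: ideal_mull.
change (f a * \sum_(i < k) f (c i) * s ^+ i + \sum_(i < k) f (d i) * s ^+ i =
  \sum_(i < k) f (a * c i + d i) * s ^+ i).
rewrite mulr_sumr -big_split; apply: eq_bigr => i _ /=.
by rewrite rmorphD rmorphM mulrDl mulrA.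
Qed.

Let combos I k := submod_of (combos_prop I k).
Let top : ideal D := ideal_unit D.
Let in_top (a : D) : a \ini top. Proof. exact/in_sub. Qed.

Let combos_shift I k (x : S) : (x : SD) \in combos I k ->
  exists (y : S) (c : D), [/\ (y : SD) \in combos I k, c \ini I & s * x = y + f c * s ^+ k].
Proof.
move=> /in_sub[c [cI ->]]; pose d i := if i is j.+1 then c j else 0.
have dI i : d i \ini I by case: i => [|i] /=; [exact: ideal0|].
exists (\sum_(i < k) f (d i) * s ^+ i), (d k); split=> //.
  by apply/in_sub; exists d.
have <- : \sum_(i < k.+1) f (d i) * s ^+ i = \sum_(i < k) f (d i) * s ^+ i + f (d k) * s ^+ k.
  by rewrite big_ord_recr.
rewrite big_ord_recl rmorph0 mul0r add0r mulr_sumr; apply: eq_bigr => i _.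
by rewrite exprS mulrCA.
Qed.

Let combos_pow k j : (j < k)%N -> (s ^+ j : SD) \in combos top k.
Proof.
move=> jk; apply/in_sub; exists (fun i => (i == j)%:R); split=> [i|]; first exact: in_top.
rewrite (bigD1 (Ordinal jk)) //= eqxx rmorph1 mul1r big1 ?addr0 // => i.
by rewrite -val_eqE /= => /negPf ->; rewrite rmorph0 mul0r.
Qed.

Let scaleE (a : D) (x : SD) : a *: x = f a * (x : S). Proof. by []. Qed.

(* With [e] minimal, a relation of degree less than [e] having a unit
   coefficient would by Nakayama yield a monic relation of smaller degree. *)
Lemma minimal_coefs e (F : nat -> D) : s ^+ e = \sum_(i < e) f (F i) * s ^+ i ->
  (forall k, (k < e)%N -> ~ exists c : nat -> D, s ^+ k = \sum_(i < k) f (c i) * s ^+ i) ->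
  forall g : nat -> D, \sum_(i < e) f (g i) * s ^+ i = 0 -> forall i, (i < e)%N -> g i \ini mD.
Proof.
move=> Fe emin g g0.
suff H k : (k <= e)%N -> (forall i, (k <= i < e)%N -> g i \ini mD) ->
    forall i, (i < e)%N -> g i \ini mD.
  by apply: (H e) => // i /andP[h1 h2]; move: (leq_trans h2 h1); rewrite ltnn.
elim: k => [|k IH] ke gm; first by move=> i ie; apply: gm.
apply: IH; first exact: ltnW.
move=> i /andP[]; rewrite leq_eqVlt => /predU1P[<-|ki] ie; last by apply: gm; rewrite ki.
apply: contrapT => gk; apply: (emin k ke).
have [b gb] := local_unit hD gk.
pose Z := subD (combos top k) (combos mD e).
have pkZ : (s ^+ k : SD) \in Z.
  have kE : s ^+ k = (- b) *: ((\sum_(i < k) f (g i) * s ^+ i : S) : SD) +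
     (- b) *: ((\sum_(i < e) f (if (k < i)%N then g i else 0) * s ^+ i : S) : SD).
    rewrite !scaleE -mulrDr rmorphN.
    have E : \sum_(i < k) f (g i) * s ^+ i +
        \sum_(i < e) f (if (k < i)%N then g i else 0) * s ^+ i = - (f (g k) * s ^+ k).
      apply/eqP; rewrite -subr_eq0 opprK -addrA [X in _ + X]addrC -[X in _ == X]g0.
      rewrite (sum_ord_split (fun i => f (g i) * s ^+ i) ke); apply/eqP; congr (_ + (_ + _)).
      by apply: eq_bigr => j _; case: ifP => // _; rewrite rmorph0 mul0r.
    by rewrite E mulrNN mulrA -rmorphM (mulrC b) gb rmorph1 mul1r.
  rewrite kE; apply: rpredD; apply: rpredZ.
    by apply: subDl; apply/in_sub; exists g.
  apply: subDr; apply/in_sub; exists (fun i => if (k < i < e)%N then g i else 0); split.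
    by move=> j; case: ifP => [/andP[kj je]|_]; [apply: gm; rewrite kj|exact: ideal0].
  by apply: eq_bigr => j _; rewrite ltn_ord andbT.
have sZ (x : S) : (x : SD) \in Z -> ((s * x : S) : SD) \in Z.
  move=> /in_sub[y yk xym]; rewrite -[x](subrK y) mulrDr; apply: rpredD.
    have [y' [c [y'm cm ->]]] := combos_shift xym.
    apply: rpredD; first exact: subDr.
    apply: subDr; apply/in_sub; exists (fun i => c * F i); split=> [j|]; first exact: ideal_mulr.
    by rewrite Fe mulr_sumr; apply: eq_bigr => j _; rewrite rmorphM mulrA.
  have [y' [c [y'm cm ->]]] := combos_shift yk.
  by apply: rpredD; [exact: subDl|apply: (@rpredZ _ _ Z c)].
have powZ j : (s ^+ j : SD) \in Z.
  case: (ltnP j k) => jk; first by apply: subDl; apply: combos_pow.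
  by rewrite -(subnK jk); elim: (j - k)%N => // l IHl; rewrite addSn exprS; apply: sZ.
have : {subset [seq (s ^+ i : SD) | i <- iota 0 e] <= combos top k}.
  apply: (nakayama hD) => _ /mapP[j _ ->].
  have /in_sub[y yk /in_sub[c [cm cE]]] := powZ j.
  exists c; split=> //; rewrite size_map size_iota.
  suff -> : (\sum_(i < e) c i *: [seq (s ^+ i : SD) | i <- iota 0 e]`_i) = s ^+ j - y.
    by rewrite subKr.
  rewrite cE; apply: eq_bigr => i' _; rewrite (nth_map 0%N) ?size_iota // nth_iota //.
move/(_ (s ^+ k)) => h.
have /h/in_sub[c [_ cE]] : (s ^+ k : SD) \in [seq (s ^+ i : SD) | i <- iota 0 e].
  by apply/mapP; exists k => //; rewrite mem_iota.
by exists c.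
Qed.

Lemma size_monic_relation e (F : nat -> D) : let p := 'X^e - \poly_(i < e) F i in
  p \is monic /\ size p = e.+1.
Proof.
have lt : (size (- \poly_(i < e) F i)%R < size ('X^e : {poly D}))%N.
  by rewrite size_polyXn size_polyN ltnS size_poly.
by split; [rewrite monicE lead_coefDl // lead_coefXn|rewrite size_polyDl // size_polyXn].
Qed.

Lemma monogenic_extension : cohen_macaulay mD (D^o : lmodType D) ->
  exists (D' : comPzRingType) (m' : ideal D') (f' : {rmorphism D' -> S}),
    [/\ noetherian_local m', cohen_macaulay m' (D'^o : lmodType D'),
        forall a, exists a', f' a' = f a & exists a', f' a' = s].
Proof.
move=> cmD; have [d hd] := has_dim_exists hD.
pose pe k := `[< exists c : nat -> D, s ^+ k = \sum_(i < k) f (c i) * s ^+ i >].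
have ex : exists k, pe k.
  by have [k [c cE]] := integral_relation nD hfin s; exists k; apply/asboolP; exists c.
case: (ex_minnP ex) => e /asboolP[F FE] emin.
have {}emin k : (k < e)%N -> ~ exists c : nat -> D, s ^+ k = \sum_(i < k) f (c i) * s ^+ i.
  by move=> ke h; have := emin k; rewrite leqNgt ke; apply/implyP; apply/asboolP.
have coefs := minimal_coefs FE emin.
have [pm ps] := size_monic_relation e F; set p := ('X^e - _) in pm ps.
have cfu : commr_rmorph f s by move=> x; apply: mulrC.
pose ev : {rmorphism {poly D} -> S} := horner_morph cfu.
have evC a : ev a%:P = f a := horner_morphC cfu a.
have evX : ev 'X = s := horner_morphX cfu.
have evE (c : nat -> D) k : ev (\poly_(i < k) c i) = \sum_(i < k) f (c i) * s ^+ i.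
  rewrite poly_def rmorph_sum; apply: eq_bigr => i _.
  by rewrite -mul_polyC rmorphM rmorphXn /= evC evX.
have evp : ev p = 0.
  by rewrite rmorphB rmorphXn /= evE -FE evX subrr.
pose I := idl (p : {poly D}); pose D' : comPzRingType := quotient_ring I.
pose q : {rmorphism {poly D} -> D'} := qpi I.
have red (u : D') : exists2 r : {poly D}, (size r <= e)%N & u = q r.
  have [g ->] := qpi_surj u; exists (Pdiv.Ring.rmodp g p).
    by rewrite -ltnS -ps Pdiv.Ring.ltn_rmodpN0 // monic_neq0.
  apply/qpi_eq/in_idl; exists (Pdiv.Ring.rdivp g p).
  by rewrite {1}(Pdiv.RingMonic.rdivp_eq pm g) addrK.
have q0 (r : {poly D}) : (size r <= e)%N -> q r = 0 -> r = 0.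
  move=> rs /qpi_eq0/in_idl[h hE]; move: rs; rewrite hE; have [->|h0] := eqVneq h 0.
    by rewrite mul0r.
  rewrite size_Mmonic // ps addnS /=; case: (size h) (size_poly_gt0 h) => [|k _].
    by rewrite h0.
  by rewrite addSn ltnNge leq_addl.
pose f0 (u : D') : S := ev (quotient_repr u).
have f0E g : f0 (q g) = ev g.
  have /in_idl[h hE] : g - quotient_repr (q g) \ini I by apply: quotient_pi_repr.
  apply/eqP; rewrite eq_sym -subr_eq0 -rmorphB /=; apply/eqP.
  by rewrite [X in ev X]hE rmorphM evp mulr0.
have f0B : zmod_morphism f0.
  move=> u v; have [[g ->] [h ->]] := (qpi_surj u, qpi_surj v).
  by rewrite -(rmorphB q) !f0E rmorphB.
have f0M : monoid_morphism f0.
  split=> [|u v]; first by rewrite -(rmorph1 q) f0E rmorph1.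
  have [[g ->] [h ->]] := (qpi_surj u, qpi_surj v).
  by rewrite -(rmorphM q) !f0E rmorphM.
pose f' := mkrm f0B f0M.
pose psi : {rmorphism D -> D'} := (q \o polyC).
have fpsi a : f' (psi a) = f a by rewrite /= f0E evC.
have qE (c : nat -> D) : q (\poly_(i < e) c i) = \sum_(i < e) psi (c i) * q 'X ^+ i.
  rewrite poly_def rmorph_sum; apply: eq_bigr => i _.
  by rewrite -mul_polyC rmorphM rmorphXn.
have polyE (r : {poly D}) : (size r <= e)%N -> r = \poly_(i < e) r`_i.
  move=> rs; apply/polyP => i; rewrite coef_poly; case: ltnP => // ei.
  by rewrite nth_default // (leq_trans rs).
have finD' : fin_gen (restrict_scalars psi (D'^o : lmodType D')).
  apply/fin_genP; exists [seq q 'X ^+ i | i <- iota 0 e] => u.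
  have [r /polyE rE ->] := red u; rewrite rE qE.
  apply: (@rpred_sum _ (span _)) => i _.
  have := @rpredZ _ _ (@span D (restrict_scalars psi (D'^o : lmodType D')) [seq q 'X ^+ i | i <- iota 0 e]) (r`_i) (q 'X ^+ i).
  by apply; apply: mem_span; apply/mapP; exists (i : nat); rewrite // mem_iota /=.
have nD' := finite_noeth nD finD'.
have n1 : (1 : S) != 0 by apply: oner_neq0.
pose m' := contract f' n.
have lD' : noetherian_local m'.
  split; first exact/noetherianP.
  apply: local_ringI => [/in_contract|u um].
    by rewrite rmorph1; apply: local_not1.
  have [v tv] : exists v, f' u * v = 1.
    by apply: (local_unit hS) => h; apply: um; apply/in_contract.
  (* The inverse [v] is integral over [D]. Multiplying a monic relation of degree [M.+1] by the
     [M]-th power of [f' u] expresses [v] as a polynomial in [f' u]. *)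
  have [w wE] : exists w, f' w = v.
    have [[|M] [c cE]] := integral_relation nD hfin v.
      by move: cE n1; rewrite big_ord0 expr0 => ->; rewrite eqxx.
    exists (\sum_(i < M.+1) psi (c i) * u ^+ (M - i)).
    have tvn k : f' u ^+ k * v ^+ k = 1 by rewrite -exprMn tv expr1n.
    rewrite -[v in RHS]mul1r -(tvn M) -mulrA -exprSr cE mulr_sumr rmorph_sum.
    apply: eq_bigr => i _; rewrite rmorphM fpsi rmorphXn mulrCA; congr (_ * _).
    have -> : f' u ^+ M = f' u ^+ (M - i) * f' u ^+ i by rewrite -exprD subnK // -ltnS ltn_ord.
    by rewrite -mulrA tvn mulr1.
  have [r rs rE] := red (1 - u * w).
  have r0 : f' (1 - u * w) = 0 by rewrite rmorphB rmorph1 rmorphM wE tv subrr.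
  have rm i : (i < e)%N -> r`_i \ini mD.
    apply: (coefs (fun i => r`_i)); rewrite -evE -(polyE r rs) -f0E -rE; exact: r0.
  apply: contrapT => hn.
  (* If [u] is not a unit, a prime contains it, and a larger one lies over [mD]. The latter contains
     [u * w], and also [1 - u * w], whose coefficients are in [mD]; this is absurd. *)
  have [|_ <- /in_idl[b ub]|Q [hQ uQ _]] := @prime_avoiding D' (idl u) (eq 1) nD' erefl.
  - by move=> _ _ <- <-; rewrite mulr1.
  - by apply: hn; exists b; rewrite mulrC.
  have [Q' [hQ' QQ' cQ']] := lying_over nD finD' (local_prime hD) (prime_sub_local hD (contract_prime psi hQ)).
  apply: (prime_not1 hQ'); rewrite -(subrK (u * w) 1); apply: ideal_add; last first.
    by apply: ideal_mulr; apply/QQ'/uQ/mem_idl.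
  rewrite rE (polyE r rs) qE; apply: ideal_sum => i _; apply: ideal_mulr.
  by apply/in_contract; rewrite cQ'; apply: rm.
exists D', m', f'; split=> //; last 2 first.
- by move=> a; exists (psi a).
- by exists (q 'X); rewrite /= f0E evX.
have e0 : (0 < e)%N.
  by case: (e) FE => // FE; move: n1; rewrite -[1](expr0 s) FE big_ord0 eqxx.
have c0 a : a \ini contract psi (sub0 D'^o) -> a = 0.
  move=> /in_contract/in_sub0/q0; rewrite size_polyC => h; apply: (@polyC_inj D); apply: h.
  by case: (a != 0).
have hd' : has_dim D' d.
  split; rewrite -(chain_contract nD finD').
    by apply: chain_mono hd.1 => a /c0 ->; apply/in_sub0.
  by move=> h; apply: hd.2; apply: chain_mono h => a /in_sub0 ->; apply: ideal0.
apply/(cohen_macaulayP lD' hd') => i id z.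
have idl : linear (@id (restrict_scalars psi (D'^o : lmodType D'))) by [].
have [g /bij_iso[gi _]] := @lc_iso_restrict _ _ _ _ hD lD' psi finD' (D'^o) _ (mklin idl) i%:Z
  (fun x y e => e) (fun y => ex_intro _ y erefl).
(* Remainders modulo the monic [p] identify [D'] with the free [D]-module of rank [e]. *)
have rl : linear (fun v : 'rV[D]_e => q (rVpoly v) : restrict_scalars psi (D'^o : lmodType D')).
  move=> a u v; have -> : rVpoly (a *: u + v) = a%:P * rVpoly u + rVpoly v.
    by rewrite linearP mul_polyC.
  by rewrite rmorphD rmorphM.
have [|u|h /bij_iso[_ hs]] := @lc_iso D nD mD _ _ (mklin rl) i.
- move=> u v /= uv; apply/eqP; rewrite -subr_eq0; apply/eqP.
  rewrite -[_ - _]rVpolyK linearB /=; have -> : rVpoly u - rVpoly v = 0; last by rewrite linear0.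
  apply: q0; last by rewrite rmorphB; apply/eqP; rewrite subr_eq0; apply/eqP/uv.
  by rewrite -linearB size_poly.
- have [r rs ->] := red u; exists (poly_rV r); by rewrite /= poly_rV_K.
apply: gi; rewrite linear0; have [y <-] := hs (g z).
by rewrite (lc_free hD (iffLR (cohen_macaulayP hD hd) cmD i id) y) linear0.
Qed.

End MonogenicExtension.

(** Polynomials are formed over nontrivial rings. As this is an equality of structures, all data on
    [D] can be transported along it. *)
Lemma comNzRing_of (D : comPzRingType) : (1 : D) != 0 ->
  exists Dn : comNzRingType, (Dn : comPzRingType) = D.
Proof.
case: D => T [c1 c2 c3 c4 c5 c6 c7 c8 c9 c10 c11] D1.
pose D : comPzRingType := GRing.ComPzRing.Pack
  (@GRing.ComPzRing.Class T c1 c2 c3 c4 c5 c6 c7 c8 c9 c10 c11).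
pose Dn : comNzRingType := HB.pack (GRing.ComPzRing.sort D) (GRing.ComPzRing.class D)
  (GRing.PzSemiRing_isNonZero.Build D D1).
by exists Dn.
Qed.

(** * From a quotient of a Cohen-Macaulay ring to a finite extension *)

Section QuotientUp.
Variables (S : comNzRingType) (n : ideal S).
Hypothesis hn : noetherian_local n.

(** The invariant is that the remaining generators span [S] modulo the image of [D]; each step adds
    one of them to the image. *)
Lemma cm_local_surj (L : seq S) (D : comPzRingType) (mD : ideal D) (f : {rmorphism D -> S}) :
  noetherian_local mD -> cohen_macaulay mD (D^o : lmodType D) ->
  fin_gen (restrict_scalars f (S^o : lmodType S)) ->
  (forall x : S, exists a,
     (x - f a : restrict_scalars f (S^o : lmodType S)) \in span (L : seq (restrict_scalars f (S^o : lmodType S)))) ->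
  quotient_of_cm_local S.
Proof.
elim: L D mD f => [|s L IH] D mD f hD cmD hfin hL.
  exists D, mD, f; split=> // y; have [a /span_nil/eqP] := hL y.
  by rewrite subr_eq0 => /eqP; exists a.
have D1 : (1 : D) != 0.
  by apply/eqP => h; apply: (local_not1 hD); rewrite h; apply: ideal0.
have [Dn E] := comNzRing_of D1; case: D / E in mD f hD cmD hfin hL {D1} *.
have [D' [m' [f' [hD' cmD' ff' [s' sE]]]]] := monogenic_extension hD hn s hfin cmD.
have sub (t : seq S) : forall x, x \in span (t : seq (restrict_scalars f (S^o : lmodType S))) ->
    x \in span (t : seq (restrict_scalars f' (S^o : lmodType S))).
  elim: t => [|y t IHt] x; first by move=> /span_nil ->; apply: rpred0.
  move=> /span_cons[a /IHt xt]; have [a' aE] := ff' a; apply/span_cons; exists a'.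
  by rewrite /GRing.scale /= /restrict_scale aE.
apply: (IH D' m' f' hD' cmD').
  have [t tS] := iffLR (fin_genP _) hfin.
  by apply/fin_genP; exists t => x; apply: sub (tS x).
move=> x; have [a /span_cons[b /sub h]] := hL x.
have [a' aE] := ff' a; have [b' bE] := ff' b.
exists (a' + b' * s'); suff <- : x - f a - f b * s = x - f' (a' + b' * s') by [].
by rewrite rmorphD rmorphM aE bE sE opprD addrA.
Qed.

Lemma quotient_of_cm_local_up (R : comPzRingType) (phi : {rmorphism R -> S}) :
  fin_gen (restrict_scalars phi (S^o : lmodType S)) ->
  quotient_of_cm_local R -> quotient_of_cm_local S.
Proof.
move=> hfin [D [mD [g [hD cmD gs]]]].
have [t tS] := iffLR (fin_genP _) hfin.
pose f : {rmorphism D -> S} := phi \o g.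
have sub (x : S) : x \in span (t : seq (restrict_scalars f (S^o : lmodType S))).
  elim: t x {tS}(tS x) => [|y t IHt] x; first by move=> /span_nil ->; apply: rpred0.
  move=> /span_cons[a /IHt xt]; have [a' aE] := gs a; apply/span_cons; exists a'.
  by rewrite /GRing.scale /= /restrict_scale /= aE.
apply: (@cm_local_surj t D mD f hD cmD) => [|x]; first by apply/fin_genP; exists t.
by exists 0; rewrite rmorph0 subr0.
Qed.

End QuotientUp.

(** * Koszul cohomology and uniform annihilators of colons *)

Section Koszul.
Variable R : comPzRingType.
Implicit Types (M : lmodType R) (ys : seq R).

Lemma scale_cmap (C : cplx R) (y : R) : @cmap R C C (fun k => mklin (@scale_linear R y (C k))).
Proof. by move=> k x; rewrite /= linearZ. Qed.

(** The cochain Koszul complex as an iterated cone; its cohomology in the top degree [size ys] is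
    [M / (ys) M]. *)
Fixpoint koszul ys M : cplx R :=
  if ys is y :: ys' then cone (@scale_cmap (koszul ys' M) y) else point_cplx M.

Definition gsub M (W : submodClosed M) ys : submodClosed M :=
  foldr (fun y W => subD (image_sub (mklin (@scale_linear R y M)) (submod_full M)) W) W ys.

Definition gen_sub ys M : submodClosed M := gsub (sub0 M) ys.

Lemma in_gsub M (W : submodClosed M) y ys (x : M) :
  (x \in gsub W (y :: ys)) <-> exists a, x - y *: a \in gsub W ys.
Proof.
rewrite in_sub; split=> [[_ /in_sub[a _ ->] h]|[a h]]; first by exists a.
by exists (y *: a) => //; apply/in_sub; exists a => //; apply/in_sub.
Qed.

Lemma in_gen_sub y ys M (x : M) :
  (x \in gen_sub (y :: ys) M) <-> exists a, x - y *: a \in gen_sub ys M.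
Proof. exact: in_gsub. Qed.

Lemma gsub_gen M (W : submodClosed M) ys y (x : M) : y \in ys -> y *: x \in gsub W ys.
Proof.
elim: ys => // z ys IH; rewrite inE => /predU1P[->|/IH h]; apply/in_gsub.
  by exists x; rewrite subrr rpred0.
by exists 0; rewrite scaler0 subr0.
Qed.

Lemma gsub_le M (W Z : submodClosed M) ys : {subset W <= Z} ->
  (forall y x, y \in ys -> y *: x \in Z) -> {subset gsub W ys <= Z}.
Proof.
move=> WZ; elim: ys => // y ys IH h x /in_gsub[a xa].
rewrite -(subrK (y *: a) x) rpredD ?h ?mem_head //.
by apply: IH xa => z w zys; apply: h; rewrite inE zys orbT.
Qed.

Lemma gsub_quot M (W : submodClosed M) ys (x : M) :
  (qmap W x \in gen_sub ys (quotient_mod W)) <-> x \in gsub W ys.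
Proof.
elim: ys x => [|y ys IH] x; first by rewrite in_sub0 qmap0.
rewrite in_gen_sub in_gsub; split=> -[a h]; last first.
  by exists (qmap W a); rewrite -linearZ -linearB IH.
have aE : qmap W (quotient_repr a) = a by apply: quotient_reprK.
exists (quotient_repr a); apply/IH.
suff -> : qmap W (x - y *: quotient_repr a) = qmap W x - y *: a by [].
by rewrite -{2}aE -linearZ -linearB.
Qed.

(** Lists are read from the right: the head is regular modulo the tail. The quotient by the whole
    list may be zero. *)
Fixpoint regular_list ys M : Prop :=
  if ys is y :: ys' then regular_list ys' M /\
    forall x : M, y *: x \in gen_sub ys' M -> x \in gen_sub ys' M
  else True.

Lemma koszul_kill ys M (c : R) : (forall x : M, c *: x = 0) -> forall n (x : koszul ys M n), c *: x = 0.
Proof.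
move=> cM; elim: ys => [|y ys IH] [|n] x.
- exact: cM.
- exact: thinmx0.
- exact: IH.
by case: x => a b; congr (_, _); apply: IH.
Qed.

Lemma koszul_above ys M n (x : koszul ys M n) : (size ys < n)%N -> x = 0.
Proof.
elim: ys n x => [|y ys IH] [|n] x //; first by move=> _; exact: thinmx0.
rewrite /= ltnS => h; case: x => a b; congr (_, _); apply: IH => //; exact: leqW.
Qed.

Section Top.
Variable M : lmodType R.

Fixpoint koszul_top ys : koszul ys M (size ys) -> M :=
  match ys with
  | [::] => fun x => x
  | y :: ys' => fun p => koszul_top p.2
  end.

Fixpoint koszul_bot ys : M -> koszul ys M (size ys) :=
  match ys with
  | [::] => fun x => x
  | y :: ys' => fun x => (0, koszul_bot ys' x)
  end.

Lemma koszul_top_linear ys : linear (@koszul_top ys).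
Proof. by elim: ys => [|y ys IH] a p q //=; rewrite -IH. Qed.

Lemma koszul_botK ys : cancel (koszul_bot ys) (@koszul_top ys).
Proof. by elim: ys. Qed.

(** This identifies the cohomology in the top degree with the quotient by [gen_sub ys M]. *)
Lemma koszul_top_bnd ys (x : koszul ys M (size ys)) : bnd [::] x <-> koszul_top x \in gen_sub ys M.
Proof.
elim: ys x => [|y ys IH] x; first by rewrite in_sub0.
have tL := koszul_top_linear (ys := ys); pose t := mklin tL.
rewrite in_gen_sub; split.
  move=> h; have [a [b [xE hb]]] : exists (a : koszul ys M (size ys)) (b : koszul ys M (size ys)),
      x.2 = y *: a - b /\ bnd [::] b.
    case: (ys) x h {IH tL t} => [|z zs] x [p pT ->].
      by exists p, 0; rewrite subr0; split.
    by case: p pT => a b _; exists a, (cdiff (koszul (z :: zs) M) _ b); split=> //; exists b.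
  exists (t a); rewrite -[koszul_top x]/(t x.2) xE linearB linearZ addrAC subrr add0r.
  by rewrite -scaleN1r rpredZ //; apply/IH.
move=> [a]; rewrite -[a](koszul_botK ys) -[koszul_top x]/(t x.2) -[koszul_top _]/(t (koszul_bot ys a)).
rewrite -linearZ -linearB => /IH; set b := koszul_bot ys a => h.
have xE : x = (0, x.2) by case: x {h} => x1 x2; rewrite (@koszul_above ys M _ x1).
rewrite xE; move: (x.2) h => x2 h.
suff : exists2 p : koszul (y :: ys) M (size ys), True & (0, x2) = cdiff (koszul (y :: ys) M) (size ys) p.
  by move=> [p _ E]; exists p => //; apply: tors_nil.
case: (ys) b x2 h {IH tL t x xE} => [|z zs] b x2 h.
  exists b => //; congr (_, _) => /=; move: h => /eqP; rewrite subr_eq0 => /eqP //.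
case: h => e _ eE; exists (b, - e) => //.
have b0 : cdiff (koszul (z :: zs) M) (size zs).+1 b = 0 by apply: koszul_above.
congr (_, _); first exact: (esym b0).
by rewrite linearN opprK -eE addrC subrK.
Qed.

End Top.
Lemma koszul_top_regular y ys M :
  (forall x : M, y *: x \in gen_sub ys M -> x \in gen_sub ys M) ->
  forall n (a : koszul ys M n), n = size ys -> bnd [::] (y *: a) -> bnd [::] a.
Proof.
move=> yreg n a ne; move: a; rewrite ne => a.
have tL := koszul_top_linear (M := M) (ys := ys); pose t := mklin tL.
move=> /koszul_top_bnd; rewrite -[koszul_top _]/(t (y *: a)) linearZ => /yreg h.
exact/koszul_top_bnd.
Qed.

(** Induction along the cones. The complex of the tail has cohomology only in its top degree, and
    there the regularity of [y] takes the place of vanishing. *)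
Lemma koszul_regular ys M : regular_list ys M -> forall n, (n < size ys)%N ->
  forall x : koszul ys M n, cdiff (koszul ys M) n x = 0 -> bnd [::] x.
Proof.
elim: ys => // y ys IH [/IH{}IH yreg] [|k] hk.
  move=> x /[dup] /(congr1 fst) /= dx /(congr1 snd) /= yx.
  case: ys IH yreg {hk} x dx yx => [|z zs] IH yreg x dx yx.
    by apply/in_sub0; apply: yreg; apply/in_sub0.
  exact: (IH 0%N isT x dx).
move=> [a b] [da /eqP]; rewrite subr_eq0 => /eqP ab.
have [a' aE] : exists a', a = cdiff (koszul ys M) k a'.
  suff [a' _ ->] : bnd [::] a by exists a'.
  move: hk; rewrite /= ltnS leq_eqVlt => /predU1P[ke|hk]; last exact: (IH k.+1 hk a da).
  by apply: (koszul_top_regular yreg ke); rewrite ab; exists b => //; apply: tors_nil.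
have db : cdiff (koszul ys M) k (b - y *: a') = 0.
  by rewrite linearB linearZ /= -aE -ab subrr.
have := IH k hk _ db; case: k a b ab a' aE db hk {da} => [|k] a b ab a' aE db hk.
  by move=> /eqP; rewrite subr_eq0 => /eqP ->; exists a'; [exact: tors_nil|rewrite aE].
move=> [b' _ bE]; exists (a', - b'); first exact: tors_nil.
by rewrite aE; congr (_, _); rewrite linearN opprK -bE addrC subrK.
Qed.

Lemma koszul_d_fst y ys M n (p : koszul (y :: ys) M n) :
  bnd [::] ((cdiff (koszul (y :: ys) M) n p).1 : koszul ys M n.+1).
Proof. by case: n p => [|n] p; [exists p|exists p.1] => //; apply: tors_nil. Qed.

(** If [y *: x] is in [(ys) M], then [x], put in the top degree of the complex of [ys], is the first
    component of a cycle for [y :: ys], one degree below the top. So annihilators in this degree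
    also annihilate the colon. *)
Lemma koszul_colon y ys M (c : R) :
  (forall x : koszul (y :: ys) M (size ys), cdiff (koszul (y :: ys) M) _ x = 0 -> bnd [::] (c *: x)) ->
  forall x : M, y *: x \in gen_sub ys M -> c *: x \in gen_sub ys M.
Proof.
case: ys => [|z zs] h x yx.
  by apply/in_sub0/(h x); move/in_sub0: yx => yx; rewrite /= yx.
set ys := z :: zs in h yx *; pose a : koszul ys M (size ys) := koszul_bot ys x.
have tL := koszul_top_linear (M := M) (ys := ys); pose t := mklin tL.
have ta : t a = x by apply: koszul_botK.
have [b _ bE] : bnd [::] (y *: a).
  by apply/koszul_top_bnd; rewrite -[koszul_top _]/(t (y *: a)) linearZ ta.
have [|p _ /(congr1 fst) pE] := h (a, b).
  congr (_, _); first exact: (@koszul_above ys M (size zs).+2 _ (leqnn _)).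
  by apply/eqP; rewrite subr_eq0; apply/eqP.
rewrite -ta -linearZ; apply/koszul_top_bnd.
rewrite [c *: a](pE : c *: a = _); exact: koszul_d_fst.
Qed.

Section Functoriality.
Variables (M N : lmodType R) (f : {linear M -> N}).

Fixpoint koszul_map ys n : koszul ys M n -> koszul ys N n :=
  match ys return koszul ys M n -> koszul ys N n with
  | [::] => match n return koszul [::] M n -> koszul [::] N n with 0 => f | _.+1 => fun=> 0 end
  | y :: ys' => match n return koszul (y :: ys') M n -> koszul (y :: ys') N n with
    | 0 => @koszul_map ys' 0
    | k.+1 => fun p => (@koszul_map ys' k.+1 p.1, @koszul_map ys' k p.2) end
  end.

Lemma koszul_map_linear ys n : linear (@koszul_map ys n).
Proof.
elim: ys n => [|y ys IH] [|n] a u v.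
- exact: linearP.
- by rewrite /= scaler0 addr0.
- exact: IH.
by case: u v => u1 u2 [v1 v2]; congr (_, _); apply: IH.
Qed.

Lemma koszul_map_d ys n (x : koszul ys M n) :
  koszul_map (cdiff (koszul ys M) n x) = cdiff (koszul ys N) n (koszul_map x).
Proof.
have Z zs k (a : R) (z : koszul zs M k) : koszul_map (a *: z) = a *: koszul_map z.
  exact: (linearZ_LR (mklin (@koszul_map_linear zs k)) a z).
have B zs k (z w : koszul zs M k) : koszul_map (z - w) = koszul_map z - koszul_map w.
  exact: (linearB (mklin (@koszul_map_linear zs k)) z w).
elim: ys n x => [|y ys IH] [|n] x.
- by [].
- by [].
- by congr (_, _); [apply: IH|apply: Z].
case: x => a b; congr (_, _); first exact: IH.
by rewrite [LHS]B IH Z.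
Qed.

Lemma koszul_map_surj ys n : (forall y, exists x, f x = y) ->
  forall y : koszul ys N n, exists x, koszul_map x = y.
Proof.
move=> fs; elim: ys n => [|y ys IH] [|n] z.
- exact: fs.
- by exists 0; rewrite [z]thinmx0.
- exact: IH.
case: z => a b; have [[a' <-] [b' <-]] := (IH _ a, IH _ b).
by exists (a', b').
Qed.

Lemma koszul_map_inj ys n : injective f -> injective (@koszul_map ys n).
Proof.
move=> fi; elim: ys n => [|y ys IH] [|n] u v.
- exact: fi.
- by rewrite [u]thinmx0 [v]thinmx0.
- exact: IH.
by case: u v => u1 u2 [v1 v2] [/IH -> /IH ->].
Qed.

End Functoriality.

Lemma koszul_map_exact (A B C : lmodType R) (al : {linear A -> B}) (be : {linear B -> C}) ys n :
  (forall b, be b = 0 -> exists a, b = al a) ->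
  forall x : koszul ys B n, koszul_map be x = 0 -> exists w, x = koszul_map al w.
Proof.
move=> ex; elim: ys n => [|y ys IH] [|n] x.
- exact: ex.
- by exists 0; rewrite [x]thinmx0.
- exact: IH.
by case: x => a b [/IH[a' ->] /IH[b' ->]]; exists (a', b').
Qed.

Section KillShortExact.
Variables (A B C : lmodType R) (al : {linear A -> B}) (be : {linear B -> C}).
Hypotheses (ali : injective al) (bes : forall c, exists b, be b = c)
  (kbe : forall b, be b = 0 <-> exists a, b = al a).
Variable ys : seq R.

Definition kills (M : lmodType R) (c : R) n : Prop :=
  forall x : koszul ys M n, cdiff (koszul ys M) n x = 0 -> bnd [::] (c *: x).

Let KA n := mklin (koszul_map_linear al (ys := ys) (n := n)).
Let KB n := mklin (koszul_map_linear be (ys := ys) (n := n)).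
Let KAd n x : KA n.+1 (cdiff (koszul ys A) n x) = cdiff (koszul ys B) n (KA n x).
Proof. exact: koszul_map_d. Qed.
Let KBd n x : KB n.+1 (cdiff (koszul ys B) n x) = cdiff (koszul ys C) n (KB n x).
Proof. exact: koszul_map_d. Qed.
Let KAi n : injective (KA n). Proof. exact: koszul_map_inj. Qed.
Let KBs n y : exists x, KB n x = y. Proof. exact: koszul_map_surj. Qed.
Let Kex n x : KB n x = 0 -> exists w, x = KA n w.
Proof. by apply: koszul_map_exact => b /kbe. Qed.
Let KBA n x : KB n (KA n x) = 0.
Proof.
rewrite /=; elim: (ys) n x => [|y zs IH] [|n] x.
- by apply/kbe; exists x.
- by [].
- exact: IH.
by case: x => a b; congr (_, _); apply: IH.
Qed.

Lemma kills_middle c1 c2 n : kills C c1 n -> kills A c2 n -> kills B (c2 * c1) n.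
Proof.
move=> hC hA x dx.
have step (w : koszul ys B n) : cdiff (koszul ys B) n w = 0 -> KB n w = 0 -> bnd [::] (c2 *: w).
  move=> dw /Kex[u wE].
  have /hA : cdiff (koszul ys A) n u = 0.
    by apply: KAi; rewrite KAd -wE dw linear0.
  rewrite wE -linearZ; case: (n) (c2 *: u) => [|k] z.
    by move=> ->; rewrite linear0.
  by move=> [v _ ->]; exists (KA k v); [exact: tors_nil|rewrite KAd].
have /hC h : cdiff (koszul ys C) n (KB n x) = 0 by rewrite -KBd dx linear0.
have c1x : cdiff (koszul ys B) n (c1 *: x) = 0 by rewrite linearZ /= dx scaler0.
rewrite -scalerA; move: h c1x; rewrite -linearZ; move: (c1 *: x) => {x dx} x h dx.
case: n x h dx step {hC hA} => [|k] x h dx step; first exact: step.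
case: h => z _; have [w <-] := KBs z; rewrite -KBd => E.
rewrite -(subrK (cdiff (koszul ys B) k w) x) scalerDr; apply: bndD.
  by apply: step; rewrite linearB ?E ?subrr // dx (@cdd R (koszul ys B) k w) subrr.
by exists (c2 *: w); [exact: tors_nil|rewrite linearZ].
Qed.

(** Where the cohomology of [B] vanishes, that of [A] is a quotient of the cohomology of [C] one
    degree lower, and in degree 0 it vanishes. *)
Lemma kills_connect c n : (forall x : koszul ys B n, cdiff (koszul ys B) n x = 0 -> bnd [::] x) ->
  (forall k, n = k.+1 -> kills C c k) -> kills A c n.
Proof.
move=> hB hC x dx.
have : cdiff (koszul ys B) n (KA n x) = 0 by rewrite -KAd dx linear0.
move/hB; case: n x dx hB hC => [|k] x dx hB hC.
  move=> xE; have -> : x = 0 by apply: KAi; rewrite linear0; exact: xE.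
  by rewrite scaler0.
move=> [y _ yE].
have h : cdiff (koszul ys C) k (KB k y) = 0.
  by rewrite -KBd -yE KBA.
have {hC} := hC k erefl _ h; rewrite -linearZ.
have dy : cdiff (koszul ys B) k (c *: y) = KA k.+1 (c *: x) by rewrite !linearZ /= -yE.
move: (c *: y) (c *: x) dy => {x y yE h dx hB} z w dz; case: k w z dz => [|k] w z dz.
  move=> /Kex[u uE]; exists u; first exact: tors_nil.
  by apply: KAi; rewrite -dz uE KAd.
move=> [v _]; have [v' <-] := KBs v; rewrite -KBd => E.
have [|u uE] := @Kex _ (z - cdiff (koszul ys B) k v'); first by rewrite linearB E subrr.
exists u; first exact: tors_nil.
by apply: KAi; rewrite KAd -uE linearB dz (@cdd R (koszul ys B) k v') subr0.
Qed.

End KillShortExact.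
End Koszul.

(** * Minimal primes of the support *)

Section Support.
Variable R : comPzRingType.
Hypothesis hR : noeth R^o.

Lemma chain_cons (p q : ideal R) i : prime_ideal p -> {subset p <= q} -> ~ {subset q <= p} ->
  chain q i -> chain p i.+1.
Proof.
move=> hp pq qp [P [hP sP qP]]; exists (fun k => if k is j.+1 then P j else p); split=> //.
  by case=> // k hk; apply: hP.
case=> [|k] hk; last exact: sP.
by split=> [x /pq/qP //|h]; apply: qp => x /qP/h.
Qed.

(** Take [J] maximal among the annihilators of elements that are inside [p]. Each [a] in [p] is
    nilpotent modulo [J] locally at [p], and maximality reduces the exponent to 1. One multiplier
    [t] serves for the generators of [p], and [t *: y] has annihilator [p]. *)
Lemma minimal_ass (N : lmodType R) (p : ideal R) : fgm N -> prime_ideal p ->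
  {subset ann N <= p} ->
  (forall q, prime_ideal q -> {subset ann N <= q} -> {subset q <= p} -> {subset p <= q}) ->
  exists y : N, colon (sub0 N) y =i p.
Proof.
move=> [s sN] hp Np pmin.
pose F (J : ideal R) := exists y : N, J =i colon (sub0 N) y /\ {subset J <= p}.
have [|J [[y [Jy Jp]] Jmax]] := @noeth_max R R^o F hR.
  apply: contrapT => hn.
  have hs y : y \in s -> exists2 t : R, ~ (t \ini p) & t *: y \in sub0 N.
    move=> _; apply: contrapT => ht; apply: hn; exists (colon (sub0 N) y), y; split=> // t ty.
    by apply: contrapT => tp; apply: ht; exists t => //; apply/in_colon.
  have [t tp ts] := common_multiplier hp hs; apply: tp; apply: Np; apply/in_sub => x.
  have st : {subset span s <= preim (mklin (@scale_linear R t N)) (sub0 N)}.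
    by apply: span_sub => z /ts h; apply/in_sub.
  by have /in_sub/in_sub0 := st _ (sN x).
have annJ (a : R) z : a \ini ann N -> a \ini colon (sub0 N) z.
  by move=> /in_sub h; apply/in_colon/in_sub0.
have loc (a : R) : a \ini p -> exists2 t, ~ (t \ini p) & t * a \ini J.
  move=> ap.
  pose pk k := `[< exists2 t, ~ (t \ini p) & t * a ^+ k \ini J >].
  have ex : exists k, pk k.
    have [|t [k [tp tk]]] := @locally_nilpotent R J p a hR hp _ ap; last first.
      by exists k; apply/asboolP; exists t.
    by move=> Q hQ JQ Qp; apply: pmin => // b bN; apply: JQ; rewrite Jy; apply: annJ.
  case: (ex_minnP ex) => -[|k] /asboolP[t tp tk] kmin.
    by case: tp; apply: Jp; rewrite expr0 mulr1 in tk.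
  exists t => //.
  have sub b : b \ini colon (sub0 N) (a ^+ k *: y) -> b \ini p.
    move=> /in_colon/in_sub0 h; apply: contrapT => bp.
    have := kmin k; rewrite ltnn => h'; suff: false by []; apply: h'.
    apply/asboolP; exists b => //; rewrite Jy; apply/in_colon/in_sub0.
    by rewrite -scalerA.
  apply: (Jmax (colon (sub0 N) (a ^+ k *: y))).
  - by exists (a ^+ k *: y); split.
  - move=> b; rewrite Jy => /in_colon/in_sub0 h; apply/in_colon/in_sub0.
    by rewrite scalerA mulrC -scalerA h scaler0.
  - apply/in_colon/in_sub0; move: tk; rewrite Jy => /in_colon/in_sub0.
    by rewrite exprS mulrA scalerA.
have [ps hps] := noeth_ideal hR p.
have [|t tp tps] := @common_multiplier R R^o J p ps hp.
  by move=> g gps; have [t tp tg] := loc g (iffRL (hps g) (mem_span gps)); exists t.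
exists (t *: y) => a; apply/idP/idP => [/in_colon/in_sub0|ap].
  rewrite scalerA => h; have /hp.2[//|/tp[]] : a * t \ini p.
  by apply: Jp; rewrite Jy; apply/in_colon/in_sub0.
have st : {subset span (ps : seq R^o) <= colon (sub0 N) (t *: y)}.
  apply: span_sub => g /tps; rewrite Jy => /in_colon/in_sub0 h; apply/in_colon/in_sub0.
  by rewrite scalerA mulrC.
exact/st/hps.
Qed.

Lemma finite_subfamily (k : nat) (P : nat -> ideal R) (T : ideal R -> Prop) :
  exists k' P', (forall i, (i < k')%N -> T (P' i)) /\
    forall i, (i < k)%N -> T (P i) -> exists2 j, (j < k')%N & P' j = P i.
Proof.
elim: k => [|k [k' [P' [h1 h2]]]]; first by exists 0%N, P.
have [Tk|Tk] := pselect (T (P k)); last first.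
  exists k', P'; split=> // i; rewrite ltnS leq_eqVlt => /predU1P[-> //|]; exact: h2.
exists k'.+1, (fun j => if j == k' then P k else P' j); split=> [i|i].
  by rewrite ltnS leq_eqVlt => /predU1P[->|ik]; rewrite ?eqxx // (ltn_eqF ik); apply: h1.
rewrite ltnS leq_eqVlt => /predU1P[-> _|ik Ti]; first by exists k'; rewrite ?eqxx.
by have [j jk jE] := h2 i ik Ti; exists j; [exact: leqW|rewrite (ltn_eqF jk)].
Qed.

End Support.

(** * Annihilators of Koszul cohomology common to all regular lists *)

Section UniformKillers.
Variables (R : comPzRingType) (m : ideal R).
Hypothesis hm : noetherian_local m.
Let hR := local_noeth hm.
Variables (I : ideal R) (N : lmodType R) (i L : nat).
Hypotheses (hN : fgm N) (IN : forall (a : R) (x : N), a \ini I -> a *: x = 0).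
Hypothesis suppN : forall p, prime_ideal p -> {subset I <= p} -> {subset ann N <= p}.
Hypothesis dimI : ~ chain I i.+1.

(** By [dimI], these are the primes over [I] of dimension exactly [i]. *)
Definition top_prime (p : ideal R) : Prop := [/\ prime_ideal p, {subset I <= p} & chain p i].

Definition off_top (c : R) : Prop := forall p, top_prime p -> ~ (c \ini p).

Lemma off_top1 : off_top 1. Proof. by move=> p [hp _ _]; apply: prime_not1. Qed.

Lemma off_topM a b : off_top a -> off_top b -> off_top (a * b).
Proof. by move=> ha hb p hp; case: (hp) => h1 _ _; apply: (prime_notM h1); [apply: ha|apply: hb]. Qed.

Lemma top_prime_max p q : prime_ideal p -> {subset I <= p} -> top_prime q -> {subset p <= q} ->
  {subset q <= p}.
Proof.
move=> hp Ip [hq Iq cq] pq; apply: contrapT => qp; apply: dimI.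
exact: chain_mono Ip (chain_cons hp pq qp cq).
Qed.

Lemma top_ass p : top_prime p -> exists y : N, colon (sub0 N) y =i p.
Proof.
move=> tp; case: (tp) => hp Ip cp; apply: (minimal_ass hR) => //; first exact: suppN.
move=> q hq Nq; apply: top_prime_max => // a aI; apply: Nq; apply/in_sub => x.
exact: IN.
Qed.

(** Top primes are associated primes of [N], hence finite in number, and prime avoidance applies. *)
Lemma avoid_top (J : ideal R) : (forall p, top_prime p -> ~ {subset J <= p}) ->
  exists2 c, c \ini J & off_top c.
Proof.
move=> hJ; have [k [P [h1 h2 h3 _]]] := finite_ass hR (noeth_fg hR hN).
have [k' [P' [h4 h5]]] := finite_subfamily k P top_prime.
have [||c [cJ cP]] := @prime_avoidance R J k' P'.
- by move=> j /h4[].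
- by move=> j /h4/hJ.
exists c => // p tp; have [y yp] := top_ass tp.
case: (tp) => hp Ip cp.
have eqp (q q' : ideal R) : q =i q' -> prime_ideal q -> prime_ideal q'.
  by move=> qq [q1 qM]; split=> [|x z]; rewrite -!qq //; apply: qM.
have [|j jk jE] := h3 y; first by apply: eqp hp => a; rewrite yp.
have Pp a : (a \in P j) = (a \in p) by rewrite -jE yp.
have [|l lk lE] := h5 j jk.
  split; first by apply: eqp hp => a; rewrite Pp.
  - by move=> a; rewrite Pp; apply: Ip.
  - by apply: chain_mono cp => a; rewrite Pp.
by rewrite -Pp -lE; apply: cP.
Qed.

(** Degrees are counted down from the top one, and [c] may not depend on the list; [L] bounds the
    lengths so that the descending induction can start. *)
Definition kill (j : nat) (M : lmodType R) : Prop := exists2 c, off_top c &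
  forall ys, regular_list ys N -> (size ys <= L)%N -> forall n, (n + j = size ys)%N ->
    kills ys M c n.

(** Descending induction on [j]; for [j] above [L] no degree is concerned. By dévissage [M] is
    [R / p]. If [p] is not a top prime, an element of [p] outside all top primes kills everything.
    If it is one, [R / p] embeds into [N], whose cohomology below the top degree vanishes on regular
    lists, so the killer for the cokernel in codegree [j.+1] works. *)
Lemma kill_all j (M : lmodType R) : (0 < j)%N -> fgm M ->
  (forall (a : R) (x : M), a \ini I -> a *: x = 0) -> kill j M.
Proof.
have [k] : exists k, (L < j + k)%N by exists L.+1; rewrite addnS ltnS leq_addl.
elim: k j M => [|k IH] j M.
  rewrite addn0 => Lj _ _ _; exists 1; first exact: off_top1.
  move=> ys _ sL n nj; move: (leq_trans (leq_addl n j) (eq_leq nj)) => h.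
  by move: (leq_trans (leq_ltn_trans sL Lj) h); rewrite ltnn.
move=> Ljk j0; move: M.
apply: (devissage hm (T := fun M => (forall (a : R) (x : M), a \ini I -> a *: x = 0) -> kill j M)).
- move=> M M0 _; exists 1 => [|ys _ _ n _ x dx]; first exact: off_top1.
  by rewrite koszul_kill //; apply: bnd0.
- move=> A B C al be ali bes kbe hA hC IB.
  have [|c2 c2t k2] := hA; first by move=> a x aI; apply: ali; rewrite linearZ /= IB // linear0.
  have [|c1 c1t k1] := hC; first by move=> a x aI; have [b <-] := bes x; rewrite -linearZ IB // linear0.
  exists (c2 * c1); first exact: off_topM.
  by move=> ys yr ysL n nj; apply: (kills_middle ali bes kbe); [apply: k1|apply: k2].
move=> C c p hp cg cp IC.
have Ip : {subset I <= p} by move=> a aI; apply/cp/IC.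
have [tp|ntp] := pselect (top_prime p); last first.
  have [q tq pq|t tp toff] := @avoid_top p.
    apply: ntp; have qp := top_prime_max hp Ip tq pq.
    by split=> //; case: tq => _ _; apply: chain_mono.
  exists t => // ys _ _ n _ x _; rewrite koszul_kill; first exact: bnd0.
  by move=> y; have [r ->] := cg y; rewrite scalerA mulrC -scalerA (iffLR (cp t)) ?scaler0.
have [y yp] := top_ass tp.
have yE (r : R) : r *: y = 0 <-> r *: c = 0.
  by rewrite -cp -yp in_colon in_sub0.
pose rho (u : C) (v : N) := exists r : R, u = r *: c /\ v = r *: y.
have [u|a _ _ _ _ [r [-> ->]] [s [-> ->]]|v [r [/esym/yE h ->]] //|al alP] := @linear_of_rel R _ _ rho.
- by have [r ->] := cg u; exists (r *: y), r.
- by exists (a * r + s); rewrite !scalerDl !scalerA.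
have alE r : al (r *: c) = r *: y by apply: alP; exists r.
have ali : injective al.
  move=> u v /eqP; rewrite -subr_eq0 -linearB; have [r rE] := cg (u - v).
  by rewrite rE alE => /eqP/yE; rewrite -rE => /eqP; rewrite subr_eq0 => /eqP.
pose W := image_sub al (submod_full C).
have kq b : qmap W b = 0 <-> exists a, b = al a.
  by rewrite qmap0 in_sub; split=> [[a _ ->]|[a ->]]; exists a => //; apply/in_sub.
have qs (b : quotient_mod W) : exists a, qmap W a = b.
  by exists (quotient_repr b); rewrite /= quotient_reprK.
have [||||e eoff ek] := IH j.+1 (quotient_mod W).
- by rewrite addSnnS.
- by [].
- exact: fgm_quot.
- by move=> a x aI; have [b <-] := qs x; rewrite -linearZ IN // linear0.
exists e => // ys yr ysL n nj.
apply: (kills_connect ali qs kq) => [x dx|k' nk].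
  by apply: koszul_regular dx => //; rewrite -nj -addn1 leq_add2l.
by apply: ek => //; rewrite -nj nk addSnnS.
Qed.

(** Codegree 1 for the module [R / I], read through [koszul_colon]; a factor from [m] outside the
    top primes brings the element into [m]. *)
Lemma uniform_killer : (0 < i)%N -> exists x : R, [/\ x \ini m, off_top x &
  forall y ys, regular_list (y :: ys) N -> (size ys < L)%N ->
    forall a : R^o, y *: a \in gsub I ys -> x *: a \in gsub I ys].
Proof.
move=> i0.
have [] := @kill_all 1 (quotient_mod I) isT.
- exists [:: qmap I (1 : R)] => x; rewrite -(quotient_reprK x) -[quotient_pi _ _]/(qmap I _).
  have -> : quotient_repr x = (quotient_repr x : R) *: (1 : R^o) by rewrite /GRing.scale /= mulr1.
  by rewrite linearZ rpredZ // mem_span ?mem_head.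
- move=> a x aI; rewrite -(quotient_reprK x) -[quotient_pi _ _]/(qmap I _) -linearZ.
  by apply/qmap0; rewrite /GRing.scale /= ; apply: ideal_mulr.
move=> c coff ck.
(* A top prime containing [m] would start a chain of positive length [i], which is impossible. *)
have [p [hp Ip [P [hP sP pP]]] mp|t tm toff] := @avoid_top m.
  by have [_] := sP 0%N i0; apply=> z /(prime_sub_local hm (hP 1%N i0))/mp/pP.
exists (c * t); split; first exact: ideal_mull.
  exact: off_topM.
move=> y ys yr ysL a ya; rewrite mulrC -scalerA; apply: rpredZ; apply/gsub_quot.
rewrite linearZ; apply: (koszul_colon (y := y)); last by rewrite -linearZ gsub_quot.
by apply: ck => //; rewrite addn1.
Qed.

End UniformKillers.

Lemma quot_map (R : comPzRingType) (M : lmodType R) (W W' : submodClosed M) : {subset W <= W'} ->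
  exists be : {linear quotient_mod W -> quotient_mod W'}, forall x, be (qmap W x) = qmap W' x.
Proof.
move=> WW'; pose rho (u : quotient_mod W) (v : quotient_mod W') := exists x, u = qmap W x /\ v = qmap W' x.
have [u|a _ _ _ _ [x [-> ->]] [y [-> ->]]|v [x [/esym/qmap0/WW' xW ->]]|be beP] := @linear_of_rel R _ _ rho.
- by exists (qmap W' (quotient_repr u)), (quotient_repr u); split=> //; rewrite /= quotient_reprK.
- by exists (a *: x + y); rewrite !linearP.
- exact/qmap0.
by exists be => x; apply: beP; exists x.
Qed.

Lemma qmap_surj (R : comPzRingType) (M : lmodType R) (W : submodClosed M) (u : quotient_mod W) :
  exists x, u = qmap W x.
Proof. by exists (quotient_repr u); rewrite /= quotient_reprK. Qed.

Lemma qmap_eq (R : comPzRingType) (M : lmodType R) (W : submodClosed M) x y :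
  qmap W x = qmap W y <-> x - y \in W.
Proof. by split=> [/quotient_eqP|h] //; apply/(quotient_eqP W). Qed.

(** Read from the left, contrary to [regular_list]: each element is regular modulo its
    predecessors. *)
Fixpoint regular_seq (E : comPzRingType) (I : ideal E) (ts : seq E) : Prop :=
  if ts is t :: ts' then (forall a : E, t * a \ini I -> a \ini I) /\ regular_seq (subD I (idl t)) ts'
  else True.

(** * Depth and systems of parameters *)

Section Depth.
Variables (R : comPzRingType) (m : ideal R).
Hypothesis hm : noetherian_local m.
Let hR := local_noeth hm.

Definition lc_vanishes (M : lmodType R) r : Prop :=
  forall j : nat, (j < r)%N -> forall z : local_cohomology m j%:Z M, z = 0.

Lemma lc_vanishes_iso (M N : lmodType R) (psi : {linear N -> M}) r : injective psi ->
  (forall y, exists x, psi x = y) -> lc_vanishes N r <-> lc_vanishes M r.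
Proof.
move=> pi ps; split=> h j jr z; have [f /bij_iso[fi fs]] := lc_iso hR m j%:Z pi ps.
  by have [w <-] := fs z; rewrite (h j jr w) linear0.
by apply: fi; rewrite linear0; apply: h.
Qed.

Lemma lc0_socle (M : lmodType R) : lc_vanishes M 1 ->
  forall y : M, (forall a : R, a \ini m -> a *: y = 0) -> y = 0.
Proof.
move=> h y my; have [ys hys] := noeth_ideal hR m.
have [C [aug [[iC kC _] _ /(_ 0%N)[cls [l s k]]]]] := lc_presented hys M.
have yc : cyc ys (aug y).
  split; last by apply/kC; exists y.
  move=> a ays; exists 1%N; rewrite expr1 -linearZ my ?linear0 //.
  by apply/hys/mem_span.
have /(k _ yc) : cls (aug y) = 0 by apply: h.
by rewrite /= -[0](linear0 aug) => /iC.
Qed.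

Lemma quotient_step (M : lmodType R) (W : submodClosed M) (y : R) (W' : submodClosed M) :
  (forall x, x \in W' <-> exists a, x - y *: a \in W) ->
  (forall x, y *: x \in W -> x \in W) ->
  (forall z : quotient_mod W, y *: z = 0 -> z = 0) /\
  exists be : {linear quotient_mod W -> quotient_mod W'},
    (forall c, exists b, be b = c) /\ forall b, be b = 0 <-> exists a, b = y *: a.
Proof.
move=> hW' reg; split=> [z|].
  by have [x ->] := qmap_surj z; rewrite -linearZ => /qmap0/reg h; apply/qmap0.
have [x xW|be beP] := @quot_map R M W W'.
  by apply/hW'; exists 0; rewrite scaler0 subr0.
exists be; split=> [c|b].
  by have [x ->] := qmap_surj c; exists (qmap W x).
have [x ->] := qmap_surj b; rewrite beP qmap0 hW'; split=> -[a].
  by move=> h; exists (qmap W a); rewrite -linearZ; apply/qmap_eq.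
have [x' ->] := qmap_surj a; rewrite -linearZ => /qmap_eq h; by exists x'.
Qed.

Lemma lc_vanish_quotient (M C : lmodType R) (x : R) (be : {linear M -> C}) r :
  (forall z : M, x *: z = 0 -> z = 0) -> (forall c, exists b, be b = c) ->
  (forall b, be b = 0 <-> exists a, b = x *: a) ->
  lc_vanishes M r.+1 -> lc_vanishes C r.
Proof.
move=> reg bes kbe h j jr.
apply: (lc_vanish hR (al := mklin (@scale_linear R x M)) (be := be)) => //.
- exact: scale_reg.
- by apply: h; apply: leqW.
- exact: h.
Qed.

(** Below degree [r.+1], multiplication by [x] is injective on cohomology, while every class is
    killed by a power of [x]. *)
Lemma lc_vanish_regular (M C : lmodType R) (x : R) (be : {linear M -> C}) r : x \ini m ->
  (forall z : M, x *: z = 0 -> z = 0) -> (forall c, exists b, be b = c) ->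
  (forall b, be b = 0 <-> exists a, b = x *: a) ->
  lc_vanishes C r -> lc_vanishes M r.+1.
Proof.
move=> xm reg bes kbe h j jr z.
have x0 (w : local_cohomology m j%:Z M) : x *: w = 0 -> w = 0.
  case: j jr w {z} => [|j] jr w; first exact: (lc_kernel0 hR reg).
  have [f fP] := lc_kernel hR m reg bes kbe j.
  by move=> /fP[u ->]; rewrite (h j jr u) linear0.
have [k] := lc_torsion hR z xm.
elim: k => [|k IH]; first by rewrite scale1r.
by rewrite exprS -scalerA => /x0/IH.
Qed.

Lemma regular_seq_lc ts (I : ideal R) : regular_seq I ts -> (forall t, t \in ts -> t \ini m) ->
  lc_vanishes (quotient_mod I) (size ts).
Proof.
elim: ts I => [|t ts IH] I //= [reg hts] tm.
have [x|x|reg' [be [bes kbe]]] := @quotient_step R^o I t (subD I (idl t)).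
- split=> [/in_sub[a aI /in_idl[b bE]]|[b h]].
    by exists b; rewrite /GRing.scale /= mulrC -bE opprB addrC subrK.
  apply/in_sub; exists (x - t * b : R) => //; rewrite opprB addrC subrK.
  by apply/in_idl; exists b; rewrite mulrC.
- exact: reg.
apply: (lc_vanish_regular _ reg' bes kbe); first by apply: tm; apply: mem_head.
by apply: IH => // z zts; apply: tm; rewrite inE zts orbT.
Qed.

(** Associated primes have dimension at least the depth. Induction on [r]: an [x] in [m] outside the
    associated primes is regular, and the given prime is strictly contained in an associated prime
    of [M / x M]. *)
Lemma depth_ass r (M : lmodType R) (y : M) : fgm M -> lc_vanishes M r ->
  prime_ideal (colon (sub0 M) y) -> chain (colon (sub0 M) y) r.
Proof.
elim: r M y => [|r IH] M y hM hv hp; first exact: chain0 hp _.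
have hN := noeth_fg hR hM.
have [k [P [h1 _ h3 _]]] := finite_ass hR hN.
have [k' [P' [h4 h5]]] := finite_subfamily k P (fun q => prime_ideal q /\ exists y : M, colon (sub0 M) y =i q).
have [||x [xm xP]] := @prime_avoidance R m k' P'.
- by move=> j /h4[].
- move=> j /h4[hq [z zq]] mq; apply: (prime_not1 hq); rewrite -zq; apply/in_colon/in_sub0.
  rewrite scale1r; apply: lc0_socle => [j' j'1|a /mq]; first by apply: hv; apply: leq_trans j'1 _.
  by rewrite -zq => /in_colon/in_sub0.
have reg (z : M) : x *: z = 0 -> z = 0.
  move=> xz; apply: contrapT => z0.
  have [|a [a0 hq]] := @ass_exists R M (sub0 M) z hR; first by apply/negP => /in_sub0.
  have [j jk jE] := h3 _ hq.
  have eqp (q q' : ideal R) : q =i q' -> prime_ideal q -> prime_ideal q'.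
    by move=> qq [q1 qM]; split=> [|u v]; rewrite -!qq //; apply: qM.
  have [|l lk lE] := h5 j jk; first by split; [exact: eqp jE hq|exists (a *: z)].
  apply: (xP l lk); rewrite lE -jE; apply/in_colon/in_sub0.
  by rewrite scalerA mulrC -scalerA xz scaler0.
pose W := image_sub (mklin (@scale_linear R x M)) (submod_full M).
have inW (z : M) : z \in W <-> exists a, z = x *: a.
  by rewrite in_sub; split=> [[a _ ->]|[a ->]]; exists a => //; apply/in_sub.
have kq b : qmap W b = 0 <-> exists a, b = x *: a by rewrite qmap0 inW.
have qs (b : quotient_mod W) : exists a, qmap W a = b by have [a ->] := qmap_surj b; exists a.
have hv' := lc_vanish_quotient reg qs kq hv.
set p := colon (sub0 M) y in hp *.
have yp (a : R) : a \ini p <-> a *: y = 0 by rewrite in_colon in_sub0.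
(* If all elements killed by [p] were multiples of [x], the quotients by the regular [x] would be
   killed by [p] too, and Nakayama's lemma would leave only zero. *)
have [z [pz zW]] : exists z : M, (forall a : R, a \ini p -> a *: z = 0) /\ z \notin W.
  apply: contrapT => hn.
  have Up : @submod_prop R M (fun z => forall a : R, a \ini p -> a *: z = 0).
    split=> [a _|c u v uU vU a ap]; first by rewrite scaler0.
    by rewrite scalerDr scalerA mulrC -scalerA uU // vU // scaler0 addr0.
  have [s [sU Us]] := hN (submod_of Up).
  have s0 : {subset s <= sub0 M}.
    apply: (nakayama hm) => g /sU/in_sub gU.
    have /inW[w gE] : g \in W by apply: contrapT => /negP gW; apply: hn; exists g.
    have /Us/span_sum[c wE] : w \in submod_of Up.
      by apply/in_sub => a ap; apply: reg; rewrite scalerA mulrC -scalerA -gE gU.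
    exists (fun j => x * c j); split=> [j|]; first exact: ideal_mulr.
    apply/in_sub0/eqP; rewrite subr_eq0 gE wE scaler_sumr; apply/eqP.
    by apply: eq_bigr => j _; rewrite scalerA.
  apply: (prime_not1 hp); apply/yp; rewrite scale1r; apply/in_sub0.
  by apply: (span_sub s0); apply: Us; apply/in_sub => a /yp.
have [|a [a0 hq]] := @ass_exists R (quotient_mod W) (sub0 _) (qmap W z) hR.
  by apply/negP => /in_sub0/qmap0; apply/negP.
apply: (chain_cons hp _ _ (IH _ _ (fgm_quot _ hM) hv' hq)) => [b bp|h].
  have bz : b *: qmap W z = 0 by rewrite -linearZ pz // linear0.
  by apply/in_colon/in_sub0; rewrite scalerA mulrC -scalerA bz scaler0.
have /h/yp/reg y0 : x \ini colon (sub0 (quotient_mod W)) (a *: qmap W z).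
  have xz : x *: qmap W z = 0 by rewrite -linearZ; apply/kq; exists z.
  by apply/in_colon/in_sub0; rewrite scalerA mulrC -scalerA xz scaler0.
by apply: (prime_not1 hp); apply/yp; rewrite y0 scaler0.
Qed.

Section SystemOfParameters.
Variables (B : lmodType R) (d : nat) (x : nat -> R) (e : nat -> nat).
Hypotheses (hB : fgm B) (vB : lc_vanishes B d).
Hypotheses (xm : forall i, (i < d)%N -> x i \ini m).
Hypothesis sop : forall q, prime_ideal q -> (forall i, (i < d)%N -> x i \ini q) -> {subset m <= q}.

Lemma size_complement (s : seq nat) : uniq s -> (forall i, i \in s -> (i < d)%N) ->
  size [seq j <- iota 0 d | j \notin s] = (d - size s)%N.
Proof.
move=> us sd; rewrite size_filter.
have h : count (mem s) (iota 0 d) = size s.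
  rewrite -size_filter; apply: perm_size; apply: uniq_perm => //.
    by rewrite filter_uniq ?iota_uniq.
  by move=> j; rewrite mem_filter mem_iota /=; case js: (j \in s) => //=; rewrite add0n sd.
by rewrite -h -[X in (X - _)%N](size_iota 0 d) -(count_predC (mem s) (iota 0 d)) addKn.
Qed.

(** An associated prime of the quotient by the earlier powers has a chain of length [d - size s]
    above it. If it contained [x i] too, then only [d - size s - 1] parameters would remain modulo
    it, too few by the height theorem. *)
Lemma sop_regular (s : seq nat) : uniq s -> (forall i, i \in s -> (i < d)%N) ->
  regular_list [seq x i ^+ e i | i <- s] B /\
  lc_vanishes (quotient_mod (gen_sub [seq x i ^+ e i | i <- s] B)) (d - size s).
Proof.
elim: s => [|i s IH] /=.
  move=> _ _; split=> //; rewrite subn0.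
  apply: (iffLR (lc_vanishes_iso (psi := qmap (gen_sub [::] B)) d _ _) vB) => [u v|y].
    by move=> /qmap_eq/in_sub0/eqP; rewrite subr_eq0 => /eqP.
  by have [u ->] := qmap_surj y; exists u.
move=> /andP[ns us] sd.
have [|rs vs] := IH us; first by move=> j js; apply: sd; rewrite inE js orbT.
set ys := [seq x i ^+ e i | i <- s] in rs vs *; set W := gen_sub ys B in vs.
have id : (i < d)%N by apply: sd; apply: mem_head.
have sz : (size (i :: s) <= d)%N.
  rewrite -[leqRHS](size_iota 0 d); apply: uniq_leq_size; first by rewrite /= ns us.
  by move=> j /sd jd; rewrite mem_iota.
have reg (a : B) : x i ^+ e i *: a \in W -> a \in W.
  move=> xa; apply: contrapT => aW.
  have [|c [c0 hp]] := @ass_exists R (quotient_mod W) (sub0 _) (qmap W a) hR.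
    by apply/negP => /in_sub0/qmap0.
  have chp := depth_ass (fgm_quot W hB) vs hp.
  set p := colon _ _ in hp chp.
  have inp (b : R) : b *: a \in W -> b \ini p.
    move=> ba; have ba0 : b *: qmap W a = 0 by rewrite -linearZ; apply/qmap0.
    by apply/in_colon/in_sub0; rewrite scalerA mulrC -scalerA ba0 scaler0.
  have xp j : j \in i :: s -> x j \ini p.
    move=> js; apply: (prime_expn hp (n := e j)); apply: inp.
    move: js; rewrite inE => /predU1P[->//|js].
    by apply: (@gsub_gen _ B (sub0 B) ys (x j ^+ e j) a); apply/mapP; exists j.
  pose th := [seq x j | j <- iota 0 d & j \notin i :: s].
  have : (d - size s <= size th)%N.
    apply: (@chain_bound R hR m p th _ hm) chp => [z /mapP[j]|q hq pq thq].
      by rewrite mem_filter mem_iota => /andP[_ /= jd] ->; apply: xm.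
    apply: (sop hq) => j jd; have [/xp/pq //|js] := boolP (j \in i :: s).
    by apply: thq; apply/mapP; exists j => //; rewrite mem_filter js mem_iota.
  rewrite size_map size_complement //=; last by rewrite ns us.
  rewrite subnS leqNgt ltn_predL subn_gt0; case/negP; exact: sz.
split; first by split.
have [x0|reg' [be [bes kbe]]] := quotient_step (W' := gen_sub (x i ^+ e i :: ys) B) _ reg.
  exact: in_gen_sub.
by apply: (lc_vanish_quotient reg' bes kbe); rewrite -subSn // subSS.
Qed.

End SystemOfParameters.
End Depth.

Definition pser (E : comPzRingType) : Type := nat -> E.
HB.instance Definition _ (E : comPzRingType) := gen_eqMixin (pser E).
HB.instance Definition _ (E : comPzRingType) := gen_choiceMixin (pser E).

(** * Power series *)

Section PowerSeries.
Variable E : comPzRingType.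
Local Notation P := (pser E).
Implicit Types f g h : P.

Definition ps_zero : P := fun=> 0.
Definition ps_opp f : P := fun n => - f n.
Definition ps_add f g : P := fun n => f n + g n.
Definition ps_tail f : P := fun n => f n.+1.

(** The Cauchy product by recursion on the degree, from the decomposition of [f] into its constant
    term and the variable times its tail; no sums over index ranges occur. *)
Fixpoint ps_coef f g n : E :=
  if n is k.+1 then f 0%N * g k.+1 + ps_coef (ps_tail f) g k else f 0%N * g 0%N.
Definition ps_mul f g : P := ps_coef f g.
Definition ps_const (a : E) : P := fun n => if n is 0%N then a else 0.
Definition ps_var : P := fun n => if n is 1%N then 1 else 0.

Lemma ps_addA : associative ps_add.
Proof. by move=> f g h; apply: funext => n; rewrite /ps_add addrA. Qed.
Lemma ps_addC : commutative ps_add.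
Proof. by move=> f g; apply: funext => n; rewrite /ps_add addrC. Qed.
Lemma ps_add0 : left_id ps_zero ps_add.
Proof. by move=> f; apply: funext => n; rewrite /ps_add add0r. Qed.
Lemma ps_addN : left_inverse ps_zero ps_opp ps_add.
Proof. by move=> f; apply: funext => n; rewrite /ps_add addNr. Qed.

HB.instance Definition _ := GRing.isZmodule.Build P ps_addA ps_addC ps_add0 ps_addN.

Lemma ps_coef0 g n : ps_coef ps_zero g n = 0.
Proof. by elim: n => [|n IH] /=; rewrite mul0r // add0r; exact: IH. Qed.

Lemma ps_coefDl f g h n : ps_coef (ps_add f g) h n = ps_coef f h n + ps_coef g h n.
Proof.
elim: n f g => [|n IH] f g /=; first by rewrite mulrDl.
by rewrite -/(ps_add _ _) [ps_coef _ _ n](IH (ps_tail f) (ps_tail g)) mulrDl addrACA.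
Qed.

Lemma ps_coefZl a f h n : ps_coef (fun i => a * f i) h n = a * ps_coef f h n.
Proof.
elim: n f => [|n IH] f /=; first by rewrite mulrA.
by rewrite (IH (ps_tail f)) mulrDr mulrA.
Qed.

Lemma ps_mulA : associative ps_mul.
Proof.
move=> f g h; apply: funext => n; elim: n f g h => [|n IH] f g h; first by rewrite /= mulrA.
change (f 0%N * ps_mul g h n.+1 + ps_mul (ps_tail f) (ps_mul g h) n =
  (f 0%N * g 0%N) * h n.+1 + ps_coef (ps_tail (ps_mul f g)) h n).
have -> : ps_tail (ps_mul f g) = ps_add (fun i => f 0%N * g i.+1) (ps_mul (ps_tail f) g) by [].
rewrite ps_coefDl (ps_coefZl (f 0%N) (ps_tail g)) IH /= mulrDr !mulrA addrA.
by [].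
Qed.

Lemma ps_mulC : commutative ps_mul.
Proof.
move=> f g; apply: funext => n.
(* Commuting requires expanding both factors, which lowers the degree by two; hence an induction on
   two consecutive degrees. *)
suff [] : (forall f g, ps_mul f g n = ps_mul g f n) /\ (forall f g, ps_mul f g n.+1 = ps_mul g f n.+1).
  by [].
elim: n {f g} => [|n [IH0 IH1]]; split=> // f g.
- by rewrite /= mulrC.
- by rewrite /= addrC mulrC (mulrC (f 0%N)).
have st k f1 g1 : ps_mul f1 g1 k.+1 = f1 0%N * g1 k.+1 + ps_mul (ps_tail f1) g1 k by [].
rewrite st IH1 st [RHS]st (IH1 (ps_tail g)) st (IH0 (ps_tail g)) !addrA.
by congr (_ + _); rewrite addrC.
Qed.

Lemma ps_mul1 : left_id (ps_const 1) ps_mul.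
Proof.
move=> f; apply: funext => -[|n]; first by rewrite /= mul1r.
change (1 * f n.+1 + ps_coef ps_zero f n = f n.+1).
by rewrite mul1r ps_coef0 addr0.
Qed.

Lemma ps_mulDl : left_distributive ps_mul ps_add.
Proof. by move=> f g h; apply: funext => n; apply: ps_coefDl. Qed.

HB.instance Definition _ := GRing.Zmodule_isComPzRing.Build P ps_mulA ps_mulC ps_mul1 ps_mulDl.

Lemma ps_coefD f g n : (f + g) n = f n + g n. Proof. by []. Qed.
Lemma ps_coefB f g n : (f - g) n = f n - g n. Proof. by []. Qed.
Lemma ps_coefM0 f g : (f * g) 0%N = f 0%N * g 0%N. Proof. by []. Qed.
Lemma ps_coefMS f g n : (f * g) n.+1 = f 0%N * g n.+1 + (ps_tail f * g) n. Proof. by []. Qed.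

Lemma ps_constM a f n : (ps_const a * f) n = a * f n.
Proof.
case: n => // n; rewrite ps_coefMS; have -> : ps_tail (ps_const a) = 0 by [].
by rewrite mul0r addr0.
Qed.

Lemma ps_varM0 f : (ps_var * f) 0%N = 0. Proof. by rewrite ps_coefM0 mul0r. Qed.

Lemma ps_varMS f n : (ps_var * f) n.+1 = f n.
Proof.
rewrite ps_coefMS mul0r add0r; have -> : ps_tail ps_var = 1 by apply: funext => -[].
by rewrite mul1r.
Qed.

Lemma ps_decomp f : f = ps_const (f 0%N) + ps_var * ps_tail f.
Proof.
by apply: funext => -[|n]; rewrite ps_coefD ?ps_varM0 ?ps_varMS ?addr0 ?add0r.
Qed.

Lemma ps_constB : zmod_morphism ps_const.
Proof. by move=> a b; apply: funext => -[|n] //; rewrite ps_coefB subr0. Qed.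
Lemma ps_const_monoid : monoid_morphism ps_const.
Proof. by split=> // a b; apply: funext => -[|n] //; rewrite ps_constM mulr0. Qed.
HB.instance Definition _ := GRing.isZmodMorphism.Build E P ps_const ps_constB.
HB.instance Definition _ := GRing.isMonoidMorphism.Build E P ps_const ps_const_monoid.

Definition ps_head f : E := f 0%N.
Lemma ps_headB : zmod_morphism ps_head. Proof. by []. Qed.
Lemma ps_head_monoid : monoid_morphism ps_head. Proof. by []. Qed.
HB.instance Definition _ := GRing.isZmodMorphism.Build P E ps_head ps_headB.
HB.instance Definition _ := GRing.isMonoidMorphism.Build P E ps_head ps_head_monoid.

(** Successive approximation: the coefficients found at each stage are assembled into power
    series. *)
Lemma ps_series_combination (F : seq P) (G : P -> Prop) :
  (forall g, G g -> exists (c : nat -> E) g1, G g1 /\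
     g = \sum_(k < size F) ps_const (c k) * F`_k + ps_var * g1) ->
  forall g, G g -> g \in @span P P^o F.
Proof.
move=> hG g Gg.
have nxt (u : {g | G g}) : {c : (nat -> E) * {g | G g} |
    sval u = \sum_(k < size F) ps_const (c.1 k) * F`_k + ps_var * sval c.2}.
  case: u => u Gu; apply: cid; have [c [g1 [Gg1 E1]]] := hG u Gu.
  by exists (c, exist _ g1 Gg1).
pose U := fix U j : {g | G g} := if j is i.+1 then (sval (nxt (U i))).2 else exist _ g Gg.
pose c j := (sval (nxt (U j))).1.
(* The series of the coefficients chosen from stage [j] on. The remainder [D j] is the variable
   times [D j.+1] for every [j], so all its coefficients vanish. *)
pose h j k : P := fun n => c (j + n)%N k.
pose D j := sval (U j) - \sum_(k < size F) h j k * F`_k.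
have hE j k : h j k = ps_const (c j k) + ps_var * h j.+1 k.
  rewrite {1}[h j k]ps_decomp; congr (ps_const (c _ k) + ps_var * _); first by rewrite addn0.
  by apply: funext => n; rewrite /ps_tail /h addSnnS.
have DS j : D j = ps_var * D j.+1.
  rewrite /D (svalP (nxt (U j))) mulrBr mulr_sumr.
  have -> : \sum_(k < size F) h j k * F`_k = \sum_(k < size F) ps_const (c j k) * F`_k +
      \sum_(k < size F) ps_var * (h j.+1 k * F`_k).
    by rewrite -big_split; apply: eq_bigr => k _; rewrite hE mulrDl mulrA.
  by rewrite opprD addrACA subrr add0r.
have D0 n j : D j n = 0.
  by elim: n j => [|n IH] j; rewrite DS ?ps_varM0 // ps_varMS.
have /eqP : D 0%N = 0 by apply: funext => n; apply: D0.
rewrite subr_eq0 => /eqP /= ->.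
by apply: (@sum_span P P^o F (h 0%N)).
Qed.

(** Hilbert's argument with lowest coefficients: [L n] consists of the coefficients of [v ^ n] in
    elements of [J] divisible by [v ^ n]. These ideals increase and stop at some [N]; generators for
    the levels up to [N] suffice. *)
Lemma ps_noeth : noeth E^o -> noeth P^o.
Proof.
move=> hE J.
pose Jn n f := ps_var ^+ n * f \ini J.
have Lp n : @submod_prop E E^o (fun a => exists2 f : P, Jn n f & f 0%N = a).
  split; first by exists 0 => //; rewrite /Jn mulr0 ideal0.
  move=> a _ _ [f fJ <-] [g gJ <-]; exists (ps_const a * f + g).
    by rewrite /Jn mulrDr mulrCA; apply: ideal_add => //; apply: ideal_mull.
  by rewrite ps_coefD ps_constM.
pose L n := submod_of (Lp n).
have LS n : {subset L n <= L n.+1}.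
  move=> a /in_sub[f fJ fa]; apply/in_sub; exists f => //.
  by rewrite /Jn exprS -mulrA; apply: ideal_mull.
have [N NP] := noeth_chain hE LS.
have gens n : exists F : seq P, (forall f, f \in F -> Jn n f) /\
    forall a, a \ini L n -> exists c : nat -> E, a = \sum_(k < size F) c k * (F`_k : P) 0%N.
  have [s [sL Ls]] := hE (L n).
  have [F [FJ Fs]] : exists F : seq P, (forall f, f \in F -> Jn n f) /\ [seq (f : P) 0%N | f <- F] = s.
    elim: s sL {Ls} => [|b s IH] sL; first by exists [::].
    case: IH => [x xs|F [FJ <-]]; first by apply: sL; rewrite inE xs orbT.
    have /in_sub[f fJ fb] := sL b (mem_head _ _).
    by exists (f :: F); split=> [g|]; [rewrite inE => /predU1P[->|/FJ]|rewrite /= fb].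
  exists F; split=> // a /Ls/span_sum[c ->]; exists c.
  by rewrite -Fs size_map; apply: eq_bigr => k _; rewrite (nth_map 0).
have [F FP] := choice gens.
have step n f : Jn n f -> exists (c : nat -> E) f1, Jn n.+1 f1 /\
    f = \sum_(k < size (F n)) ps_const (c k) * (F n)`_k + ps_var * f1.
  move=> fJ; have [FJ FL] := FP n.
  have [|c cE] := FL (f 0%N); first by apply/in_sub; exists f.
  pose g := f - \sum_(k < size (F n)) ps_const (c k) * (F n)`_k.
  have g0 : g 0%N = 0.
    rewrite /g ps_coefB cE -[X in _ - X]/(ps_head _) rmorph_sum.
    by rewrite [X in _ - X](eq_bigr (fun k : 'I__ => c k * ((F n)`_k : P) 0%N)) ?subrr.
  have gE : g = ps_var * ps_tail g by rewrite {1}(ps_decomp g) g0 rmorph0 add0r.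
  exists c, (ps_tail g); split; last by rewrite -gE addrC subrK.
  rewrite /Jn exprSr -mulrA -gE mulrBr mulr_sumr; apply: ideal_sub => //.
  apply: ideal_sum => k _; rewrite mulrCA; apply: ideal_mull; apply: FJ; exact: mem_nth.
pose T := flatten [seq [seq ps_var ^+ n * f | f <- F n] | n <- iota 0 N.+1].
exists T; split=> [x|x xJ].
  move=> /flattenP[_ /mapP[n _ ->] /mapP[f fF ->]].
  by have [FJ _] := FP n; apply: FJ.
have mulT n (y : P) : (n <= N)%N -> y \in @span P P^o (F n) -> (ps_var ^+ n * y : P^o) \in @span P P^o T.
  move=> nN yF.
  pose Z := preim (mklin (@scale_linear P (ps_var ^+ n) P^o)) (@span P P^o T).
  suff ZF : {subset @span P P^o (F n) <= Z} by have /in_sub := ZF y yF.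
  apply: span_sub => f fF; apply/in_sub/mem_span/flattenP.
  exists [seq ps_var ^+ n * f | f <- F n]; last by apply/mapP; exists f.
  by apply/mapP; exists n => //; rewrite mem_iota.
(* From level [N] on the same generators serve at every level, and the approximation converges. *)
have top n f : (N <= n)%N -> Jn n f -> f \in @span P P^o (F N).
  move=> Nn fJ.
  apply: (@ps_series_combination (F N) (fun f => exists2 n, (N <= n)%N & Jn n f)); last by exists n.
  move=> g [k Nk gJ]; have [FJ FL] := FP N.
  have [|c cE] := FL (g 0%N); first by apply: (NP k); apply/in_sub; exists g.
  pose g' := g - \sum_(k < size (F N)) ps_const (c k) * (F N)`_k.
  have g0 : g' 0%N = 0.
    rewrite /g' ps_coefB cE -[X in _ - X]/(ps_head _) rmorph_sum.
    by rewrite [X in _ - X](eq_bigr (fun k : 'I__ => c k * ((F N)`_k : P) 0%N)) ?subrr.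
  have gE : g' = ps_var * ps_tail g' by rewrite {1}(ps_decomp g') g0 rmorph0 add0r.
  exists c, (ps_tail g'); split; last by rewrite -gE addrC subrK.
  exists k.+1; first exact: leqW.
  rewrite /Jn exprSr -mulrA -gE mulrBr mulr_sumr; apply: ideal_sub => //.
  apply: ideal_sum => l _; rewrite mulrCA; apply: ideal_mull.
  rewrite -(subnK Nk) exprD -mulrA; apply: ideal_mull; apply: FJ; exact: mem_nth.
suff H j f : (j <= N)%N -> Jn (N - j)%N f -> (ps_var ^+ (N - j) * f : P^o) \in @span P P^o T.
  by have := H N x (leqnn N); rewrite subnn /Jn expr0 mul1r => /(_ xJ).
elim: j f => [|j IH] f jN fJ.
  by rewrite subn0 in fJ *; apply: mulT => //; apply: top fJ.
have [c [f1 [f1J ->]]] := step _ _ fJ.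
have E1 : (N - j = (N - j.+1).+1)%N by rewrite subnSK.
rewrite mulrDr; apply: rpredD.
  apply: mulT; first exact: leq_subr.
  exact: (@sum_span P P^o (F (N - j.+1)%N) (fun k => ps_const (c k))).
by rewrite mulrA -exprSr -E1; apply: IH; [exact: ltnW|rewrite E1].
Qed.

(** With an invertible constant term, [f] alone matches every constant coefficient, so by
    approximation it generates 1. *)
Lemma ps_unit f b : f 0%N * b = 1 -> exists g, f * g = 1.
Proof.
move=> fb.
have H : (1 : P) \in @span P P^o [:: f].
  apply: (@ps_series_combination [:: f] (fun=> True)) => // h _.
  exists (fun=> b * h 0%N).
  pose h' := h - ps_const (b * h 0%N) * f.
  exists (ps_tail h'); split=> //; rewrite big_ord_recl big_ord0 addr0 /=.
  have h0 : h' 0%N = 0.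
    by rewrite /h' ps_coefB ps_constM mulrAC (mulrC b) fb mul1r subrr.
  have -> : ps_var * ps_tail h' = h' by rewrite {2}(ps_decomp h') h0 rmorph0 add0r.
  by rewrite addrC subrK.
have [a /span_nil/eqP] := iffLR (span_cons _ _ _) H.
by rewrite subr_eq0 => /eqP ->; exists a; rewrite mulrC.
Qed.

Lemma ps_local (m : ideal E) : noetherian_local m -> noetherian_local (contract ps_head m : ideal P).
Proof.
move=> hm; split; first by apply/noetherianP; apply: ps_noeth; apply: local_noeth hm.
apply: local_ringI => [/in_contract|f fm]; first exact: (local_not1 hm).
have [|b fb] := local_unit hm (a := f 0%N); last exact: ps_unit fb.
by move=> h; apply: fm; apply/in_contract.
Qed.

End PowerSeries.

(** Equality including the closure proofs, so that identities between ideals can be rewritten. *)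
Lemma submod_eq (R : pzRingType) (V : lmodType R) (A B : submodClosed V) : A =i B -> A = B.
Proof.
case: A B => a [[h1] [h2]] [b [[k1] [k2]]] /= ab.
have E : a = b by apply: funext => x; exact: ab.
case: _ / E in k1 k2 ab *.
by rewrite (Prop_irrelevance h1 k1) (Prop_irrelevance h2 k2).
Qed.

Lemma ideal_eq (E : comPzRingType) (I : ideal E) (a b : E) : a \ini I -> a = b -> b \ini I.
Proof. by move=> aI <-. Qed.

(** * A regular sequence after adjoining variables *)

Section AddIdeal.
Variable E : comPzRingType.
Implicit Types (I : ideal E) (x y a : E).

Definition add_ideal I x : ideal E := subD I (idl x).

Lemma in_add_ideal I x a : (a \ini add_ideal I x) <-> exists b, a - x * b \ini I.
Proof.
split=> [/in_sub[c cI /in_idl[b bE]]|[b h]].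
  by exists b; rewrite mulrC -bE opprB addrC subrK.
apply/in_sub; exists (a - x * b : E) => //; rewrite opprB addrC subrK.
by apply/in_idl; exists b; rewrite mulrC.
Qed.

Lemma add_ideal_base I x a : a \ini I -> a \ini add_ideal I x.
Proof. by move=> aI; apply/in_add_ideal; exists 0; rewrite mulr0 subr0. Qed.

Lemma add_ideal_gen I x a : x * a \ini add_ideal I x.
Proof. by apply/in_add_ideal; exists a; rewrite subrr ideal0. Qed.

Lemma add_idealC I x y : add_ideal (add_ideal I x) y = add_ideal (add_ideal I y) x.
Proof.
have H J u v a : a \ini add_ideal (add_ideal J u) v -> a \ini add_ideal (add_ideal J v) u.
  move=> /in_add_ideal[b /in_add_ideal[c h]]; apply/in_add_ideal; exists c.
  by apply/in_add_ideal; exists b; rewrite addrAC.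
by apply: submod_eq => a; apply/idP/idP; apply: H.
Qed.

Definition add_squares I (ys : seq E) : ideal E := foldr (fun y W => add_ideal W (y * y)) I ys.

Lemma add_squares_ideal I y ys : add_squares (add_ideal I y) ys = add_ideal (add_squares I ys) y.
Proof. by elim: ys => //= z ys ->; rewrite add_idealC. Qed.

(** Multiplication by [x] is injective on the multiples of [x] in [E / I]; equivalently, [theta x]
    is regular modulo [hat I x]. *)
Definition stable I x : Prop := forall a, x * (x * a) \ini I -> x * a \ini I.

(* [stable (I + squares of the later entries + any of the earlier entries) x]
   for every entry [x]. *)
Fixpoint stable_list I (ys : seq E) : Prop :=
  if ys is y :: ys' then
    [/\ stable (add_squares I ys') y, stable_list I ys' & stable_list (add_ideal I y) ys']
  else True.

End AddIdeal.

(** The map [p] need not be multiplicative; it only has to respect multiplication by the entries.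
    This admits truncated evaluations of power series. *)
Lemma regular_seq_transfer (P E : comPzRingType) (p : P -> E) (t : P -> E) (us : seq P)
    (J : ideal P) (K : ideal E) : zmod_morphism p -> (forall a, exists f, p f = a) ->
  (forall u f, u \in us -> p (u * f) = t u * p f) ->
  (forall f, f \ini J <-> p f \ini K) -> regular_seq J us <-> regular_seq K (map t us).
Proof.
move=> pB ps; elim: us J K => //= u us IH J K hu JK.
have hu0 f : p (u * f) = t u * p f by apply: hu; apply: mem_head.
rewrite (IH (subD J (idl u)) (subD K (idl (t u)))); last 2 first.
- by move=> v f vus; apply: hu; rewrite inE vus orbT.
- move=> f; rewrite -!/(add_ideal _ _) !in_add_ideal; split=> -[g].
    by move=> /JK; rewrite pB hu0; exists (p g).
  by have [h <-] := ps g; rewrite -hu0 -pB => /JK; exists h.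
split=> -[h1 h2]; split=> // a.
  by have [f <-] := ps a; rewrite -hu0 => /JK/h1/JK.
by move=> /JK; rewrite hu0 => /h1/JK.
Qed.

(** * Adjoining one variable [v] with [x v = 0] *)

Section Hat.
Variable E : comPzRingType.
Local Notation P := (pser E).
Local Notation C := (@ps_const E).
Implicit Types (I : ideal E) (x y : E) (f g : P).

Lemma ps_coef_ideal (K : ideal E) f g n : (forall i, f i \ini K) -> (g * f) n \ini K.
Proof.
move=> fK; elim: n g => [|n IH] g; first by rewrite ps_coefM0; apply: ideal_mull.
by rewrite ps_coefMS; apply: ideal_add; [apply: ideal_mull|apply: IH].
Qed.

Lemma hat_prop I x : @submod_prop P P^o (fun f : P => f 0%N \ini I /\
  forall n, f n.+1 \ini add_ideal I x).
Proof.
split; first by split=> [|n]; apply: ideal0.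
move=> a f g [f0 fS] [g0 gS]; split=> [|n].
  by apply: ideal_add => //; apply: (ideal_mull (a 0%N)).
apply: ideal_add => //; apply: ps_coef_ideal => -[|i] //; exact: add_ideal_base.
Qed.

(* The image of [I] in [E[[v]] / (x v)], pulled back to [E[[v]]]. *)
Definition hat I x : ideal P := submod_of (hat_prop I x).

Lemma in_hat I x f : (f \ini hat I x) <-> f 0%N \ini I /\ forall n, f n.+1 \ini add_ideal I x.
Proof. exact: in_sub. Qed.

Lemma hat_add I x a : hat (add_ideal I a) x = add_ideal (hat I x) (C a).
Proof.
apply: submod_eq => f; apply/idP/idP => [/in_hat[/in_add_ideal[b h0] hS]|/in_add_ideal[g]].
  have hS' n : exists c, f n.+1 - a * c \ini add_ideal I x.
    have := hS n; rewrite /add_ideal -!/(add_ideal _ _) add_idealC.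
    by move=> /in_add_ideal[c h]; exists c.
  have [c cP] := choice hS'.
  apply/in_add_ideal; exists (fun n => if n is k.+1 then c k else b).
  by apply/in_hat; split=> [|n]; rewrite ps_coefB ps_constM.
move=> /in_hat[h0 hS]; apply/in_hat; split=> [|n].
  by apply/in_add_ideal; exists (g 0%N); move: h0; rewrite ps_coefB ps_constM.
rewrite add_idealC; apply/in_add_ideal; exists (g n.+1).
by have := hS n; rewrite ps_coefB ps_constM.
Qed.

Lemma hat_squares I x ys : hat (add_squares I ys) x = add_squares (hat I x) (map C ys).
Proof. by elim: ys => //= y ys IH; rewrite hat_add IH rmorphM. Qed.

Lemma stable_hat I x y : stable I y -> stable (add_ideal I x) y -> stable (hat I x) (C y).
Proof.
move=> h1 h2 f /in_hat[f0 fS]; apply/in_hat; split=> [|n]; rewrite ps_constM.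
  by apply: h1; move: f0; rewrite !ps_constM.
by apply: h2; have := fS n; rewrite !ps_constM.
Qed.

(** In [hat I y] constant coefficients are taken modulo [I] and the others modulo [I] and [y];
    stability is therefore needed for both ideals. *)
Lemma stable_list_hat I y ys : stable_list I ys -> stable_list (add_ideal I y) ys ->
  stable_list (hat I y) (map C ys).
Proof.
elim: ys I => //= z ys IH I [s1 l1 l1'] [s2 l2 l2']; split.
- by rewrite -hat_squares; apply: stable_hat => //; rewrite -add_squares_ideal.
- exact: IH.
- by rewrite -hat_add; apply: IH => //; rewrite add_idealC.
Qed.

Definition theta x : P := C x + ps_var E.

Lemma theta0 x f : (theta x * f) 0%N = x * f 0%N.
Proof. by rewrite mulrDl ps_coefD ps_constM ps_varM0 addr0. Qed.

Lemma thetaS x f n : (theta x * f) n.+1 = x * f n.+1 + f n.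
Proof. by rewrite mulrDl ps_coefD ps_constM ps_varMS. Qed.

(* [E[[v]] / (I, x v, x + v)] is [E / (I, x ^ 2)], through [v |-> - x]. *)
Lemma theta_layer I x ts : stable I x -> regular_seq (add_ideal I (x * x)) ts ->
  regular_seq (hat I x) (theta x :: map C ts).
Proof.
move=> sx hts; split.
  move=> f /in_hat[f0 fS].
  (* In degree [n.+1] the product is [x * f n.+1 + f n], so [f n] is a multiple of [x] modulo
     [I]. *)
  have fI n : f n \ini add_ideal I x.
    have /in_add_ideal[b h] := fS n; apply/in_add_ideal; exists (b - f n.+1).
    by move: h; rewrite thetaS mulrBr opprB addrCA addrA.
  apply/in_hat; split=> [|n]; last exact: fI.
  (* With [f 0] equal to [x * b] modulo [I], the constant coefficient of the product puts
     [x * (x * b)] in [I], and stability applies. *)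
  have /in_add_ideal[b h] := fI 0%N; rewrite -(subrK (x * b) (f 0%N)); apply: ideal_add => //.
  apply: sx; rewrite -[x * (x * b)](subKr (x * f 0%N)) -mulrBr; apply: ideal_sub.
    by rewrite -theta0.
  exact: ideal_mull.
(* Evaluation at [v = - x], truncated because [x ^ 2] is divided out. *)
pose p (f : P) := f 0%N - x * f 1%N.
suff [_ h] : regular_seq (subD (hat I x) (idl (theta x))) (map C ts) <->
    regular_seq (add_ideal I (x * x)) (map (@ps_head E) (map C ts)).
  by apply: h; rewrite -map_comp (eq_map (g := id)) ?map_id.
apply: (@regular_seq_transfer P E p (@ps_head E)) => [f g|a|u f /mapP[t _ ->]|f].
- by rewrite /p !ps_coefB; ring.
- by exists (C a); rewrite /p /= mulr0 subr0.
- by rewrite /p !ps_constM /ps_head /= mulrBr mulrCA.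
rewrite -/(add_ideal _ _) !in_add_ideal; split=> [[g /in_hat[h0 hS]]|[b h]].
  have /in_add_ideal[b] := hS 0%N; rewrite ps_coefB thetaS => h1.
  exists (- (b + g 1%N)); move: h0; rewrite ps_coefB theta0 => h0.
  by apply: ideal_eq (ideal_sub h0 (ideal_mull x h1)) _; rewrite /p; ring.
(* Modulo [x] the quotient by [theta x] is the tail of [f]; the constant [x * b] corrects degree
   0. *)
exists (fun n => f n.+1 + C (x * b) n); apply/in_hat; split=> [|n].
  by rewrite ps_coefB theta0 /=; apply: ideal_eq h _; rewrite /p; ring.
rewrite ps_coefB thetaS; apply/in_add_ideal; case: n => [|n] /=.
  by exists (- (f 2%N) - b); apply: ideal_eq (ideal0 I) _; ring.
by exists (- f n.+3); apply: ideal_eq (ideal0 I) _; ring.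
Qed.

End Hat.

(** * Adjoining all the variables *)

Section Tower.

(* [G / Z] is [E / I] with, for each [y] in [ys], a variable [v] such that
   [y v = 0] adjoined; [ths] consists of the elements [y + v]. *)
Definition tower_spec (E : comPzRingType) (m I : ideal E) (ys : seq E) : Prop :=
  exists (G : comPzRingType) (Z mG : ideal G) (io : {rmorphism E -> G})
    (ro : {rmorphism G -> E}) (ths : seq G),
  [/\ [/\ noetherian_local mG, forall x, ro (io x) = x & forall z, ro z \ini m -> z \ini mG],
      (forall z, z \ini Z -> ro z \ini I) /\ (forall a, a \ini I -> io a \ini Z),
      size ths = size ys /\ (forall t, t \in ths -> t \ini mG),
      forall ts, regular_seq (add_squares I ys) ts -> regular_seq Z (ths ++ map io ts)
    & forall q, prime_ideal q -> {subset Z <= q} -> (forall t, t \in ths -> t \ini q) ->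
        (forall y, y \in ys -> io y \ini q) /\
        ((forall a, a \ini m -> io a \ini q) -> {subset mG <= q})].

(** The variable of the head is adjoined first and the induction runs over the power series ring
    with the ideal [hat I y]. Hence [theta y] comes after the elements of the tail, for which the
    later squares have already been produced. *)
Lemma tower_exists k (E : comPzRingType) (m I : ideal E) (ys : seq E) : size ys = k ->
  noetherian_local m -> (forall y, y \in ys -> y \ini m) -> stable_list I ys ->
  tower_spec m I ys.
Proof.
elim: k E m I ys => [|k IH] E m I [|y ys] //=.
  move=> _ hm _ _.
  exists E, I, m, (@idfun E), (@idfun E), [::]; split=> // ts.
  by rewrite map_id.
move=> [sz] hm ym [st sl sl'].
have hP := ps_local hm.
have [||||G [Z [mG [io [ro [ths [[hG roio mGro] [Zro ioZ] [sth thm] reg D]]]]]]] :=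
    IH (pser E) (contract (@ps_head E) m) (hat I y) (map (@ps_const E) ys).
- by rewrite size_map.
- exact: hP.
- move=> _ /mapP[z zys ->]; apply/in_contract; apply: ym; rewrite inE zys orbT //.
- exact: stable_list_hat.
exists G, Z, mG, (io \o @ps_const E), (@ps_head E \o ro), (ths ++ [:: io (theta y)]).
split.
- split=> // [x|z zm]; first by rewrite /= roio.
  by apply: mGro; apply/in_contract.
- split=> [z /Zro/in_hat[] //|a aI]; apply: ioZ; apply/in_hat; split=> // n.
  exact: ideal0.
- split=> [|t]; first by rewrite size_cat addn1 sth size_map.
  rewrite mem_cat inE => /orP[/thm //|/eqP ->].
  apply: mGro; rewrite roio; apply/in_contract.
  exact: (ideal_eq (ym y (mem_head _ _)) (esym (addr0 y))).
- move=> ts h0; have := theta_layer st h0; rewrite hat_squares => h.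
  have /= := reg (theta y :: map (@ps_const E) ts) h.
  by rewrite -catA /= -map_comp.
move=> q hq Zq thq.
have [|ysq mGq] := D q hq Zq; first by move=> t tth; apply: thq; rewrite mem_cat tth.
have th : io (theta y) \ini q by apply: thq; rewrite mem_cat mem_head orbT.
have xv : io (ps_const y * ps_var E) \ini q.
  apply/Zq/ioZ/in_hat; rewrite ps_constM mulr0; split=> [|n]; first exact: ideal0.
  by rewrite ps_constM; apply: add_ideal_gen.
have yq : io (ps_const y) \ini q.
  (* Here [y (y + v) - y v] is [y ^ 2], so a prime containing [y + v] and [y v] contains [y], and
     then [v]. *)
  have : io (ps_const y) * io (ps_const y) \ini q.
    apply: ideal_eq (ideal_sub (ideal_mull (io (ps_const y)) th) xv) _.
    by rewrite /theta !rmorphD !rmorphM; ring.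
  by case/hq.2.
have vq : io (ps_var E) \ini q.
  by apply: ideal_eq (ideal_sub th yq) _; rewrite /theta rmorphD; ring.
split=> [z|hmq].
  rewrite inE => /predU1P[->|zys] //=; apply: ysq; exact: map_f.
apply: mGq => f /in_contract fm; rewrite (ps_decomp f) rmorphD rmorphM.
by apply: ideal_add; [apply: (hmq _ fm)|apply: ideal_mulr].
Qed.

End Tower.

Lemma quotient_lift (R S : comPzRingType) (I : ideal R) (f : {rmorphism R -> S}) :
  (forall a, a \ini I -> f a = 0) ->
  exists f' : {rmorphism quotient_ring I -> S}, forall a, f' (qpi I a) = f a.
Proof.
move=> fI; pose f0 (u : quotient_ring I) : S := f (quotient_repr u).
have f0E a : f0 (qpi I a) = f a.
  by apply/eqP; rewrite eq_sym -subr_eq0 -rmorphB fI //; apply: quotient_pi_repr.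
have f0B : zmod_morphism f0.
  move=> u v; have [[a ->] [b ->]] := (qpi_surj u, qpi_surj v).
  by rewrite -(rmorphB (qpi I)) !f0E rmorphB.
have f0M : monoid_morphism f0.
  split=> [|u v]; first by rewrite -(rmorph1 (qpi I)) f0E rmorph1.
  have [[a ->] [b ->]] := (qpi_surj u, qpi_surj v).
  by rewrite -(rmorphM (qpi I)) !f0E rmorphM.
by exists (mkrm f0B f0M).
Qed.

Section LocalQuotient.
Variables (G : comPzRingType) (Z m : ideal G).
Hypotheses (hm : noetherian_local m) (Zm : {subset Z <= m}).

Lemma local_quotient : exists m' : ideal (quotient_ring Z), noetherian_local m' /\
  forall g, g \ini m -> qpi Z g \ini m'.
Proof.
have mp : @submod_prop (quotient_ring Z) (quotient_ring Z)^o (fun u => exists2 g, g \ini m & u = qpi Z g).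
  split; first by exists 0; [exact: ideal0|rewrite rmorph0].
  move=> a _ _ [g gm ->] [h hm' ->]; have [b ->] := qpi_surj a.
  by exists (b * g + h); [apply: ideal_add => //; apply: ideal_mull|rewrite rmorphD rmorphM].
exists (submod_of mp); split; last by move=> g gm; apply/in_sub; exists g.
split.
  apply/noetherianP/(finite_noeth (local_noeth hm) (phi := qpi Z)).
  apply/fin_genP; exists [:: (1 : quotient_ring Z)] => u; have [g ->] := qpi_surj u.
  apply/span_cons; exists g; apply/span_nil.
  by rewrite /GRing.scale /= /restrict_scale /GRing.scale /= mulr1 subrr.
apply: local_ringI => [/in_sub[g gm] /esym|u um].
  rewrite -(rmorph1 (qpi Z)) => /qpi_eq/Zm h; apply: (local_not1 hm).
  by rewrite -(subKr g 1); apply: ideal_sub.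
have [g gE] := qpi_surj u; have [|b gb] := local_unit hm (a := g).
  by move=> gm; apply: um; apply/in_sub; exists g.
by exists (qpi Z b); rewrite gE -rmorphM gb rmorph1.
Qed.

End LocalQuotient.

(** * Finite subrings of Cohen-Macaulay local rings *)

Section FiniteSubring.
Variables (A B : comPzRingType) (mA : ideal A) (mB : ideal B).
Hypotheses (hA : noetherian_local mA) (hB : noetherian_local mB).
Variable io : {rmorphism A -> B}.
Hypotheses (ioi : injective io) (hfin : fin_gen (restrict_scalars io (B^o : lmodType B))).
Hypothesis cmB : cohen_macaulay mB (B^o : lmodType B).
Let nA := local_noeth hA.
Let BA : lmodType A := restrict_scalars io (B^o : lmodType B).

Lemma contract_zero a : a \ini contract io (sub0 B^o) -> a = 0.
Proof. by move=> /in_contract/in_sub0; rewrite -[X in _ = X](rmorph0 io) => /ioi. Qed.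

Lemma has_dim_sub d : has_dim B d -> has_dim A d.
Proof.
have E k : chain (sub0 B^o) k <-> chain (sub0 A^o) k.
  rewrite -(chain_contract nA hfin); split; apply: chain_mono => a.
    by move=> /in_sub0 ->; apply: ideal0.
  by move=> /contract_zero ->; apply/in_sub0.
by rewrite /has_dim !E.
Qed.

Lemma lc_vanishes_sub d : has_dim B d -> lc_vanishes mA BA d.
Proof.
move=> hd j jd z; have idl : linear (@id BA) by [].
have [f /bij_iso[_ fs]] := @lc_iso_restrict _ _ _ _ hA hB io hfin (B^o) _ (mklin idl) j%:Z
  (fun x y e => e) (fun y => ex_intro _ y erefl).
have [w <-] := fs z.
by rewrite (iffLR (cohen_macaulayP hB hd) cmB j jd w) linear0.
Qed.

Let fgB : fgm BA. Proof. exact/fin_genP. Qed.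

Section Dimension.
Variable d : nat.
Hypothesis hd : has_dim B d.

Let sq (r : seq A) : seq A := [seq y * y | y <- r].
Let Ir (r : seq A) : ideal A := add_squares (sub0 A^o) r.
Let Nr (r : seq A) : lmodType A := quotient_mod (gen_sub (sq r) BA).

(* The regular lists of [B / (squares of r) B] need not be regular on
   [A / (squares of r)]; [x] bounds the failure of the latter. *)
Definition colon_killer (x : A) (r : seq A) : Prop :=
  forall y zs, regular_list (y :: zs) (Nr r) -> (size zs < d.+1)%N ->
    forall a : A^o, y *: a \in gsub (Ir r) zs -> x *: a \in gsub (Ir r) zs.

Fixpoint colon_killers (r : seq A) : Prop :=
  if r is x :: r' then colon_killer x r' /\ colon_killers r' else True.

Lemma squares_act r a (b : BA) : a \ini Ir r -> a *: b \in gen_sub (sq r) BA.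
Proof.
elim: r a b => [|y r IH] a b; first by move=> /in_sub0 ->; rewrite scale0r rpred0.
move=> /in_add_ideal[c h]; apply/in_gen_sub; exists (c *: b).
by rewrite scalerA -scalerBl; apply: IH.
Qed.

Lemma squares_sub r (q : ideal A) : (forall y, y \in r -> y \ini q) -> {subset Ir r <= q}.
Proof.
elim: r => [|y r IH] h a; first by move=> /in_sub0 ->; apply: ideal0.
move=> /in_add_ideal[c /IH ac]; rewrite -(subrK (y * y * c) a); apply: ideal_add.
  by apply: ac => z zr; apply: h; rewrite inE zr orbT.
by rewrite -mulrA; apply: ideal_mulr; apply: h; apply: mem_head.
Qed.

(** As [x] avoids the primes of dimension [d - size r] over the squares, adding [x * x] lowers the
    dimension. *)
Lemma extend_parameters r : (size r < d)%N -> ~ chain (Ir r) (d - size r).+1 ->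
  exists x, [/\ x \ini mA, colon_killer x r & ~ chain (Ir (x :: r)) (d - size r)].
Proof.
move=> rd nch.
(* A prime of [B] over [p] contains the squares times [B], but not the image of an element outside
   [p]; so [B] modulo the squares has full support. *)
have suppN p : prime_ideal p -> {subset Ir r <= p} -> {subset ann (Nr r) <= p}.
  move=> hp Ip a /in_sub aN.
  have [|Q [hQ _ cQ]] := @lying_over _ _ io nA hfin (sub0 B^o) p hp.
    by move=> b /contract_zero ->; apply: ideal0.
  have aB : a *: (1 : BA) \in gen_sub (sq r) BA by apply/qmap0; rewrite linearZ; apply: aN.
  have sub : {subset gen_sub (sq r) BA <= restrict_sub io Q}.
    apply: gsub_le => [b /in_sub0 ->|_ b /mapP[y yr ->]]; first exact: rpred0.
    apply/in_sub; apply: ideal_mulr; apply/in_contract; rewrite cQ; apply: Ip.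
    elim: (r) yr => // z r' IH; rewrite inE => /predU1P[->|/IH h]; last exact: add_ideal_base.
    by rewrite -[z * z]mulr1; apply: add_ideal_gen.
  rewrite -cQ; apply/in_contract; have /in_sub := sub _ aB.
  by rewrite /GRing.scale /= /restrict_scale /GRing.scale /= mulr1.
have IN (a : A) (x : Nr r) : a \ini Ir r -> a *: x = 0.
  by move=> aI; have [b ->] := qmap_surj x; rewrite -linearZ; apply/qmap0/squares_act.
have [x [xm xoff xk]] := @uniform_killer _ _ hA (Ir r) (Nr r) (d - size r) d.+1
  (fgm_quot _ fgB) IN suppN nch (etrans (subn_gt0 _ _) rd).
exists x; split=> // -[P [hP sP IP]].
have hP0 := hP 0%N (leq0n _).
apply: (xoff (P 0%N)).
  split=> //; last by exists P; split.
  by move=> a aI; apply: IP; apply: add_ideal_base.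
apply: (prime_expn hP0 (n := 2)); apply: IP; rewrite expr2 -[x * x]mulr1; exact: add_ideal_gen.
Qed.

Lemma parameters_exist k : (k <= d)%N -> exists r, [/\ size r = k, forall y, y \in r -> y \ini mA,
  colon_killers r & ~ chain (Ir r) (d - k).+1].
Proof.
elim: k => [|k IH] kd.
  exists [::]; split=> //; rewrite subn0; exact: (has_dim_sub hd).2.
have [r [rk rm rkill rch]] := IH (ltnW kd).
have [||x [xm xk xch]] := @extend_parameters r; rewrite ?rk //.
exists (x :: r); split=> [|y||]; rewrite /= ?rk //.
  by rewrite inE => /predU1P[->|/rm].
by move: xch; rewrite rk -subSn.
Qed.

Lemma gsub_cons_ideal (I : ideal A) z zs :
  gsub I (z :: zs) = add_ideal (gsub I zs : ideal A) z :> ideal A.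
Proof.
apply: submod_eq => a; apply/idP/idP; first by move=> /in_gsub[b h]; apply/in_add_ideal; exists b.
by move=> /in_add_ideal[b h]; apply/in_gsub; exists b.
Qed.

Lemma gsub_squares (I : ideal A) zs r :
  gsub (add_squares I r) zs = add_squares (gsub I zs : ideal A) r.
Proof. by elim: zs => // z zs IH; rewrite !gsub_cons_ideal IH add_squares_ideal. Qed.

Lemma regular_list_cat (l1 l2 : seq A) (M : lmodType A) : regular_list (l1 ++ l2) M ->
  regular_list l1 (quotient_mod (gen_sub l2 M)).
Proof.
elim: l1 => //= y l1 IH [/IH h reg]; split=> // u; have [x ->] := qmap_surj u.
by rewrite -linearZ !gsub_quot /gsub -foldr_cat; apply: reg.
Qed.

(** The colon by [x_k ^ 2], modulo some earlier parameters and the squares of the later ones, is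
    killed by [x_k], because the corresponding list is regular on [B]. *)
Lemma stable_parameters r : size r = d -> (forall y, y \in r -> y \ini mA) -> colon_killers r ->
  (forall q, prime_ideal q -> (forall y, y \in r -> y \ini q) -> {subset mA <= q}) ->
  stable_list (sub0 A^o) r.
Proof.
move=> rd rm rkill sop; pose x k : A := r`_k.
have rE k : (k < d)%N -> drop k r = x k :: drop k.+1 r by move=> kd; rewrite (drop_nth 0) ?rd.
have killk k : (k < d)%N -> colon_killer (x k) (drop k.+1 r).
  move=> kd; suff : colon_killers (drop k r) by rewrite rE // => -[].
  elim: k r rkill {rd rm sop rE kd} @x => [|k IH] r' rkill x; first by rewrite drop0.
  by case: r' rkill x => //= y r' [_ h] x; apply: IH.
(* The list [s] records which earlier parameters have been added along the branches of
   [stable_list]. *)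
suff H j k : (j + k = d)%N -> forall s : seq nat, uniq s -> (forall l, l \in s -> (l < k)%N) ->
    stable_list (gsub (sub0 A^o) [seq x l | l <- s] : ideal A) (drop k r).
  by have := H d 0%N (addn0 d) [::] isT; rewrite drop0; apply.
elim: j k => [|j IH] k jk s us sk; first by rewrite drop_oversize // rd -jk.
have kd : (k < d)%N by rewrite -jk addSn ltnS leq_addl.
rewrite rE //=; split; last 2 first.
- by apply: IH => //; rewrite ?addnS -?addSn // => l /sk h; apply: leqW.
- rewrite -gsub_cons_ideal -[x k :: _]/[seq x l | l <- k :: s]; apply: IH; first by rewrite addnS -addSn.
    by rewrite /= us andbT; apply/negP => /sk; rewrite ltnn.
  by move=> l; rewrite inE => /predU1P[->//|/sk h]; apply: leqW.
move=> a; rewrite -gsub_squares mulrA => h.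
apply: (killk k kd (x k * x k)); last exact: h; last first.
  rewrite size_map ltnS -(size_iota 0 d); apply: uniq_leq_size => // l /sk lk.
  by rewrite mem_iota /= (ltn_trans lk).
apply: regular_list_cat.
(* Earlier parameters enter with exponent 1, the current one and all later ones with exponent 2. *)
pose e l := if (l < k)%N then 1%N else 2%N.
pose t := k :: s ++ iota k.+1 (d - k.+1).
have -> : (x k * x k :: [seq x l | l <- s]) ++ sq (drop k.+1 r) = [seq x l ^+ e l | l <- t].
  rewrite /t /= map_cat /e ltnn expr2; congr (_ :: _ ++ _).
    by apply/eq_in_map => l /sk ->; rewrite expr1.
  have -> : drop k.+1 r = [seq x l | l <- iota k.+1 (d - k.+1)].
    apply: (@eq_from_nth _ 0) => [|l]; rewrite size_drop ?size_map ?size_iota rd // => ld.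
    by rewrite nth_drop (nth_map 0%N) ?size_iota // nth_iota.
  rewrite /sq -map_comp; apply/eq_in_map => l; rewrite mem_iota => /andP[kl _] /=.
  by rewrite ltnNge (ltnW kl) /= expr2.
apply: (@sop_regular A mA hA BA d x e fgB (lc_vanishes_sub hd) _ _ t _ _).1.
- by move=> l ld; apply: rm; apply: mem_nth; rewrite rd.
- by move=> q hq xq; apply: sop => // y /(nthP 0)[l]; rewrite rd => ld <-; apply: xq.
- rewrite /t /= cat_uniq us iota_uniq mem_cat negb_or mem_iota ltnn /= !andbT.
  apply/andP; split; first by apply/negP => /sk; rewrite ltnn.
  apply/hasPn => l; rewrite mem_iota => /andP[kl _]; apply/negP => /sk lk.
  by move: (ltn_trans lk kl); rewrite ltnn.
move=> l; rewrite /t inE mem_cat mem_iota subnKC //.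
by move=> /or3P[/eqP -> //|/sk lk|/andP[] //]; apply: ltn_trans lk kd.
Qed.

End Dimension.

Lemma quotient_of_cm_finite_sub : quotient_of_cm_local A.
Proof.
have [d hd] := has_dim_exists hB.
have [r [rd rm rkill rch]] := parameters_exist hd (leqnn d).
have sop q : prime_ideal q -> (forall y, y \in r -> y \ini q) -> {subset mA <= q}.
  move=> hq rq; apply: contrapT => mq; apply: rch; rewrite subnn.
  apply: (chain_mono (squares_sub rq)); apply: (chain_cons hq (prime_sub_local hA hq) mq).
  exact: chain0 (local_prime hA) _.
have st := stable_parameters hd rd rm rkill sop.
have [G [Z [mG [i [ro [ths [[hG roi mGro] [Zro iZ] [sth thm] reg D]]]]]]] :=
  tower_exists erefl hA rm st.
have Zm : {subset Z <= mG}.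
  by move=> z /Zro/in_sub0 h; apply: mGro; rewrite h; apply: ideal0.
have [m' [hm' mq]] := local_quotient hG Zm.
have [|f fE] := @quotient_lift _ _ Z ro; first by move=> z /Zro/in_sub0.
exists (quotient_ring Z), m', f; split=> // [|a]; last first.
  by exists (qpi Z (i a)); rewrite fE.
have [e he] := has_dim_exists hm'.
(* A prime over [Z] and the [d] elements [ths] contains [mG], so the quotient has dimension at most
   [d]; their regularity makes the cohomology vanish below [d]. *)
have ed : (e <= d)%N.
  rewrite -rd -sth; apply: (@chain_bound _ (local_noeth hG) mG Z ths e hG thm).
    move=> q hq Zq thq; have [rq mGq] := D q hq Zq thq; apply: mGq => a am.
    apply/in_contract; apply: sop am => [|y yr]; first exact: contract_prime.
    exact/in_contract/rq.
  by apply/chain_quotient/prime_chain_chain; case: he.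
apply/(cohen_macaulayP hm' he) => j je.
have hseq : regular_seq (sub0 (quotient_ring Z)^o) [seq qpi Z t | t <- ths].
  have := reg [::] I; rewrite cats0.
  apply: (iffLR (regular_seq_transfer (p := qpi Z) (t := qpi Z) (K := sub0 _) _ _ _ _)).
  - exact: rmorphB.
  - by move=> u; have [g ->] := qpi_surj u; exists g.
  - by move=> u g _; rewrite rmorphM.
  - by move=> g; rewrite in_sub0 qpi_eq0.
have h := regular_seq_lc hm' hseq.
have v : lc_vanishes m' (quotient_mod (sub0 (quotient_ring Z)^o)) d.
  rewrite -rd -sth -(size_map (qpi Z)); apply: h => _ /mapP[t /thm tm ->]; exact: mq.
have [reg0 surj0] : injective (qmap (sub0 (quotient_ring Z)^o)) /\
    forall y, exists x, qmap (sub0 (quotient_ring Z)^o) x = y.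
  split=> [u w /qmap_eq/in_sub0/eqP|y]; first by rewrite subr_eq0 => /eqP.
  by have [x ->] := qmap_surj y; exists x.
apply: (iffRL (lc_vanishes_iso hm' d reg0 surj0) v).
exact: leq_trans je ed.
Qed.

End FiniteSubring.

(** * Fibre products *)

Section FibreProduct.
Variables (R S B : comPzRingType) (phi : {rmorphism R -> S}) (f : {rmorphism B -> S}).

Definition pullback_pred : {pred B} := fun b => `[< exists r, phi r = f b >].

Lemma pullback_subring : subring_closed pullback_pred.
Proof.
split=> [|x y|x y]; first by apply/asboolP; exists 1; rewrite !rmorph1.
  by move=> /asboolP[r rx] /asboolP[s sy]; apply/asboolP; exists (r - s); rewrite !rmorphB rx sy.
by move=> /asboolP[r rx] /asboolP[s sy]; apply/asboolP; exists (r * s); rewrite !rmorphM rx sy.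
Qed.

HB.instance Definition _ := GRing.isSubringClosed.Build B pullback_pred pullback_subring.

Record pullback := Pullback { pullback_val : B; _ : pullback_val \in pullback_pred }.
HB.instance Definition _ := [isSub for pullback_val].
HB.instance Definition _ := [Choice of pullback by <:].
HB.instance Definition _ := GRing.SubChoice_isSubComPzRing.Build B pullback_pred pullback pullback_subring.

Lemma pullback_valB : zmod_morphism pullback_val. Proof. by []. Qed.
Lemma pullback_valM : monoid_morphism pullback_val. Proof. by []. Qed.
Definition pullback_incl : {rmorphism pullback -> B} := mkrm pullback_valB pullback_valM.

Lemma pullback_incl_inj : injective pullback_incl. Proof. exact: val_inj. Qed.

Lemma pullbackP b : (exists r, phi r = f b) -> exists a, pullback_incl a = b.
Proof.
move=> h; have hb : b \in pullback_pred by apply/asboolP.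
by exists (Pullback hb).
Qed.

Hypotheses (phii : injective phi) (fs : forall y, exists x, f x = y).

Lemma pullback_proj : exists p : {rmorphism pullback -> R},
  (forall a, phi (p a) = f (pullback_incl a)) /\ forall r, exists a, p a = r.
Proof.
have h (a : pullback) : exists r, phi r = f (pullback_incl a) by case: a => b hb; apply/asboolP.
have [p pP] := choice h.
have pB : zmod_morphism p by move=> a b; apply: phii; rewrite rmorphB !pP !rmorphB.
have pM : monoid_morphism p.
  by split=> [|a b]; apply: phii; rewrite ?rmorph1 ?rmorphM !pP ?rmorph1 ?rmorphM.
exists (mkrm pB pM); split=> // r; have [b bE] := fs (phi r).
have [|a aE] := @pullbackP b; first by exists r.
by exists a; apply: phii; rewrite /= pP aE.
Qed.

Lemma pullback_kernel b : f b = 0 -> exists k, pullback_incl k = b.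
Proof. by move=> fb; apply: pullbackP; exists 0; rewrite rmorph0 fb. Qed.

Section Finite.
Variables (mR : ideal R) (mS : ideal S) (mB : ideal B).
Hypotheses (hR : noetherian_local mR) (hS : noetherian_local mS) (hB : noetherian_local mB).
Hypothesis hfin : fin_gen (restrict_scalars phi (S^o : lmodType S)).
Local Notation io := pullback_incl.
Let BA : lmodType pullback := restrict_scalars io (B^o : lmodType B).

(** Lifts of generators of [S] over [R] correct an element of [B] until it lies in the kernel of
    [f], which is part of the fibre product and is covered by the generator 1. *)
Lemma pullback_finite : fin_gen BA.
Proof.
apply/fin_genP; have [s sS] := finite_span hfin.
have [g gP] := choice fs.
exists ((1 : B) :: [seq g y | y <- s]) => b.
suff h y : y \in span s -> forall b : BA, f (b : B) = y ->
    b \in span ((1 : B) :: [seq g y | y <- s] : seq BA) by apply: (h (f b)).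
elim: s y {sS} => [|v s IH] y.
  move=> /span_nil -> c /pullback_kernel[k kE].
  apply/span_cons; exists k; apply/span_nil; apply/eqP; rewrite subr_eq0; apply/eqP.
  by rewrite /GRing.scale /= /restrict_scale /GRing.scale /= mulr1.
case/span_cons=> r yr c cy.
have [|a aE] := @pullbackP (g (phi r)); first by exists r; rewrite gP.
have E : f (c - io a * g v) = y - r *: (v : restrict_scalars phi (S^o : lmodType S)).
  by rewrite rmorphB rmorphM aE !gP cy.
have /span_cons[k ks] := IH _ yr _ E.
apply/span_cons; exists k; apply/span_cons; exists a.
by rewrite addrAC.
Qed.

Variable p : {rmorphism pullback -> R}.
Hypotheses (pE : forall a, phi (p a) = f (io a)) (ps : forall r, exists a, p a = r).

Lemma pullback_proj0 a : p a = 0 <-> f (io a) = 0.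
Proof. by rewrite -pE -[X in _ <-> _ = X](rmorph0 phi); split=> [->|/phii]. Qed.

Lemma ker_prop (U V : comPzRingType) (h : {rmorphism U -> V}) :
  @submod_prop U U^o (fun a => h a = 0).
Proof.
split=> [|a u v hu hv]; first exact: rmorph0.
by rewrite rmorphD rmorphM hu hv mulr0 addr0.
Qed.

Let K : ideal pullback := submod_of (ker_prop p).

Lemma incl_linear : linear (io : pullback^o -> BA).
Proof. by []. Qed.
Let ioL : {linear pullback^o -> BA} := mklin incl_linear.

Lemma restrict_fgs (J : ideal B) : fgs J -> fgs (restrict_sub io J).
Proof.
have lv : linear (@submod_val _ _ J : restrict_scalars io (submod_type J) -> BA) by [].
move=> /fgs_sub_type/fin_genP/(restrict_fg pullback_finite)[s sJ].
exists (map (mklin lv) s); split=> [_ /mapP[u _ ->]|x /in_sub xJ].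
  by apply/in_sub; apply: valP.
exact: (@span_map _ _ _ (mklin lv) s (SubmodType xJ)).
Qed.

(** As a set [K] is the kernel of [f], finitely generated over [B], and [B] is finite over the fibre
    product. *)
Lemma pullback_kernel_fg : fgs K.
Proof.
have [s [sf fsp]] := restrict_fgs (iffLR (noetherianP B) hB.1 (submod_of (ker_prop f))).
have [t [tK ts]] : exists t, {subset t <= K} /\ map ioL t = s.
  elim: s sf {fsp} => [|v s IH] sf; first by exists [::].
  case: IH => [x xs|t [tK <-]]; first by apply: sf; rewrite inE xs orbT.
  have /in_sub/in_sub fv := sf v (mem_head _ _); have [k kE] := pullback_kernel fv.
  exists (k :: t); split=> [x|/=]; last by rewrite -[v]kE.
  by rewrite inE => /predU1P[->|/tK //]; apply/in_sub/pullback_proj0; rewrite kE.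
exists t; split=> // a /in_sub/pullback_proj0 fa.
have /fsp : ioL a \in restrict_sub io (submod_of (ker_prop f)) by apply/in_sub/in_sub.
by rewrite -ts => /span_map_inv[x xt /pullback_incl_inj ->].
Qed.

Lemma pullback_above_fg (J : ideal pullback) : {subset K <= J} -> fgs J.
Proof.
move=> KJ; have [k [kK Kk]] := pullback_kernel_fg.
have Ip : @submod_prop R R^o (fun r => exists2 a, a \ini J & p a = r).
  split; first by exists 0; [exact: ideal0|exact: rmorph0].
  move=> c _ _ [a aJ <-] [b bJ <-]; have [d <-] := ps c.
  by exists (d * a + b); [apply: ideal_add => //; apply: ideal_mull|rewrite rmorphD rmorphM].
have [s [sI Is]] := iffLR (noetherianP R) hR.1 (submod_of Ip).
have [t [tJ ts]] : exists t : seq pullback^o, {subset t <= J} /\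
    forall r, r \in span s -> exists2 y, y \in span t & p y = r.
  elim: s sI {Is} => [|v s IH] sI.
    by exists [::]; split=> // r /span_nil ->; exists 0; [exact: rpred0|exact: rmorph0].
  case: IH => [x xs|t [tJ ts]]; first by apply: sI; rewrite inE xs orbT.
  have /in_sub[a aJ av] := sI v (mem_head _ _).
  exists (a :: t); split=> [x|r /span_cons[c /ts[y yt yE]]].
    by rewrite inE => /predU1P[->|/tJ].
  have [d dc] := ps c; exists (y + d * a); first by apply/span_cons; exists d; rewrite addrK.
  by rewrite rmorphD rmorphM yE dc av subrK.
exists (t ++ k); split=> [x|x xJ].
  by rewrite mem_cat => /orP[/tJ //|/kK /KJ].
have [|y yt yE] := ts (p x); first by apply: Is; apply/in_sub; exists x.
rewrite -(subrK y x) addrC; apply: rpredD; [exact: span_catl|apply: span_catr].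
by apply: Kk; apply/in_sub; rewrite rmorphB yE subrr.
Qed.

(** The kernel absorbs coefficients from [B], so [K] times a span over [B] falls into the span over
    the fibre product. *)
Lemma ker_mul_span (s : seq pullback^o) (x : B^o) k : x \in span (map io s : seq B^o) -> k \ini K ->
  exists2 y, y \in span s & io k * x = io y.
Proof.
move=> + /in_sub/pullback_proj0 fk; elim: s x => [|a s IH] x.
  by move=> /span_nil ->; exists 0; rewrite ?rpred0 ?rmorph0 ?mulr0.
case/span_cons=> c /IH[y ys yE]; have [|d dE] := @pullback_kernel (io k * c).
  by rewrite rmorphM fk mul0r.
exists (y + d * a); first by apply/span_cons; exists d; rewrite addrK.
by rewrite rmorphD rmorphM dE -yE mulrBr -mulrA subrK.
Qed.

(** Choose finitely many [s] in [I] with [s B = I B]. Then [K] times [I B] lies in the span of [s],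
    so modulo this span [I B] is a finite module on which only ideals above [K] matter, and these
    come from [R]. *)
Lemma pullback_noeth : noeth pullback^o.
Proof.
move=> I.
pose F (J : ideal B) := exists s : seq pullback^o, {subset s <= I} /\ J = span (map io s : seq B^o).
have [|J [[s [sI JE]] Jmax]] := @noeth_max _ _ F (iffLR (noetherianP B) hB.1).
  by exists (span [::]), [::].
have IJ a : a \ini I -> io a \ini J.
  move=> aI; apply: (Jmax (span (map io (a :: s) : seq B^o))); last exact: mem_span (mem_head _ _).
    by exists (a :: s); split=> // x; rewrite inE => /predU1P[->|/sI].
  by rewrite JE => x xs; apply/span_cons; exists 0; rewrite scale0r subr0.
have [t [tJ Jt]] := restrict_fgs (iffLR (noetherianP B) hB.1 J).
have sI' := span_sub sI.
have [|v k /tJ/in_sub vJ kK|_ /in_sub[x xs ->]|_ /in_sub[x xI ->]|u [uI Iu]] :=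
  @noeth_span_rel _ K BA (image_sub ioL (span s)) t _ _ (image_sub ioL I).
- exact: pullback_above_fg.
- rewrite JE in vJ; have [y ys yE] := ker_mul_span vJ kK.
  by apply/in_sub; exists y.
- by apply/in_sub; exists x => //; apply: sI'.
- by apply: subDr; apply: Jt; apply/in_sub/IJ.
have [w [wI wu]] : exists w, {subset w <= I} /\ map ioL w = u.
  elim: u uI {Iu} => [|v u IH] uI; first by exists [::].
  case: IH => [x xu|w [wI <-]]; first by apply: uI; rewrite inE xu orbT.
  have /in_sub[a aI ->] := uI v (mem_head _ _).
  by exists (a :: w); split=> // x; rewrite inE => /predU1P[->|/wI].
exists (s ++ w); split=> [x|x xI]; first by rewrite mem_cat => /orP[/sI|/wI].
have /Iu/in_sub[_ /in_sub[y ys ->]] : ioL x \in image_sub ioL I by apply/in_sub; exists x.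
rewrite -wu => /span_map_inv[z zw E].
have -> : x = y + z.
  by apply: pullback_incl_inj; rewrite rmorphD; apply/eqP; rewrite addrC -subr_eq; apply/eqP.
by apply: rpredD; [exact: span_catl|exact: span_catr].
Qed.

(** Let [a] be invertible in [B]. Its image in [S] is a unit, so [p a] is a unit of [R], and its
    inverse shows that the inverse of [a] belongs to the fibre product. *)
Lemma pullback_local : noetherian_local (contract io mB).
Proof.
split; first exact/noetherianP/pullback_noeth.
apply: local_ringI => [/in_contract|a am].
  by rewrite rmorph1; apply: (local_not1 hB).
have [|b ab] := local_unit hB (a := io a); first by move=> h; apply: am; apply/in_contract.
have fab : phi (p a) * f b = 1 by rewrite pE -rmorphM ab rmorph1.
have [|r ar] := local_unit hR (a := p a).
  move=> /(contract_local hfin hR hS) h; apply: (local_not1 hS).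
  by rewrite -fab; apply: ideal_mulr.
have [|c cb] := @pullbackP b.
  exists r; rewrite -[LHS]mulr1 -fab mulrA -rmorphM [r * _]mulrC ar rmorph1.
  exact: mul1r.
by exists c; apply: pullback_incl_inj; rewrite rmorphM cb ab rmorph1.
Qed.

End Finite.

End FibreProduct.

Lemma quotient_of_cm_local_down (R S : comPzRingType) (mR : ideal R) (mS : ideal S)
    (phi : {rmorphism R -> S}) :
  noetherian_local mR -> noetherian_local mS -> module_finite_extension phi ->
  quotient_of_cm_local S -> quotient_of_cm_local R.
Proof.
move=> hR hS [phii hfin] [B [mB [f [hB cmB fs]]]].
have [p [pE ps]] := pullback_proj phii fs.
have hA := pullback_local phii fs hR hS hB hfin pE ps.
have [A [mA [g [hmA cmA gs]]]] := quotient_of_cm_finite_sub hA hB (@pullback_incl_inj _ _ _ phi f)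
  (pullback_finite fs hfin) cmB.
exists A, mA, (p \o g); split=> // r.
have [a <-] := ps r; have [x <-] := gs a; by exists x.
Qed.

Theorem theorem1p2 (R S : comNzRingType) (m : ideal R) (n : ideal S)
    (hR : noetherian_local m) (hS : noetherian_local n)
    (phi : {rmorphism R -> S}) (hphi : module_finite_extension phi)
    (N : lmodType S) (hN : fin_gen N) :
  let NR : lmodType R := restrict_scalars phi N in
  [/\ forall i : int,
        [/\ exists f : {linear restrict_scalars phi (local_cohomology n i N) ->
                                local_cohomology m i NR}, bijective f,
            artinian (restrict_scalars phi (local_cohomology n i N)),
            artinian (local_cohomology m i NR) &
            (exists x : local_cohomology n i N, x != 0) ->
              mod_dim (local_cohomology n i N) =
              mod_dim (local_cohomology m i NR)],
      [/\ cohen_macaulay n N <-> cohen_macaulay m NR,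
          generalized_cohen_macaulay n N <-> generalized_cohen_macaulay m NR &
          one_cohen_macaulay n N <-> one_cohen_macaulay m NR],
      [/\ sequentially n (cohen_macaulay n) N <->
            sequentially m (cohen_macaulay m) NR,
          sequentially n (generalized_cohen_macaulay n) N <->
            sequentially m (generalized_cohen_macaulay m) NR &
          sequentially n (one_cohen_macaulay n) N <->
            sequentially m (one_cohen_macaulay m) NR] &
      quotient_of_cm_local R <-> quotient_of_cm_local S].
Proof.
move=> NR; have [phii hfin] := hphi.
have fgN : fgm NR by apply: restrict_fg => //; apply/fin_genP.
have dimE (V : lmodType S) (W : lmodType R) (psi : {linear restrict_scalars phi V -> W}) :
    injective psi -> (forall y, exists x, psi x = y) -> lc_ann_dim n V = lc_ann_dim m W.
  exact: lc_ann_dim_restrict.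
have idl : linear (@id NR) by [].
have dimN : lc_ann_dim n N = lc_ann_dim m NR.
  by apply: (@dimE N _ (mklin idl)) => // y; exists y.
(* All the notions are conditions on [lc_ann_dim], so a single transfer, for an arbitrary condition
   [C], covers the three sequential cases. *)
have seqE (C : \bar int -> Prop) :
    sequentially n (fun V => C (lc_ann_dim n V)) N <->
    sequentially m (fun W => C (lc_ann_dim m W)) NR.
  by apply: sequentially_restrict => // V W psi psii psis; rewrite (dimE _ _ psi).
split; last by split; [exact: (quotient_of_cm_local_up hS hfin)|exact: (quotient_of_cm_local_down hR hS hphi)].
- move=> i.
  have [f fb] := @lc_iso_restrict _ _ _ _ hR hS phi hfin N _ (mklin idl) i
    (fun x y e => e) (fun y => ex_intro _ y erefl).
  have [fi fs] := bij_iso fb.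
  have artR : artinian (local_cohomology m i NR).
    case: i {f fb fi fs} => [k|k]; first exact: lc_artinian.
    by apply: artinian_zero => x; exact: thinmx0.
  split=> //; first by exists f.
    exact: artinian_inj fi artR.
  by move=> _; apply: (mod_dim_restrict hR hfin fi fs).
- by rewrite /cohen_macaulay /generalized_cohen_macaulay /one_cohen_macaulay dimN.
- split.
  + exact: (seqE (fun d => d = (-1)%:E)).
  + exact: (seqE (fun d => d <= 0%:E)%E).
  + exact: (seqE (fun d => d <= 1%:E)%E).
Qed.
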